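(* Let $\phi=(f_0:f_1:f_2):\mathbb{P}^1\to\mathbb{P}^2$ be a generically $1$-to-$1$ parametrization of a rational plane curve $\mathcal{C}$ of degree $d\geq 3$ over $\mathbb{C}$, and let $X_2\subset\mathbb{P}^2=\operatorname{Proj}(\mathbb{C}[u_0,u_1,u_2])$ be the subscheme defined by the $(d+1)$-minors of the matrix $\mathbb{M}_2$ associated with $\phi$. The degree of the scheme $X_2\subset\mathbb{P}^2$ is equal to $\delta(\mathcal{C})=(d-1)(d-2)/2$. Moreover, the curve $\mathcal{C}$ is cuspidal if and only if the support of $X_2$ is contained in $V(u_1^2-4u_0u_2)\subset\mathbb{P}^2$.
   Context: Here $f_0,f_1,f_2\in\mathbb{C}[s,t]$ are homogeneous of the same degree $d$ with $\gcd(f_0,f_1,f_2)=1$, $\mathcal{C}$ is the image of $\phi$, and generically $1$-to-$1$ means that the fiber over a generic point of $\mathcal{C}$ is a single point (so $\deg\mathcal{C}=d$). Write $f_j=\sum_{i=0}^d a_{j,i}s^{d-i}t^i$. The matrix $\mathbb{M}_2$: let $\mathbb{A}=\mathbb{C}[u_0,u_1,u_2]$ and $P_2(s,t)=u_0s^2+u_1st+u_2t^2$. $\mathbb{M}_2$ is the $(d+1)\times(d+2)$ matrix with entries in $\mathbb{A}$ whose columns are the coefficient vectors, in the basis $s^d,s^{d-1}t,\dots,t^d$, of the $d-1$ forms $s^{d-2}P_2,\ s^{d-3}tP_2,\dots,t^{d-2}P_2$ followed by $f_0,f_1,f_2$. That is, it is the matrix of the degree-$d$ part of the graded map $(P_2,f_0,f_1,f_2):\mathbb{A}[s,t](-2)\oplus\mathbb{A}[s,t](-d)^3\to\mathbb{A}[s,t]$.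 $\delta(\mathcal{C})=\sum_P\delta_P$ is the sum of the delta invariants of the singular points of $\mathcal{C}$. A rational curve is cuspidal if all of its singular points are unibranch. *)

(* Defs.v *)
From HB Require Import structures.
From mathcomp Require Import all_boot all_order all_algebra.
From mathcomp Require Import complex.
From mathcomp Require Import reals.
From mathcomp Require Import mpoly.

Set Implicit Arguments.
Unset Strict Implicit.
Unset Printing Implicit Defensive.

Import GRing.Theory.
Local Open Scope ring_scope.

(* A point of P^n is a nonzero row vector P : 'rV[F]_n.+1; two of them are the
   same point when they span the same line, i.e. when (P == Q)%MS.  The value
   at P of a form A is A.@[P 0], P 0 being the coordinate function of P. *)

Section QuotientDimension.
Variables (F : fieldType) (E : zmodType) (scale : F -> E -> E).

(* dim_F V / (V \cap W) = n, for F-subspaces V and W of E *)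
Definition quotient_dim (V W : E -> Prop) (n : nat) : Prop :=
  exists b : 'I_n -> E, (forall i, V (b i)) /\
    forall x, V x ->
      exists! c : 'rV[F]_n, W (x - \sum_(i < n) scale (c 0 i) (b i)).

End QuotientDimension.

Section ProjectiveSubschemes.
Variables (F : fieldType) (n : nat).
Implicit Types I : {mpoly F[n.+1]} -> Prop.

Definition hilbert_value I (m h : nat) : Prop :=
  quotient_dim (fun a (x : {mpoly F[n.+1]}) => a *: x)
    (fun g => g \is m.-homog) I h.

(* The degree of Proj (F[u_0, ..., u_n] / I) is r! times the leading
   coefficient of its Hilbert polynomial, r being the degree of the latter. *)
Definition scheme_degree I (e : nat) : Prop :=
  exists (H : {poly rat}) (m0 : nat),
    (forall m, (m0 <= m)%N -> exists2 h, hilbert_value I m h & H.[m%:R] = h%:R)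
    /\ e%:R = ((size H).-1)`!%:R * lead_coef H.

Definition in_support I (u : 'rV[F]_n.+1) : Prop :=
  u != 0 /\ forall g, I g -> g.@[u 0] = 0.

End ProjectiveSubschemes.

Section Parametrization.
Variables (F : fieldType) (f : 3.-tuple {mpoly F[2]}).
Implicit Types (p q : 'rV[F]_2) (P Q : 'rV[F]_3) (A B G : {mpoly F[3]}).

Definition gcd_is_one : Prop :=
  forall g : {mpoly F[2]}, (forall j, exists h, tnth f j = g * h) ->
    g \is a GRing.unit.

Definition param p : 'rV[F]_3 := \row_j (tnth f j).@[p 0].

Definition in_fiber P p : Prop := p != 0 /\ (param p == P)%MS.

Definition on_curve P : Prop := P != 0 /\ exists p, in_fiber P p.

(* The fiber is a single point over a nonempty open subset, which may be taken
   of the form {G <> 0}, of the curve. *)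
Definition generically_one_to_one : Prop :=
  exists (e : nat) (G : {mpoly F[3]}),
    [/\ G \is e.-homog,
        exists2 P, on_curve P & G.@[P 0] != 0
      & forall P, on_curve P -> G.@[P 0] != 0 ->
          forall p q, in_fiber P p -> in_fiber P q -> (p == q)%MS].

Definition vanishes_on_curve G : Prop :=
  forall P, on_curve P -> G.@[P 0] = 0.

(* Jacobian criterion: the Jacobian matrix of the homogeneous ideal of the
   curve has rank < codim = 1 at P. *)
Definition singular_point P : Prop :=
  on_curve P /\
  forall (e : nat) G, G \is e.-homog -> vanishes_on_curve G ->
    forall j, G^`M(j).@[P 0] = 0.

(* A |-> A(f_0, f_1, f_2) identifies the homogeneous coordinate ring of the
   curve with F[f_0, f_1, f_2]; hence the function field of the curve and its
   local rings are realized below as subrings of F(s, t). *)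
Definition ratio A B : {fraction {mpoly F[2]}} :=
  tofrac (A \mPo f) / tofrac (B \mPo f).

Definition function_field (x : {fraction {mpoly F[2]}}) : Prop :=
  exists (e : nat) A B,
    [/\ A \is e.-homog, B \is e.-homog, B \mPo f != 0 & x = ratio A B].

(* for P on the curve *)
Definition local_ring P (x : {fraction {mpoly F[2]}}) : Prop :=
  exists (e : nat) A B,
    [/\ A \is e.-homog, B \is e.-homog, B.@[P 0] != 0 & x = ratio A B].

(* integral closure of the local ring at P in the function field *)
Definition normalized_local_ring P (x : {fraction {mpoly F[2]}}) : Prop :=
  function_field x /\
  exists h : {poly {fraction {mpoly F[2]}}},
    [/\ h \is monic, forall i, local_ring P h`_i & root h x].

Definition delta_invariant P (n : nat) : Prop :=
  quotient_dim (fun a (x : {fraction {mpoly F[2]}}) => tofrac a%:MP * x)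
    (normalized_local_ring P) (local_ring P) n.

(* s lists the singular points of the curve, each exactly once *)
Definition singular_locus (s : seq 'rV[F]_3) : Prop :=
  [/\ forall P, P \in s -> singular_point P,
      forall P, singular_point P -> exists2 Q, Q \in s & (P == Q)%MS
    & pairwise (fun P Q => ~~ (P == Q)%MS) s].

Definition total_delta (n : nat) : Prop :=
  exists (s : seq 'rV[F]_3) (delta : 'rV[F]_3 -> nat),
    [/\ singular_locus s, forall P, P \in s -> delta_invariant P (delta P)
      & n = (\sum_(P <- s) delta P)%N].

(* the normalized local ring is a local ring *)
Definition unibranch P : Prop :=
  let O := normalized_local_ring P in
  let invertible x := [/\ O x, x != 0 & O x^-1] in
  forall x y, O x -> O y -> invertible (x + y) -> invertible x \/ invertible y.

Definition cuspidal : Prop := forall P, singular_point P -> unibranch P.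

(* P_2 = u_0 s^2 + u_1 s t + u_2 t^2, with u_i = 'X_i in F[u_0, u_1, u_2],
   s = 'X_0 and t = 'X_1 *)
Definition P2 : {mpoly {mpoly F[3]}[2]} :=
  'X_0 *: 'X_0 ^+ 2 + 'X_1 *: ('X_0 * 'X_1) + 'X_(inord 2) *: 'X_1 ^+ 2.

Definition M2_form (d j : nat) : {mpoly {mpoly F[3]}[2]} :=
  if (j < d.-1)%N then 'X_0 ^+ (d - 2 - j) * 'X_1 ^+ j * P2
  else map_mpoly (@mpolyC 3 F) (tnth f (inord (j - d.-1))).

Definition M2 (d : nat) : 'M[{mpoly F[3]}]_(d.+1, d.+2) :=
  \matrix_(i, j) (M2_form d j)@_(U_(ord0) *+ (d - i) + U_(ord_max) *+ i)%MM.

(* the ideal generated by the (d+1)-minors of M2 *)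
Definition X2 (d : nat) (g : {mpoly F[3]}) : Prop :=
  exists c : 'I_d.+2 -> {mpoly F[3]},
    g = \sum_(j < d.+2) c j * \det (col' j (M2 d)).

End Parametrization.

(* Main.v *)
(* Write N = (d-1)(d-2)/2.

   Delta invariant.  Choose a line l = 0 meeting the curve transversally in d
   points with d distinct preimages p_1, ..., p_d.  Splitting off multiples of l
   shows that, in large degree jd, the forms on P^1 modulo those coming from the
   curve have dimension N; hence so do the regular functions on P^1 minus
   {l = 0} modulo those of the affine curve.  The normalization of the local ring
   at P is the ring of functions that are regular along the fiber over P, and a
   Chinese remainder argument splits that quotient of dimension N into the
   local quotients at the singular points.  The same description shows that P is
   unibranch if and only if its fiber is a single point.

   Degree of X_2.  Evaluating forms of degree d at p turns a row of M_2 into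
   (P_2(p) times the evaluation of forms of degree d-2, phi(p)).  On the line
   P_2(p_1) = 0 of the plane of quadratic forms, P_2 is the product of a fixed
   and of a variable linear form, and the evaluations at p_1, ..., p_d, whose
   images are collinear, make all relations between the minors explicit: they
   come from the rows of M_2.  It follows that P_2(p_1) is a nonzerodivisor
   modulo the ideal I of minors, and that I together with P_2(p_1) contains
   everything in degrees at least d-2, where I starts.  So the Hilbert function
   of I is constant from degree d-3 on, with the value N = dim C[u]_{d-3}.

   Support.  M_2 drops rank at u if and only if some functional on the forms of
   degree d kills f_0, f_1, f_2 and the multiples of P_2(u).  If the
   discriminant of u is nonzero, P_2(u) has two distinct roots p, q, such a
   functional is a combination of the evaluations at p and q, and it exists if
   and only if phi(p) = phi(q). *)
Require Import Defs.
From HB Require Import structures.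
From mathcomp Require Import all_boot all_order all_algebra.
From mathcomp Require Import perm complex.
From mathcomp Require Import reals.
From mathcomp Require Import mpoly.
From mathcomp Require Import boolp.
From mathcomp Require Import zify ring.
Set Implicit Arguments.
Unset Strict Implicit.
Unset Printing Implicit Defensive.
Import GRing.Theory Num.Theory.
Local Open Scope ring_scope.

(** * Dimensions of quotients *)

Section QuotientDim.
Variable F : fieldType.

(** Delta invariants live in integral closures inside an abstract fraction field, while the count is
    made on graded pieces. The bridge is the finite dimension N: birationality, local nilpotence and
    the conductor all come from comparing a number of functions with N, and integrality from the
    finite local quotients. N itself arises as (d-2) + (d-3) + ...: on the line l = 0 the curve
    forms of degree m+1 restrict to the span of the first min(d, m+2) powers of a coordinate that
    takes d distinct values.

    No free resolution is used for X_2. Write n = d-2 and q_0, q_1, ... for p_2, p_3, ...;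
    collinearity gives phi(q_i) = al_i phi(p_1) + be_i phi(q_0). Pair a column killed by the
    restricted matrix with the evaluation at p_1: since P_2(p_1) = 0, its part facing phi(p_1) is
    zero, so its parts facing the phi(q_i) are be_i b for one polynomial b. Hence a combination of
    minors with coefficients a_i that vanishes on the line satisfies sum_i a_i w_i prod_(j != i) L_j
    = 0, where L_j is the linear form of q_j and w_i a nonzero constant. So a_i vanishes at q_i, and
    both claims about P_2(p_1) rest on this. *)

Record scalar_action (E : zmodType) (scale : F -> E -> E) : Prop := ScalarAction {
  sa_addr : forall a x y, scale a (x + y) = scale a x + scale a y;
  sa_addl : forall a b x, scale (a + b) x = scale a x + scale b x;
  sa_mul : forall a b x, scale (a * b) x = scale a (scale b x);
  sa_one : forall x, scale 1 x = x }.

Definition subspace (E : zmodType) (scale : F -> E -> E) (W : E -> Prop) : Prop :=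
  W 0 /\ forall a x y, W x -> W y -> W (scale a x + y).

Definition lcomb (E : zmodType) (scale : F -> E -> E) n (c : 'rV[F]_n)
  (b : 'I_n -> E) : E := \sum_(i < n) scale (c 0 i) (b i).

Section OneSpace.
Variables (E : zmodType) (scale : F -> E -> E) (sE : scalar_action scale).
Implicit Types (V W : E -> Prop).
Local Notation lcomb := (lcomb scale).
Local Notation subspace := (subspace scale).
Local Notation qdim := (quotient_dim scale).

Lemma act0l x : scale 0 x = 0.
Proof. by apply: (addIr (scale 0 x)); rewrite -(sa_addl sE) !add0r. Qed.

Lemma act0r a : scale a 0 = 0.
Proof. by apply: (addIr (scale a 0)); rewrite -(sa_addr sE) !add0r. Qed.

Lemma actNl a x : scale (- a) x = - scale a x.
Proof. by apply: (addIr (scale a x)); rewrite -(sa_addl sE) !addNr act0l. Qed.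

Lemma actNr a x : scale a (- x) = - scale a x.
Proof. by apply: (addIr (scale a x)); rewrite -(sa_addr sE) !addNr act0r. Qed.

Lemma act_suml a (I : Type) (r : seq I) (P : pred I) (G : I -> E) :
  scale a (\sum_(i <- r | P i) G i) = \sum_(i <- r | P i) scale a (G i).
Proof. by apply: (big_morph _ (sa_addr sE a) (act0r a)). Qed.

Lemma act_sumr x (I : Type) (r : seq I) (P : pred I) (G : I -> F) :
  scale (\sum_(i <- r | P i) G i) x = \sum_(i <- r | P i) scale (G i) x.
Proof.
apply: (big_morph (fun a => scale a x)); last exact: act0l.
by move=> a b; rewrite (sa_addl sE).
Qed.

Lemma lcombD n (c c' : 'rV_n) b : lcomb (c + c') b = lcomb c b + lcomb c' b.
Proof.
by rewrite /lcomb -big_split; apply: eq_bigr => i _; rewrite mxE (sa_addl sE).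
Qed.

Lemma lcombZ n a (c : 'rV_n) b : lcomb (a *: c) b = scale a (lcomb c b).
Proof.
by rewrite /lcomb act_suml; apply: eq_bigr => i _; rewrite mxE (sa_mul sE).
Qed.

Lemma lcombN n (c : 'rV_n) b : lcomb (- c) b = - lcomb c b.
Proof.
by rewrite /lcomb -sumrN; apply: eq_bigr => i _; rewrite mxE actNl.
Qed.

Lemma lcombB n (c c' : 'rV_n) b : lcomb (c - c') b = lcomb c b - lcomb c' b.
Proof. by rewrite lcombD lcombN. Qed.

Lemma lcomb0 n b : lcomb (0 : 'rV_n) b = 0.
Proof. by rewrite /lcomb big1 // => i _; rewrite mxE act0l. Qed.

Lemma lcomb_row_mx m n (c : 'rV_m) (c' : 'rV_n) b :
  lcomb (row_mx c c') b = lcomb c (b \o lshift n) + lcomb c' (b \o @rshift m n).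
Proof.
rewrite /lcomb big_split_ord; congr (_ + _); apply: eq_bigr => i _.
  by rewrite row_mxEl.
by rewrite row_mxEr.
Qed.

Lemma lcomb_mulmx m n (c : 'rV_m) (M : 'M_(m, n)) b :
  lcomb (c *m M) b = lcomb c (fun i => lcomb (row i M) b).
Proof.
rewrite /lcomb; under [RHS]eq_bigr do rewrite act_suml.
rewrite exchange_big /=; apply: eq_bigr => j _; rewrite mxE act_sumr.
by apply: eq_bigr => i _; rewrite mxE (sa_mul sE).
Qed.

Lemma lcombDr n (c : 'rV_n) b b' :
  lcomb c (fun i => b i + b' i) = lcomb c b + lcomb c b'.
Proof. by rewrite /lcomb -big_split; apply: eq_bigr => i _; rewrite (sa_addr sE). Qed.

Lemma lcombBr n (c : 'rV_n) b b' :
  lcomb c (fun i => b i - b' i) = lcomb c b - lcomb c b'.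
Proof.
by rewrite /lcomb -sumrB; apply: eq_bigr => i _; rewrite (sa_addr sE) actNr.
Qed.

Section Subspace.
Variables (W : E -> Prop) (sW : subspace W).

Lemma sub0 : W 0. Proof. by case: sW. Qed.

Lemma subD x y : W x -> W y -> W (x + y).
Proof. by case: sW => _ H Wx Wy; have := H 1 x y Wx Wy; rewrite (sa_one sE). Qed.

Lemma subZ a x : W x -> W (scale a x).
Proof. by case: sW => W0 H Wx; have := H a x 0 Wx W0; rewrite addr0. Qed.

Lemma subN x : W x -> W (- x).
Proof. by move=> /(subZ (-1)); rewrite actNl (sa_one sE). Qed.

Lemma subB x y : W x -> W y -> W (x - y).
Proof. by move=> Wx /subN; apply: subD. Qed.

Lemma subBC x y : W (x - y) -> W (y - x).
Proof. by move/subN; rewrite opprB. Qed.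

Lemma sub_sum (I : Type) (r : seq I) (P : pred I) (G : I -> E) :
  (forall i, P i -> W (G i)) -> W (\sum_(i <- r | P i) G i).
Proof. by move=> WG; apply: big_ind => //; [exact: sub0 | exact: subD]. Qed.

Lemma sub_lcomb n (c : 'rV_n) b : (forall i, W (b i)) -> W (lcomb c b).
Proof. by move=> Wb; apply: sub_sum => i _; apply: subZ. Qed.

End Subspace.

Lemma subspaceI V W : subspace V -> subspace W -> subspace (fun x => V x /\ W x).
Proof.
case=> V0 HV [W0 HW]; split=> // a x y [Vx Wx] [Vy Wy].
by split; [apply: HV | apply: HW].
Qed.

Definition basis_mod V W n (b : 'I_n -> E) : Prop :=
  [/\ forall i, V (b i), forall x, V x -> exists c, W (x - lcomb c b)
    & forall c, W (lcomb c b) -> c = 0].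

Lemma qdimP V W n : subspace V -> subspace W ->
  qdim V W n <-> exists b, @basis_mod V W n b.
Proof.
move=> sV sW; split=> -[b].
  move=> [Vb H]; exists b; split=> // [x /H [c [Wc _]] | c Wc].
    by exists c.
  have [c0 [_ Hc0]] := H 0 (sub0 sV).
  rewrite -[c]opprK -(Hc0 (- c)) ?(Hc0 0) ?oppr0 //.
    by rewrite -/(lcomb _ _) lcomb0 subrr; apply: sub0.
  by rewrite -/(lcomb _ _) lcombN sub0r opprK.
move=> [Vb span indep]; exists b; split=> // x /span [c Wc].
exists c; split=> // c' Wc'; apply/eqP; rewrite -subr_eq0; apply/eqP/indep.
by rewrite lcombB; have := subB sW Wc' Wc; rewrite opprB addrC addrA subrK.
Qed.

(** Row i of [A] holds the coordinates of [y i] modulo [W]. Unlike a single dependency, a matrix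
    lets the conditions of two families be imposed on the same coefficients. *)
Lemma qdim_relations V W n m (y : 'I_m -> E) : subspace V -> subspace W ->
  qdim V W n -> (forall i, V (y i)) ->
  exists A : 'M_(m, n), forall c : 'rV_m, c *m A = 0 -> W (lcomb c y).
Proof.
move=> sV sW /(qdimP _ sV sW) [b [Vb span _]] Vy.
have /choice [M HM] : forall i, exists c, W (y i - lcomb c b) by move=> i; apply: span.
exists (\matrix_(i, j) M i 0 j) => c cA.
have -> : lcomb c y = lcomb c (fun i => y i - lcomb (M i) b)
                    + lcomb (c *m \matrix_(i, j) M i 0 j) b.
  rewrite lcomb_mulmx -lcombDr; apply: eq_bigr => i _; congr (scale _ _).
  rewrite (_ : row i _ = M i) ?subrK //; apply/rowP => j; by rewrite !mxE.
by rewrite cA lcomb0 addr0; apply: sub_lcomb.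
Qed.

Lemma kernel_vector n m (A : 'M[F]_(m, n)) : (n < m)%N ->
  exists2 c : 'rV_m, c != 0 & c *m A = 0.
Proof.
move=> lt_nm; have : kermx A != 0.
  rewrite kermx_eq0 /row_free; apply/eqP => rA.
  by have := rank_leq_col A; rewrite rA leqNgt lt_nm.
by case/rowV0Pn => c /sub_kermxP cA c0; exists c.
Qed.

Lemma qdim_dep V W n m (y : 'I_m -> E) : subspace V -> subspace W ->
  qdim V W n -> (n < m)%N -> (forall i, V (y i)) ->
  exists2 c : 'rV_m, c != 0 & W (lcomb c y).
Proof.
move=> sV sW Q lt_nm /(qdim_relations sV sW Q) [A HA].
by have [c c0 /HA] := kernel_vector A lt_nm; exists c.
Qed.

Lemma qdim_uniq V W n m : subspace V -> subspace W ->
  qdim V W n -> qdim V W m -> n = m.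
Proof.
move=> sV sW; wlog le_nm : n m / (n <= m)%N => [H Hn Hm|].
  by case/orP: (leq_total n m) => le; [|symmetry]; apply: H.
move=> Hn /(qdimP _ sV sW) [b [Vb _ ind]]; apply/eqP; rewrite eqn_leq le_nm.
rewrite leqNgt; apply/negP => /(qdim_dep sV sW Hn) /(_ Vb) [c c0 /ind].
by move/eqP: c0.
Qed.

Lemma qdim_ext V V' W W' n : (forall x, V x <-> V' x) ->
  (forall x, V x -> (W x <-> W' x)) -> subspace V -> qdim V W n -> qdim V' W' n.
Proof.
move=> eV eW sV [b [Vb H]]; exists b; split=> [i|x /eV Vx]; first exact/eV.
have [c [Wc Hc]] := H _ Vx; exists c.
have V'c c' : V (x - lcomb c' b) by apply: subB => //; apply: sub_lcomb.
by split=> [|c' /(eW _ (V'c _)) /Hc //]; apply/(eW _ (V'c _)).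
Qed.

Definition spanned V W n : Prop := exists b : 'I_n -> E,
  (forall i, V (b i)) /\ forall x, V x -> exists c, W (x - lcomb c b).

Lemma qdim_spanned V W n : subspace V -> subspace W ->
  spanned V W n -> exists m, qdim V W m.
Proof.
move=> sV sW; elim: n => [|n IHn] [b [Vb span]].
  by exists 0%N; apply/qdimP => //; exists b; split=> // c _; apply/rowP; case.
case: (EM (forall c, W (lcomb c b) -> c = 0)) => [ind|].
  by exists n.+1; apply/qdimP => //; exists b.
case/existsNP => c /not_implyP [Wc /eqP c0].
have [k ck] : exists k, c 0 k != 0.
  by apply/rV0Pn.
apply: IHn; exists (b \o lift k); split=> [i|x /span [c' Wc']]; first exact: Vb.
pose a := c' 0 k / c 0 k; exists (\row_i (c' - a *: c) 0 (lift k i)).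
have -> : lcomb (\row_i (c' - a *: c) 0 (lift k i)) (b \o lift k)
        = lcomb (c' - a *: c) b.
  rewrite /lcomb (bigD1_ord k) //= !mxE divfK // subrr act0l add0r.
  by apply: eq_bigr => i _; rewrite !mxE.
rewrite lcombB lcombZ opprB addrA addrAC; apply: subD => //.
exact: subZ.
Qed.

Lemma qdim_coarser V W W' n : subspace V -> subspace W -> subspace W' ->
  (forall x, W x -> W' x) -> qdim V W n -> exists m, qdim V W' m.
Proof.
move=> sV sW sW' WW' /(qdimP _ sV sW) [b [Vb span _]].
apply: (@qdim_spanned _ _ n) => //; exists b; split=> // x /span [c /WW'].
by exists c.
Qed.

(** The count behind the Chinese remainder theorem: a basis modulo [W1] is moved into [W2], one
    modulo [W2] into [W1], and both together form a basis modulo the intersection. *)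
Lemma qdimI V W1 W2 n1 n2 : subspace V -> subspace W1 -> subspace W2 ->
  (forall x, V x -> exists y, [/\ V y, W1 (y - x) & W2 y]) ->
  (forall x, V x -> exists y, [/\ V y, W2 (y - x) & W1 y]) ->
  qdim V W1 n1 -> qdim V W2 n2 -> qdim V (fun x => W1 x /\ W2 x) (n1 + n2).
Proof.
move=> sV sW1 sW2 crt1 crt2 /(qdimP _ sV sW1) [b1 [Vb1 span1 ind1]].
move=> /(qdimP _ sV sW2) [b2 [Vb2 span2 ind2]].
apply/qdimP => //; first exact: subspaceI.
have /choice [e1 He1] := fun i => crt1 _ (Vb1 i).
have /choice [e2 He2] := fun i => crt2 _ (Vb2 i).
pose b i := match split i with inl i => e1 i | inr i => e2 i end.
have bl : b \o lshift n2 = e1.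
  by apply/funext => i; rewrite /b /= (unsplitK (inl i)).
have br : b \o @rshift n1 n2 = e2.
  by apply/funext => i; rewrite /b /= (unsplitK (inr i)).
have D1 c : W1 (lcomb c e1 - lcomb c b1) /\ W2 (lcomb c e1).
  rewrite -lcombBr; split; apply: sub_lcomb => // i; first by case: (He1 i).
  by case: (He1 i).
have D2 c : W2 (lcomb c e2 - lcomb c b2) /\ W1 (lcomb c e2).
  rewrite -lcombBr; split; apply: sub_lcomb => // i; first by case: (He2 i).
  by case: (He2 i).
exists b; split.
- by move=> i; rewrite /b; case: split => j; [case: (He1 j) | case: (He2 j)].
- move=> x Vx; have [c1 Wc1] := span1 x Vx; have [c2 Wc2] := span2 x Vx.
  exists (row_mx c1 c2); rewrite lcomb_row_mx bl br.
  have [A1 A2] := D1 c1; have [B1 B2] := D2 c2; split.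
    have := subB sW1 (subB sW1 Wc1 A1) B2.
    by congr W1; rewrite opprB !opprD addrA addrA subrK.
  have := subB sW2 (subB sW2 Wc2 B1) A2.
  by congr W2; rewrite opprB !opprD addrA subrK addrA addrAC.
- move=> c; rewrite -[c]hsubmxK lcomb_row_mx bl br => -[Wc1 Wc2].
  have [A1 A2] := D1 (lsubmx c); have [B1 B2] := D2 (rsubmx c).
  have -> : lsubmx c = 0.
    apply: ind1; have := subB sW1 (subB sW1 Wc1 B2) A1.
    by rewrite addrK subKr.
  have -> : rsubmx c = 0.
    apply: ind2; have := subB sW2 (subB sW2 Wc2 A2) B1.
    by rewrite [lcomb _ e1 + _]addrC addrK subKr.
  by rewrite row_mx0.
Qed.

End OneSpace.

Section TwoSpaces.
Variables (E E' : zmodType) (scale : F -> E -> E) (scale' : F -> E' -> E').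
Variables (sE : scalar_action scale) (sE' : scalar_action scale').

(** Dimension count in a short exact sequence: [phi] embeds V/W into V'/W' and [w] is a basis of the
    cokernel. With [k = 0] it transports a dimension along an isomorphism. *)
Lemma qdim_step (phi : E -> E') V W V' W' n k (w : 'I_k -> E') :
  (forall a x y, phi (scale a x + y) = scale' a (phi x) + phi y) ->
  subspace scale V -> subspace scale W ->
  subspace scale' V' -> subspace scale' W' ->
  (forall x, V x -> V' (phi x)) -> (forall x, W x -> W' (phi x)) ->
  (forall i, V' (w i)) ->
  (forall y, V' y -> exists x c, V x /\ W' (y - phi x - lcomb scale' c w)) ->
  (forall x c, V x -> W' (phi x + lcomb scale' c w) -> c = 0 /\ W x) ->
  quotient_dim scale V W n -> quotient_dim scale' V' W' (n + k).
Proof.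
move=> phiP sV sW sV' sW' phiV phiW V'w span' ind' /(qdimP sE _ sV sW).
move=> [b [Vb span ind]]; apply/(qdimP sE') => //.
have phi0 : phi 0 = 0.
  have := phiP 1 0 0; rewrite (act0r sE) (sa_one sE') addr0 => H.
  by apply: (addIr (phi 0)); rewrite add0r -H.
have phiD x y : phi (x + y) = phi x + phi y.
  by have := phiP 1 x y; rewrite (sa_one sE) (sa_one sE').
have phiZ a x : phi (scale a x) = scale' a (phi x).
  by have := phiP a x 0; rewrite phi0 !addr0.
have phiL c : phi (lcomb scale c b) = lcomb scale' c (phi \o b).
  rewrite /lcomb (big_morph phi phiD phi0); by apply: eq_bigr => i _; rewrite phiZ.
pose b' i := match split i with inl i => phi (b i) | inr i => w i end.
have bl : b' \o lshift k = phi \o b.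
  by apply/funext => i; rewrite /b' /= (unsplitK (inl i)).
have br : b' \o @rshift n k = w.
  by apply/funext => i; rewrite /b' /= (unsplitK (inr i)).
exists b'; split.
- by move=> i; rewrite /b'; case: split => j; auto.
- move=> y /span' [x [c' [Vx W'y]]]; have [c Wc] := span x Vx.
  exists (row_mx c c'); rewrite lcomb_row_mx bl br -phiL.
  have := subD sE' sW' W'y (phiW _ Wc); congr W'.
  have -> : phi x = phi (x - lcomb scale c b) + phi (lcomb scale c b).
    by rewrite -phiD subrK.
  by rewrite [phi (_ - _) + _]addrC !opprD !addrA [LHS]addrAC subrK.
- move=> c; rewrite -[c]hsubmxK lcomb_row_mx bl br -phiL => H.
  have [] := ind' _ _ _ H; first by apply: sub_lcomb.
  by move=> -> /ind ->; rewrite row_mx0.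
Qed.

End TwoSpaces.
End QuotientDim.

(** * Homogeneous polynomials and binary forms *)

Section Homogeneous.
Variables (n : nat) (R : comNzRingType).
Implicit Types (p q A : {mpoly R[n]}).

Lemma homog_mdeg e A m : A \is e.-homog -> m \in msupp A -> mdeg m = e.
Proof. by move/dhomogP; apply. Qed.

Lemma homog_decomp e A : A \is e.+1.-homog ->
  exists B : 'I_n -> {mpoly R[n]},
    (forall i, B i \is e.-homog) /\ A = \sum_i 'X_i * B i.
Proof.
move=> /homog_mdeg hA; rewrite [A]mpolyE big_seq.
elim/big_rec: _ => [|m q m_in [B [hB ->]]].
  by exists (fun=> 0); split=> [i|]; rewrite ?rpred0 // big1 // => i _; rewrite mulr0.
have [i mi] : exists i, m i != 0%N.
  apply: contrapT => H; have := hA _ m_in; rewrite mdegE big1 // => i _.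
  by apply: contrapT => mi; apply: H; exists i; apply/eqP.
exists (fun j => B j + if j == i then A@_m *: 'X_[m - U_(i)] else 0); split=> [j|].
  rewrite rpredD // 1?hB //; case: eqP => _; last exact: rpred0.
  rewrite rpredZ // dhomogX; apply/eqP.
  have : mdeg (m - U_(i) + U_(i)) = e.+1 by rewrite submK ?hA // lep1mP.
  by rewrite mdegD mdeg1 addn1 => -[].
rewrite addrC; under [RHS]eq_bigr do rewrite mulrDr.
rewrite big_split /=; congr (_ + _).
rewrite (bigD1 i) //= eqxx big1 ?addr0 => [|j /negPf ->]; last by rewrite mulr0.
by rewrite -scalerAr -mpolyXD addmC submK // lep1mP.
Qed.

Lemma homog0C A : A \is 0.-homog -> A = (A@_0%MM)%:MP.
Proof.
move=> hA; apply/mpolyP => m; rewrite mcoeffC; case: eqP => [->|/eqP m0].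
  by rewrite mulr1.
by rewrite mulr0 (dhomog_nemf_coeff hA) // mdeg_eq0.
Qed.

Lemma homogC (c : R) : (c%:MP : {mpoly R[n]}) \is 0.-homog.
Proof. by rewrite -alg_mpolyC rpredZ // dhomog1. Qed.

Lemma homogX i : ('X_i : {mpoly R[n]}) \is 1.-homog.
Proof. by rewrite dhomogX /= mdeg1. Qed.

Lemma homog_prod_var (I : Type) (r : seq I) (P : pred I)
    (G : I -> {mpoly R[n]}) (e : I -> nat) :
  (forall i, P i -> G i \is (e i).-homog) ->
  \prod_(i <- r | P i) G i \is (\sum_(i <- r | P i) e i)%N.-homog.
Proof.
move=> hG; elim: r => [|i r IHr]; first by rewrite !big_nil dhomog1.
by rewrite !big_cons; case: ifP => // Pi; apply: dhomogM => //; apply: hG.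
Qed.

Lemma homog_eval_scale e A (c : R) (v : 'I_n -> R) : A \is e.-homog ->
  A.@[fun i => c * v i] = c ^+ e * A.@[v].
Proof.
move/homog_mdeg => hA; rewrite !mevalE mulr_sumr !big_seq; apply: eq_bigr => m /hA <-.
rewrite [RHS]mulrCA mdegE -prodrXr -big_split /=; congr (_ * _).
by apply: eq_bigr => i _; rewrite exprMn.
Qed.

Lemma homog_deriv e A i : A \is e.+1.-homog -> A^`M(i) \is e.-homog.
Proof.
move=> hA; apply/dhomogP => m; rewrite mcoeff_msupp mcoeff_mderiv => nz.
apply/eqP; rewrite -eqSS -addn1 -[X in (_ + X)%N](mdeg1 i) -mdegD.
apply: contraR nz => /(dhomog_nemf_coeff hA) -> ; by rewrite mul0rn.
Qed.

Lemma meval_sum v (I : Type) (r : seq I) (P : pred I) (G : I -> {mpoly R[n]}) :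
  (\sum_(i <- r | P i) G i).@[v] = \sum_(i <- r | P i) (G i).@[v].
Proof. exact: raddf_sum. Qed.

Lemma mderiv_sum k (I : Type) (r : seq I) (P : pred I) (G : I -> {mpoly R[n]}) :
  (\sum_(i <- r | P i) G i)^`M(k) = \sum_(i <- r | P i) (G i)^`M(k).
Proof. exact: raddf_sum. Qed.

Lemma mderiv_var i j : ('X_j : {mpoly R[n]})^`M(i) = (i == j)%:R.
Proof.
rewrite mderivX mnm1E eq_sym; case: eqP => [->|_]; last by rewrite scale0r.
rewrite scale1r (_ : (_ - _)%MM = 0%MM) ?mpolyX0 //.
by apply/mnmP => k; rewrite mnmBE subnn mnm0E.
Qed.

End Homogeneous.

Section Composition.
Variables (n : nat) (R : comNzRingType).
Implicit Types (A : {mpoly R[n]}).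

Lemma homog_comp k m e A (w : n.-tuple {mpoly R[k]}) :
  (forall i, tnth w i \is e.-homog) -> A \is m.-homog ->
  A \mPo w \is (m * e).-homog.
Proof.
move=> hw /homog_mdeg hA; rewrite comp_mpolyEX big_seq; apply: rpred_sum => mo /hA <-.
rewrite rpredZ // comp_mpolyX mdegE big_distrl /=.
apply: (@homog_prod_var _ _ _ _ _ _ (fun i => mo i * e)%N) => i _.
by rewrite mulnC; apply: dhomogMn.
Qed.

Lemma comp_mpolyXi k i (w : n.-tuple {mpoly R[k]}) : 'X_i \mPo w = tnth w i.
Proof. by rewrite comp_mpolyXU (tnth_nth 0). Qed.

Lemma comp_mpolyM k (w : n.-tuple {mpoly R[k]}) : {morph comp_mpoly w : p q / p * q}.
Proof. exact: rmorphM. Qed.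

Lemma comp_mpoly_combination k (w : n.-tuple {mpoly R[k]}) m (v : 'I_m -> R)
    (A : 'I_m -> {mpoly R[n]}) : (\sum_i v i *: A i) \mPo w = \sum_i v i *: (A i \mPo w).
Proof. by rewrite raddf_sum; apply: eq_bigr => i _; rewrite /= comp_mpolyZ. Qed.

End Composition.

Section Vanishing.
Variables (n : nat) (F : fieldType).
Implicit Types (A B : {mpoly F[n]}).

(* [P j * X_k = (P j * X_k - P k * X_j) + P k * X_j] trades the factor [X_k]
   for [X_j], up to the claimed combination. *)
Lemma homog_vanish e A (P : 'rV[F]_n) j : P 0 j != 0 ->
  A \is e.+1.-homog -> A.@[P 0] = 0 ->
  exists B : 'I_n -> {mpoly F[n]}, (forall i, B i \is e.-homog) /\
    A = \sum_i (P 0 j *: 'X_i - P 0 i *: 'X_j) * B i.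
Proof.
move=> Pj; pose X i : {mpoly F[n]} := P 0 j *: 'X_i - P 0 i *: 'X_j.
elim: e A => [|e IHe] A hA A0.
  have [B [hB eA]] := homog_decomp hA; exists (fun i => (P 0 j)^-1 *: B i).
  split=> [i|]; first by apply: rpredZ; apply: hB.
  have: \sum_i P 0 i *: B i = 0.
    set S := \sum_i _; have hS : S \is 0.-homog.
      by apply: rpred_sum => i _; apply: rpredZ; apply: hB.
    rewrite (homog0C hS) -(mevalC (P 0) S@_0%MM) -(homog0C hS).
    rewrite (_ : _.@[_] = 0) ?mpolyC0 // -[RHS]A0 eA !raddf_sum /=.
    by apply: eq_bigr => i _; rewrite mevalM mevalXU mevalZ.
  move=> S0; under eq_bigr do rewrite -scalerAr mulrBl.
  rewrite -scaler_sumr sumrB; under [X in _ *: (_ - X)]eq_bigr do rewrite -scalerAl scalerAr.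
  rewrite -mulr_sumr S0 mulr0 subr0; under eq_bigr do rewrite -scalerAl.
  by rewrite -scaler_sumr scalerA mulVf // scale1r.
have [B [hB eA]] := homog_decomp hA.
pose A' := \sum_i P 0 i *: B i.
have hA' : A' \is e.+1.-homog by apply: rpred_sum => i _; apply: rpredZ; apply: hB.
have [|B' [hB' eA']] := IHe A' hA'.
  move: A0; rewrite eA !raddf_sum /= => A0.
  by rewrite -[RHS]A0; apply: eq_bigr => i _; rewrite mevalM mevalXU mevalZ.
exists (fun i => (P 0 j)^-1 *: (B i + 'X_j * B' i)); split=> [i|].
  apply: rpredZ; apply: rpredD; first exact: hB.
  by apply: (@dhomogM _ _ _ 1%N _ e); [exact: homogX | exact: hB'].
have -> : \sum_i X i * ((P 0 j)^-1 *: (B i + 'X_j * B' i)) =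
   (P 0 j)^-1 *: (\sum_i X i * B i + 'X_j * \sum_i X i * B' i).
  rewrite mulr_sumr -big_split /= scaler_sumr; apply: eq_bigr => i _.
  by rewrite -scalerAr mulrDr mulrCA.
rewrite -eA' /A' mulr_sumr -big_split /=.
rewrite eA scaler_sumr; apply: eq_bigr => i _.
rewrite mulrBl -!scalerAl -!scalerAr subrK scalerA mulVf // scale1r //.
Qed.

End Vanishing.

Section Lines.
Variable F : fieldType.

Lemma eqmx_rVP n (p q : 'rV[F]_n) :
  reflect (exists2 c, c != 0 & p = c *: q) (p == q)%MS.
Proof.
apply: (iffP idP) => [/andP [/sub_rVP [c ->] qp]|[c c0 ->]]; last first.
  by apply/eqmxP/eqmx_scale.
have [c0|] := eqVneq c 0; last by exists c.
exists 1; rewrite ?oner_eq0 //; case/sub_rVP: qp => b.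
by rewrite c0 scale0r !scaler0 => ->; rewrite scaler0.
Qed.

Lemma par_refl n (p : 'rV[F]_n) : (p == p)%MS.
Proof. by apply/eqmx_rVP; exists 1; rewrite ?oner_eq0 ?scale1r. Qed.

Lemma par_sym n (p q : 'rV[F]_n) : (p == q)%MS = (q == p)%MS.
Proof. by rewrite andbC. Qed.

Lemma par_trans n (p q r : 'rV[F]_n) : (p == q)%MS -> (q == r)%MS -> (p == r)%MS.
Proof. by move=> /eqmxP pq /eqmxP qr; apply/eqmxP; apply: eqmx_trans pq qr. Qed.

(** The determinant with rows [q] and [p]. For nonzero rows it vanishes exactly when they are the
    same point of P^1. *)
Definition br (p q : 'rV[F]_2) : F := p 0 1 * q 0 0 - p 0 0 * q 0 1.

Lemma brC p q : br p q = - br q p.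
Proof. by rewrite /br; ring. Qed.

Lemma brZr p c q : br p (c *: q) = c * br p q.
Proof. by rewrite /br !mxE; ring. Qed.

Lemma rV2P (p q : 'rV[F]_2) : p 0 0 = q 0 0 -> p 0 1 = q 0 1 -> p = q.
Proof.
move=> e0 e1; apply/rowP => i; have [->|->] : i = 0 \/ i = 1 => //.
by case: i => -[|[|//]] Hi; [left | right]; apply/val_inj.
Qed.

Lemma rV2_neq0 (p : 'rV[F]_2) : (p != 0) = (p 0 0 != 0) || (p 0 1 != 0).
Proof.
apply/idP/idP => [|]; last by apply: contraTneq => ->; rewrite !mxE eqxx.
by apply: contraR; rewrite negb_or !negbK => /andP [/eqP a /eqP b]; apply/eqP/rV2P; rewrite mxE.
Qed.

Lemma br_eq0 p q : p != 0 -> q != 0 -> (br p q == 0) = (p == q)%MS.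
Proof.
move=> p0 q0; apply/idP/idP; last first.
  by case/eqmx_rVP => c _ ->; rewrite brC brZr /br; apply/eqP; ring.
rewrite subr_eq0 => /eqP e; apply/eqmx_rVP.
move: (p0); rewrite rV2_neq0 => /orP [pi|pi].
  have q00 : q 0 0 != 0.
    apply: contraNneq q0 => z; apply/eqP/rV2P; rewrite mxE //.
    by move/eqP: e; rewrite z mulr0 eq_sym mulf_eq0 (negPf pi) => /eqP.
  exists (p 0 0 / q 0 0); first by rewrite mulf_neq0 ?invr_eq0.
  by apply: rV2P; rewrite !mxE ?divfK // mulrAC -e mulfK.
have q01 : q 0 1 != 0.
  apply: contraNneq q0 => z; apply/eqP/rV2P; rewrite mxE //.
  by move/eqP: e; rewrite z mulr0 mulf_eq0 (negPf pi) => /eqP.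
exists (p 0 1 / q 0 1); first by rewrite mulf_neq0 ?invr_eq0.
by apply: rV2P; rewrite !mxE ?divfK // mulrAC e mulfK.
Qed.

End Lines.

(** * Zeros, factorization and interpolation of binary forms *)

Section BinaryForms.
Variable F : fieldType.
Implicit Types (p q : 'rV[F]_2) (g h : {mpoly F[2]}).

Definition lin p : {mpoly F[2]} := p 0 1 *: 'X_0 - p 0 0 *: 'X_1.

Lemma lin_eval p q : (lin p).@[q 0] = br p q.
Proof. by rewrite mevalB !mevalZ !mevalXU. Qed.

Lemma lin_root p : (lin p).@[p 0] = 0.
Proof. by rewrite lin_eval /br; ring. Qed.

Lemma lin_homog p : lin p \is 1.-homog.
Proof. by apply: rpredB; apply: rpredZ; apply: homogX. Qed.

Lemma meval_rowZ n e c (v : 'rV[F]_n) (A : {mpoly F[n]}) : A \is e.-homog ->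
  A.@[(c *: v) 0] = c ^+ e * A.@[v 0].
Proof.
by move=> /homog_eval_scale <-; apply: meval_eq => i; rewrite mxE.
Qed.

Lemma form_par n e (g : {mpoly F[n]}) (p q : 'rV[F]_n) : g \is e.-homog -> (p == q)%MS ->
  g.@[q 0] = 0 -> g.@[p 0] = 0.
Proof. by move=> hg /eqmx_rVP [c _ ->]; rewrite (meval_rowZ _ _ hg) => ->; rewrite mulr0. Qed.

Lemma form_root e g p : p != 0 -> g \is e.+1.-homog -> g.@[p 0] = 0 ->
  exists2 h, h \is e.-homog & g = lin p * h.
Proof.
rewrite rV2_neq0 => /orP [p0|p1] hg g0.
  have [B [hB ->]] := homog_vanish p0 hg g0.
  exists (- B 1); first by rewrite rpredN; apply: hB.
  rewrite !big_ord_recl big_ord0 addr0 subrr mul0r add0r mulrN -mulNr opprB.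
  by congr (_ * _); [congr (_ *: 'X_ _ - _ *: 'X__) | congr B]; try congr (p 0 _); apply/val_inj.
have [B [hB ->]] := homog_vanish p1 hg g0.
exists (B 0) => //.
rewrite !big_ord_recl big_ord0 addr0.
have -> : lift ord0 (ord0 : 'I_1) = 1 :> 'I_2 by apply/val_inj.
by rewrite subrr mul0r addr0; congr (_ * _); congr B; apply/val_inj.
Qed.

Lemma const_form_eq0 n (g : {mpoly F[n]}) (p : 'rV[F]_n) : g \is 0.-homog -> g.@[p 0] = 0 -> g = 0.
Proof. by move=> /homog0C ->; rewrite mevalC => ->; rewrite mpolyC0. Qed.

Lemma lin_neq0 p : p != 0 -> lin p != 0.
Proof.
move=> p0; have [q q0] : exists q, br p q != 0.
  move: p0; rewrite rV2_neq0 => /orP [H|H].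
    by exists (\row_i (i == 1)%:R); rewrite /br !mxE eqxx mulr0 mulr1 sub0r oppr_eq0.
  by exists (\row_i (i == 0)%:R); rewrite /br !mxE eqxx mulr0 mulr1 subr0.
by apply: contraNneq q0 => l0; rewrite -lin_eval l0 meval0.
Qed.

Lemma form_nonroot e p : p != 0 ->
  exists2 m : {mpoly F[2]}, m \is e.-homog & m.@[p 0] != 0.
Proof.
rewrite rV2_neq0 => /orP [H|H]; [exists ('X_0 ^+ e) | exists ('X_1 ^+ e)];
  rewrite ?mevalXn ?rmorphXn /= ?mevalXU ?expf_neq0 //.
  by have := dhomogMn e (@homogX 2 F 0); rewrite mul1n.
by have := dhomogMn e (@homogX 2 F 1); rewrite mul1n.
Qed.

Section Points.
Variables (I : eqType) (pt : I -> 'rV[F]_2).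
Hypothesis pt0 : forall i, pt i != 0.
Hypothesis ptD : forall i j, i != j -> br (pt i) (pt j) != 0.

(** Splitting off [lin (pt i)] leaves a cofactor that still vanishes at the other points, because
    that linear form does not. When the points outnumber the degree, a constant with a zero is
    reached. *)
Lemma form_roots e g (s : seq I) : uniq s -> g \is e.-homog ->
  (forall i, i \in s -> g.@[pt i 0] = 0) ->
  if (size s <= e)%N then
    exists2 h, h \is (e - size s).-homog & g = (\prod_(i <- s) lin (pt i)) * h
  else g = 0.
Proof.
elim: s e g => [|i s IHs] e g /=.
  by move=> _ hg _; exists g; rewrite ?subn0 // big_nil mul1r.
move=> /andP [i_s us] hg g0; have gi := g0 _ (mem_head _ _).
case: e hg => [|e] hg; first exact: const_form_eq0 gi.
have [h hh eg] := form_root (pt0 i) hg gi.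
have h0 j : j \in s -> h.@[pt j 0] = 0.
  move=> j_s; have := g0 j; rewrite inE j_s orbT => /(_ isT) /eqP.
  rewrite eg mevalM lin_eval mulf_eq0 (negPf (ptD _)) /= => [/eqP //|].
  by apply: contraNneq i_s => ->.
have := IHs e h us hh h0; rewrite ltnS subSS; case: ifP => _ => [[k hk eh]|eh].
  by exists k => //; rewrite big_cons eg eh mulrA.
by rewrite eg eh mulr0.
Qed.

End Points.

Section FinPoints.
Variables (I : finType) (pt : I -> 'rV[F]_2).
Hypothesis pt0 : forall i, pt i != 0.
Hypothesis ptD : forall i j, i != j -> br (pt i) (pt j) != 0.

Lemma form_roots_in (P : pred I) e g : (#|P| <= e)%N -> g \is e.-homog ->
  (forall i, P i -> g.@[pt i 0] = 0) ->
  exists2 h, h \is (e - #|P|).-homog & g = (\prod_(i | P i) lin (pt i)) * h.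
Proof.
move=> le_e hg g0; have := @form_roots _ _ pt0 ptD _ _ (enum P) (enum_uniq _) hg.
by rewrite -cardE le_e big_enum; apply=> i; rewrite mem_enum; apply: g0.
Qed.

Lemma form_eq0 (P : pred I) e g : (e < #|P|)%N -> g \is e.-homog ->
  (forall i, P i -> g.@[pt i 0] = 0) -> g = 0.
Proof.
move=> lt_e hg g0; have := @form_roots _ _ pt0 ptD _ _ (enum P) (enum_uniq _) hg.
rewrite -cardE leqNgt lt_e /=; apply=> i; rewrite mem_enum; exact: g0.
Qed.

Lemma form_prod_homog (P : pred I) : \prod_(i | P i) lin (pt i) \is #|P|.-homog.
Proof.
have := @homog_prod_var _ _ _ (index_enum I) P (lin \o pt) (fun=> 1%N).
by rewrite sum1_card; apply=> i _; apply: lin_homog.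
Qed.

(** Lagrange interpolation; [m i], nonzero at [pt i], only fills the degree up to [e]. *)
Lemma form_interpolation (P : pred I) e (v : I -> F) : (#|P| <= e.+1)%N ->
  exists2 g, g \is e.-homog & forall i, P i -> g.@[pt i 0] = v i.
Proof.
move=> le_e.
have /choice [m Hm] : forall i, exists m : {mpoly F[2]},
    m \is (e - #|P|.-1).-homog /\ m.@[pt i 0] != 0.
  by move=> i; have [m] := form_nonroot (e - #|P|.-1) (pt0 i); exists m.
pose k i := (\prod_(j | P j && (j != i)) lin (pt j)) * m i.
have kE i j : P i -> P j -> (k i).@[pt j 0] != 0 -> i = j.
  move=> Pi Pj; apply: contraNeq => ij; rewrite /k (bigD1 j) //=; last by rewrite Pj eq_sym.
  by rewrite !mevalM lin_root !mul0r.
have kn i : P i -> (k i).@[pt i 0] != 0.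
  move=> Pi; rewrite mevalM mulf_neq0 ?(Hm i).2 // rmorph_prod /=.
  by apply/prodf_neq0 => j /andP [_ ji]; rewrite lin_eval ptD.
exists (\sum_(i | P i) (v i / (k i).@[pt i 0]) *: k i).
  apply: rpred_sum => i Pi; apply: rpredZ.
  have eE : (#|P|.-1 + (e - #|P|.-1))%N = e by move: le_e; lia.
  rewrite -eE; apply: dhomogM; last exact: (Hm i).1.
  have -> : #|P|.-1 = #|[pred j | P j & j != i]|.
    have iP : i \in P := Pi.
    by rewrite (cardD1 i P) iP add1n /=; apply: eq_card => j; rewrite !inE andbC.
  exact: form_prod_homog.
move=> i Pi; rewrite raddf_sum (bigD1 i) //= mevalZ divfK ?kn // big1 ?addr0 // => j.
move=> /andP [Pj ji]; rewrite mevalZ; apply/eqP; rewrite mulf_eq0; apply/orP; right.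
by apply: contraNT ji => /kE ->.
Qed.

End FinPoints.
End BinaryForms.

Section ClosedForms.
Variable F : closedFieldType.
Implicit Types (p q : 'rV[F]_2) (g h : {mpoly F[2]}).

Definition dehom g : {poly F} := mmap (@polyC F) (fun i : 'I_2 => if i == 0 then 'X else 1) g.

Lemma dehomE g x : (dehom g).[x] = g.@[fun i => if i == 0 then x else 1].
Proof.
rewrite /dehom /mmap horner_sum mevalE; apply: eq_bigr => m _.
rewrite hornerM hornerC horner_prod; congr (_ * _); apply: eq_bigr => i _.
by rewrite horner_exp; case: eqP => _; rewrite ?hornerX ?hornerC.
Qed.

Lemma size_dehom e g : g \is e.-homog -> (size (dehom g) <= e.+1)%N.
Proof.
move=> /homog_mdeg hg; rewrite /dehom /mmap big_seq.
elim/big_ind: _ => [|x y hx hy|m /hg <-]; first by rewrite size_poly0.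
  by apply: leq_trans (size_polyD _ _) _; rewrite geq_max hx.
rewrite mul_polyC; apply: leq_trans (size_scale_leq _ _) _.
rewrite /mmap1 (bigD1 0) //= big1 => [|i /negPf ->]; last by rewrite expr1n.
by rewrite mulr1 size_polyXn ltnS mdegE (bigD1 0) //= leq_addr.
Qed.

(** If (1 : 0) is not a zero, the value [c] there is the leading coefficient of the polynomial
    obtained at t = 1, which therefore has degree e+1 and a root in a closed field. *)
Lemma form_has_root e g : g \is e.+1.-homog -> exists2 p : 'rV[F]_2, p != 0 & g.@[p 0] = 0.
Proof.
move=> hg; pose p1 : 'rV[F]_2 := \row_i (i == 0)%:R.
have p1n : p1 != 0 by rewrite rV2_neq0 !mxE oner_eq0.
have [g0|g0] := eqVneq g.@[p1 0] 0; first by exists p1.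
set c := g.@[p1 0] in g0.
have hX : ('X_0 ^+ e.+1 : {mpoly F[2]}) \is e.+1.-homog.
  by have := dhomogMn e.+1 (@homogX 2 F 0); rewrite mul1n.
have [||h hh eg] := @form_root _ e (g - c *: 'X_0 ^+ e.+1) p1 p1n.
- by apply: rpredB => //; apply: rpredZ.
- by rewrite mevalB mevalZ rmorphXn /= mevalXU mxE eqxx expr1n mulr1 subrr.
have [x] : exists x, root (c *: 'X^(e.+1) - dehom h) x.
  apply/closed_rootP; rewrite size_polyDl size_scale // size_polyXn //.
  by rewrite size_polyN ltnS size_dehom.
rewrite /root => /eqP rx.
exists (\row_i (if i == 0 then x else 1)); first by rewrite rV2_neq0 !mxE oner_eq0 orbT.
have -> : g = c *: 'X_0 ^+ e.+1 + lin p1 * h by rewrite -eg addrC subrK.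
rewrite mevalD mevalZ rmorphXn /= mevalXU mevalM lin_eval /br !mxE eqxx.
rewrite mul0r sub0r !mulr1 mulNr mul1r -[RHS]rx !hornerE dehomE.
by congr (_ - _); apply: meval_eq => i; rewrite mxE.
Qed.

Lemma form_factor e g : g \is e.-homog -> exists c (s : seq 'rV[F]_2),
  [/\ size s = e, forall p, p \in s -> p != 0 & g = c *: \prod_(p <- s) lin p].
Proof.
elim: e g => [|e IHe] g hg.
  by exists g@_0%MM, [::]; rewrite big_nil alg_mpolyC -homog0C.
have [p p0 gp] := form_has_root hg; have [h /IHe [c [s [sz s0 ->]]] ->] := form_root p0 hg gp.
exists c, (p :: s); split=> [|q|]; rewrite /= ?sz // ?big_cons ?scalerAr //.
by rewrite inE => /orP [/eqP ->|/s0].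
Qed.

Lemma form_zeros e g : g \is e.-homog -> g != 0 -> exists s : seq 'rV[F]_2,
  (forall p, p \in s -> p != 0) /\
  forall q, q != 0 -> g.@[q 0] = 0 -> exists2 z, z \in s & (q == z)%MS.
Proof.
move=> /form_factor [c [s [_ s0 ->]]] g0; exists s; split=> // q q0 /eqP.
rewrite mevalZ mulf_eq0 => /orP [/eqP c0|]; first by rewrite c0 scale0r eqxx in g0.
rewrite rmorph_prod /= prodf_seq_eq0 => /hasP [z zs /=]; rewrite lin_eval => b0.
by exists z => //; rewrite par_sym -(br_eq0 (s0 _ zs) q0).
Qed.

Lemma form_order e g p : p != 0 -> g \is e.-homog -> g != 0 ->
  exists k h, [/\ (k <= e)%N, h \is (e - k).-homog, h.@[p 0] != 0 & g = lin p ^+ k * h].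
Proof.
move=> p0; elim: e g => [|e IHe] g hg g0.
  exists 0%N, g; split=> //; last by rewrite expr0 mul1r.
  by apply: contraNneq g0 => /const_form_eq0 -> .
have [gp|gp] := eqVneq g.@[p 0] 0; last first.
  by exists 0%N, g; rewrite subn0 expr0 mul1r.
have [h hh eg] := form_root p0 hg gp.
have h0 : h != 0 by apply: contraNneq g0; rewrite eg => ->; rewrite mulr0.
have [k [h' [ke hh' h'p eh]]] := IHe h hh h0.
by exists k.+1, h'; rewrite ltnS subSS exprS -mulrA -eh.
Qed.

End ClosedForms.

(** * Transversal lines and the homogeneous coordinate ring *)

Section Avoidance.
Variable F : closedFieldType.

Definition dot n (c P : 'rV[F]_n) : F := \sum_j c 0 j * P 0 j.

Lemma dotDl n (a b P : 'rV[F]_n) : dot (a + b) P = dot a P + dot b P.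
Proof. by rewrite /dot -big_split; apply: eq_bigr => j _; rewrite mxE mulrDl. Qed.

Lemma dotZl n t (b P : 'rV[F]_n) : dot (t *: b) P = t * dot b P.
Proof. by rewrite /dot mulr_sumr; apply: eq_bigr => j _; rewrite mxE mulrA. Qed.

Lemma dotZr n t (b P : 'rV[F]_n) : dot b (t *: P) = t * dot b P.
Proof. by rewrite /dot mulr_sumr; apply: eq_bigr => j _; rewrite mxE mulrCA. Qed.

Lemma nonroot_seq (s : seq {poly F}) : (forall q, q \in s -> q != 0) ->
  exists x, forall q, q \in s -> q.[x] != 0.
Proof.
move=> s0; have : \prod_(q <- s) q != 0.
  by rewrite prodf_seq_neq0; apply/allP => q /s0 ->.
move/closed_nonrootP => [x]; rewrite rootE horner_prod prodf_seq_neq0 => /allP H.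
by exists x => q /H.
Qed.

(** The coefficients are sought on the moment curve (1, x, x^2, ...), where each [P] becomes a
    nonzero polynomial in x. *)
Lemma avoid_points n (s : seq 'rV[F]_n) : (forall P, P \in s -> P != 0) ->
  exists c, forall P, P \in s -> dot c P != 0.
Proof.
move=> s0; pose pol (P : 'rV[F]_n) := \poly_(j < n) oapp (P 0) 0 (insub j).
have polE P (j : 'I_n) : (pol P)`_j = P 0 j by rewrite coef_poly ltn_ord valK.
have [q /mapP [P /s0 P0 ->]|x Hx] := @nonroot_seq [seq pol P | P <- s].
  by apply: contraNneq P0 => pol0; apply/eqP/rowP => j; rewrite -polE pol0 coef0 mxE.
exists (\row_j x ^+ j) => P Ps; have := Hx (pol P) (map_f _ Ps).
rewrite horner_poly; congr (_ != 0); apply: eq_bigr => j _.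
by rewrite mxE mulrC valK.
Qed.

Lemma avoid_pencil (s : seq (F * F)) : (forall u, u \in s -> u != 0) ->
  exists t, forall u, u \in s -> u.1 + t * u.2 != 0.
Proof.
move=> s0; pose pol (u : F * F) := u.1%:P + u.2 *: 'X.
have [q /mapP [u /s0 u0 ->]|x Hx] := @nonroot_seq [seq pol u | u <- s].
  apply: contraNneq u0 => /polyP H; rewrite -pair_eqE /=.
  have := H 0%N; rewrite coefD coefZ coefC coefX coef0 /= mulr0 addr0 => ->.
  have := H 1%N; rewrite coefD coefZ coefC coefX coef0 /= mulr1 add0r => ->.
  by rewrite eqxx.
exists x => u us; have := Hx _ (map_f pol us).
by rewrite hornerD hornerC hornerZ hornerX mulrC.
Qed.

End Avoidance.

Lemma mderiv_exp n (R : comNzRingType) (p : {mpoly R[n]}) i k :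
  (p ^+ k.+1)^`M(i) = (p ^+ k * p^`M(i)) *+ k.+1.
Proof.
elim: k => [|k IHk]; first by rewrite expr1 mul1r.
by rewrite exprS mderivM IHk mulrnAr mulrA -exprS [p^`M(i) * _]mulrC -mulrS.
Qed.

Section Curve.
Variables (F : numClosedFieldType) (d : nat) (f : 3.-tuple {mpoly F[2]}).
Hypothesis f_homog : forall j, tnth f j \is d.-homog.

Definition comb (c : 'rV[F]_3) : {mpoly F[2]} := \sum_j c 0 j *: tnth f j.

Lemma comb_homog c : comb c \is d.-homog.
Proof. by apply: rpred_sum => j _; apply: rpredZ; apply: f_homog. Qed.

Lemma comb_eval c (p : 'rV[F]_2) : (comb c).@[p 0] = dot c (param f p).
Proof. by rewrite /comb raddf_sum /=; apply: eq_bigr => j _; rewrite mevalZ mxE. Qed.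

Lemma combD a b : comb (a + b) = comb a + comb b.
Proof. by rewrite /comb -big_split; apply: eq_bigr => j _; rewrite mxE scalerDl. Qed.

Lemma combZ t b : comb (t *: b) = t *: comb b.
Proof. by rewrite /comb scaler_sumr; apply: eq_bigr => j _; rewrite mxE scalerA. Qed.

Lemma comp_eval (A : {mpoly F[3]}) (p : 'rV[F]_2) : (A \mPo f).@[p 0] = A.@[param f p 0].
Proof. by rewrite comp_mpoly_meval; apply: meval_eq => i; rewrite mxE. Qed.

Lemma paramZ c p : param f (c *: p) = c ^+ d *: param f p.
Proof. by apply/rowP => j; rewrite !mxE (meval_rowZ _ _ (f_homog j)). Qed.

Lemma param_par p q : (p == q)%MS -> (param f p == param f q)%MS.
Proof.
case/eqmx_rVP => c c0 ->; apply/eqmx_rVP; exists (c ^+ d); rewrite ?expf_neq0 //.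
exact: paramZ.
Qed.

Hypothesis d_gt0 : (0 < d)%N.
Hypothesis f_gcd : gcd_is_one f.

(** A common zero [p] would make [lin p] a common factor, and a form with a zero is not a unit. *)
Lemma param_neq0 p : p != 0 -> param f p != 0.
Proof.
move=> p0; apply/eqP => fp0.
have /f_gcd : forall j, exists h, tnth f j = lin p * h.
  move=> j; have : (tnth f j).@[p 0] = 0 by have /rowP /(_ j) := fp0; rewrite !mxE.
  case: d d_gt0 f_homog => // e _ /(_ j) hj fj.
  by have [h _] := form_root p0 hj fj; exists h.
move=> /mulVr /(congr1 (meval (p 0))); rewrite mevalM lin_root mulr0 meval1 => /eqP.
by rewrite eq_sym oner_eq0.
Qed.

Hypothesis f_gen : generically_one_to_one f.

(** The line is a general member of a pencil c0 + t c1 without base points on the curve. Multiple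
    zeros of a member are zeros of the Wronskian [W], and a point whose image has a second preimage
    is a zero of [H], the pullback of the form that witnesses generic injectivity. Only finitely
    many t meet the zeros of [W * H] or the points of [s]. *)
Lemma good_line (s : seq 'rV[F]_3) : (forall P, P \in s -> P != 0) ->
  exists c (pt : 'I_d -> 'rV[F]_2) k,
  [/\ forall P, P \in s -> dot c P != 0, forall i, pt i != 0, k != 0,
      comb c = k *: \prod_i lin (pt i)
    & forall i j, i != j -> ~~ (param f (pt i) == param f (pt j))%MS].
Proof.
move=> s0; have [e [G [hG [P [P0 [p0 [p0n fp0]]] GP] Ginj]]] := f_gen.
pose H := G \mPo f.
have hH : H \is (e * d).-homog := homog_comp f_homog hG.
have H0 : H != 0.
  have Pp : (P == param f p0)%MS by rewrite par_sym.
  apply: contraNneq GP => H0; apply/eqP/(form_par hG Pp).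
  by rewrite -comp_eval -/H H0 meval0.
have [|c0 Hc0] := @avoid_points _ _ (param f p0 :: s).
  by move=> Q; rewrite inE => /orP [/eqP -> |/s0 //]; apply: param_neq0.
have g0p : (comb c0).@[p0 0] != 0 by rewrite comb_eval Hc0 // mem_head.
have g0n : comb c0 != 0 by apply: contraNneq g0p => ->; rewrite meval0.
have [zs [zs0 Hzs]] := form_zeros (comb_homog c0) g0n.
have [|c1 Hc1] := @avoid_points _ _ [seq param f z | z <- zs].
  by move=> _ /mapP [z /zs0 z0 ->]; apply: param_neq0.
have coprime01 (q : 'rV[F]_2) : q != 0 -> (comb c0).@[q 0] = 0 -> (comb c1).@[q 0] != 0.
  move=> qn /(Hzs _ qn) [z zz qz]; have := Hc1 _ (map_f _ zz).
  rewrite -comb_eval; apply: contraNneq => /(form_par (comb_homog c1)) -> //.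
  by rewrite par_sym.
have [p pn g0p0] : exists2 p : 'rV[F]_2, p != 0 & (comb c0).@[p 0] = 0.
  by have := comb_homog c0; case: d d_gt0 => // d' _ /form_has_root.
have g1p := coprime01 _ pn g0p0.
(* The Wronskian is taken for a partial derivative that does not kill [lin p]. *)
have [i dlin] : exists i, ((lin p)^`M(i)).@[p 0] != 0.
  move: pn; rewrite rV2_neq0 => /orP [pi|pi]; [exists 1 | exists 0];
    rewrite /lin mderivB !mderivZ !mderiv_var /= scaler0.
    by rewrite sub0r mevalN mevalZ meval1 mulr1 oppr_eq0.
  by rewrite subr0 mevalZ meval1 mulr1.
pose W := comb c0 * (comb c1)^`M(i) - comb c1 * (comb c0)^`M(i).
have hW : W \is (d + d.-1).-homog.
  have dS : d.-1.+1 = d by case: d d_gt0.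
  have hD c : (comb c)^`M(i) \is d.-1.-homog by apply: homog_deriv; rewrite dS; apply: comb_homog.
  by apply: rpredB; apply: dhomogM; rewrite ?comb_homog ?hD.
(* Where [comb c0] has order k+1, [W] has order exactly k: in characteristic 0 the factor k+1
   survives, and [comb c1] is nonzero at [p]. *)
have W0 : W != 0.
  have [k [h [kd hh hp eg]]] := form_order pn (comb_homog c0) g0n.
  case: k kd hh eg => [|k] kd hh eg.
    by move: hp; rewrite -[h]mul1r -(expr0 (lin p)) -eg g0p0 eqxx.
  apply/eqP; rewrite /W eg mderivM mderiv_exp => /eqP; rewrite subr_eq0 => /eqP eW.
  have : lin p * (h * (comb c1)^`M(i)) =
         comb c1 * (k.+1%:R * ((lin p)^`M(i) * h) + lin p * h^`M(i)).
    apply: (mulfI (expf_neq0 k (lin_neq0 pn))); move: eW; rewrite exprS -mulr_natl => eW.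
    transitivity (lin p * lin p ^+ k * h * (comb c1)^`M(i)); first by ring.
    by rewrite eW; ring.
  move/(congr1 (meval (p 0)))/eqP; rewrite !mevalM lin_root mul0r.
  rewrite mevalD !mevalM lin_root mul0r addr0.
  by rewrite eq_sym !mulf_eq0 rmorph_nat pnatr_eq0 /= (negPf g1p) (negPf dlin) (negPf hp).
have [zw [zw0 Hzw]] := form_zeros (dhomogM hW hH) (mulf_neq0 W0 H0).
pose S := [seq (dot c0 P, dot c1 P) | P <- s] ++
    [seq ((comb c0).@[z 0], (comb c1).@[z 0]) | z : 'rV[F]_2 <- zw].
have [|t Ht] := @avoid_pencil _ S.
  move=> u; rewrite mem_cat => /orP [/mapP [Q Qs ->]|/mapP [z zz ->]]; rewrite -pair_eqE /=.
    by rewrite negb_and Hc0 // inE Qs orbT.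
  by rewrite negb_and -implybE; apply/implyP => /eqP /(coprime01 _ (zw0 _ zz)).
pose c := c0 + t *: c1.
have cE (q : 'rV[F]_2) : (comb c).@[q 0] = (comb c0).@[q 0] + t * (comb c1).@[q 0].
  by rewrite combD combZ mevalD mevalZ.
have c_zw (q : 'rV[F]_2) : q != 0 -> (comb c).@[q 0] = 0 -> (W * H).@[q 0] != 0.
  move=> qn cq; apply/eqP => /(Hzw _ qn) [z zz qz].
  have /Ht /negP [] : ((comb c0).@[z 0], (comb c1).@[z 0]) \in S.
    by rewrite mem_cat; apply/orP; right; apply/mapP; exists z.
  by rewrite /= -cE; apply/eqP/(form_par (comb_homog c) _ cq); rewrite par_sym.
have [k [ps [sz ps0 eps]]] := form_factor (comb_homog c).
have cP Q : Q \in s -> dot c Q != 0.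
  move=> Qs; have /Ht : (dot c0 Q, dot c1 Q) \in S.
    by rewrite mem_cat; apply/orP; left; apply/mapP; exists Q.
  by rewrite /= dotDl dotZl.
have cn : comb c != 0.
  have [z zn Wz] : exists2 z : 'rV[F]_2, z != 0 & (W * H).@[z 0] = 0.
    have := dhomogM hW hH; case: d d_gt0 => // d' _; rewrite addSn addSn.
    exact: form_has_root.
  by apply/eqP => c00; have := c_zw _ zn; rewrite c00 meval0 Wz eqxx => /(_ erefl).
pose pt (i : 'I_d) := nth 0 ps i.
have ptn j : pt j != 0 by apply: ps0; rewrite mem_nth ?sz.
have eprod : comb c = k *: \prod_j lin (pt j) by rewrite eps (big_nth 0) big_mkord sz.
have kn : k != 0 by apply: contraNneq cn => k0; rewrite eps k0 scale0r.
have croot j : (comb c).@[pt j 0] = 0.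
  by rewrite eprod mevalZ (bigD1 j) //= mevalM lin_root mul0r mulr0.
exists c, pt, k; split=> // j l jl; apply/negP => par_jl.
have := c_zw _ (ptn j) (croot j); rewrite mevalM mulf_eq0 negb_or => /andP [Wj].
rewrite comp_eval => Hj.
have oc : on_curve f (param f (pt j)).
  by split; [apply: param_neq0 | exists (pt j); split=> //; apply: par_refl].
have /eqmx_rVP [a a0 ptE] : (pt l == pt j)%MS.
  by apply: (Ginj _ oc Hj); split=> //; [rewrite par_sym | apply: par_refl].
(* a double zero of [comb c] is a zero of the Wronskian [W] *)
case/negP: Wj; apply/eqP.
have -> : W = comb c * (comb c1)^`M(i) - comb c1 * (comb c)^`M(i).
  rewrite combD combZ mderivD mderivZ /W -!mul_mpolyC; ring.
rewrite mevalB !mevalM croot mul0r sub0r.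
rewrite eprod (bigD1 j) //= (bigD1 l) //=; last by rewrite eq_sym.
have -> : lin (pt l) = a *: lin (pt j).
  by rewrite /lin ptE !mxE scalerBr !scalerA.
set B := \prod_(_ | _) _.
have -> : k *: (lin (pt j) * (a *: lin (pt j) * B)) = lin (pt j) * (lin (pt j) * (k *: (a *: B))).
  by rewrite -!mul_mpolyC; ring.
by rewrite mderivM mevalD !mevalM lin_root !(mul0r, mulr0) addr0 mulr0 oppr0.
Qed.

End Curve.

(** * The homogeneous coordinate ring of the curve inside the binary forms *)

Section CoordinateRing.
Variables (F : numClosedFieldType) (d : nat) (f : 3.-tuple {mpoly F[2]}).
Hypothesis f_homog : forall j, tnth f j \is d.-homog.
Implicit Types (y : {mpoly F[2]}) (A : {mpoly F[3]}).

Definition homscale n a (x : {mpoly F[n]}) : {mpoly F[n]} := a *: x.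

Lemma homscale_action n : scalar_action (@homscale n).
Proof.
split=> [a x y|a b x|a b x|x]; rewrite /homscale ?scalerDr ?scalerDl ?scalerA //.
exact: scale1r.
Qed.

Lemma subspace_homog n e : subspace (@homscale n) (fun x => x \is e.-homog).
Proof. by split=> [|a x y hx hy]; [apply: rpred0 | apply: rpredD => //; apply: rpredZ]. Qed.

(** The degree [m] piece of F[f_0, f_1, f_2], lying in the binary forms of degree [m * d]. *)
Definition Rg m y : Prop := exists2 A, A \is m.-homog & y = A \mPo f.

Lemma Rg_homog m y : Rg m y -> y \is (m * d).-homog.
Proof. by case=> A hA ->; apply: homog_comp. Qed.

Lemma subspace_Rg m : subspace (@homscale 2) (Rg m).
Proof.
split=> [|a x y [A hA ->] [B hB ->]]; first by exists 0; rewrite ?comp_mpoly0 ?rpred0.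
exists (a *: A + B); last by rewrite comp_mpolyD comp_mpolyZ.
by apply: rpredD => //; apply: rpredZ.
Qed.

Lemma RgM m n y z : Rg m y -> Rg n z -> Rg (m + n) (y * z).
Proof.
by case=> A hA -> [B hB ->]; exists (A * B); [apply: dhomogM | rewrite rmorphM].
Qed.

Lemma RgZ m a y : Rg m y -> Rg m (a *: y).
Proof. exact: (subZ (subspace_Rg m)). Qed.

Lemma RgN m y : Rg m y -> Rg m (- y).
Proof. by move=> Ry; rewrite -scaleN1r; apply: RgZ. Qed.

Lemma RgD m y z : Rg m y -> Rg m z -> Rg m (y + z).
Proof. exact: (subD (homscale_action 2) (subspace_Rg m)). Qed.

Lemma Rg_sum m (I : Type) (r : seq I) (P : pred I) (G : I -> {mpoly F[2]}) :
  (forall i, P i -> Rg m (G i)) -> Rg m (\sum_(i <- r | P i) G i).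
Proof. exact: (sub_sum (homscale_action 2) (subspace_Rg m)). Qed.

Definition linform (c : 'rV[F]_3) : {mpoly F[3]} := \sum_j c 0 j *: 'X_j.

Lemma linform_homog c : linform c \is 1.-homog.
Proof. by apply: rpred_sum => j _; apply: rpredZ; apply: homogX. Qed.

Lemma linform_eval c (P : 'rV[F]_3) : (linform c).@[P 0] = dot c P.
Proof. by rewrite /linform raddf_sum /=; apply: eq_bigr => j _; rewrite mevalZ mevalXU. Qed.

Lemma linform_comp c : linform c \mPo f = comb f c.
Proof.
rewrite /linform raddf_sum /=; apply: eq_bigr => j _.
by rewrite comp_mpolyZ comp_mpolyXi.
Qed.

Lemma Rg_comb c : Rg 1 (comb f c).
Proof. by exists (linform c); [apply: linform_homog | rewrite linform_comp]. Qed.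

Lemma Rg1 : Rg 0 1.
Proof. by exists 1; [apply: dhomog1 | rewrite comp_mpoly1]. Qed.

Lemma RgX m n y : Rg m y -> Rg (m * n) (y ^+ n).
Proof.
move=> Ry; elim: n => [|n IHn]; first by rewrite muln0 expr0; apply: Rg1.
by rewrite mulnS exprS; apply: RgM.
Qed.

Lemma Rg_comp m A (w : 3.-tuple {mpoly F[2]}) :
  (forall j, Rg 1 (tnth w j)) -> A \is m.-homog -> Rg m (A \mPo w).
Proof.
move=> hw; elim: m A => [|m IHm] A hA.
  by rewrite (homog0C hA) comp_mpolyC -alg_mpolyC; apply: RgZ; apply: Rg1.
have [B [hB ->]] := homog_decomp hA; rewrite raddf_sum /=; apply: Rg_sum => j _.
by rewrite rmorphM /= comp_mpolyXi -add1n; apply: RgM => //; apply: IHm; apply: hB.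
Qed.

Lemma RgS m y : Rg m.+1 y -> exists z : 'I_3 -> {mpoly F[2]},
  (forall j, Rg m (z j)) /\ y = \sum_j tnth f j * z j.
Proof.
move=> [A hA ->]; have [B [hB ->]] := homog_decomp hA.
exists (fun j => B j \mPo f); split=> [j|]; first by exists (B j) => //; apply: hB.
by rewrite raddf_sum /=; apply: eq_bigr => j _; rewrite rmorphM /= comp_mpolyXi.
Qed.

Section GoodLine.
Hypothesis d_gt1 : (1 < d)%N.
Variables (c : 'rV[F]_3) (pt : 'I_d -> 'rV[F]_2) (k : F).
Hypothesis pt0 : forall i, pt i != 0.
Hypothesis kn : k != 0.
Hypothesis c_prod : comb f c = k *: \prod_i lin (pt i).
Hypothesis pt_inj : forall i j, i != j -> ~~ (param f (pt i) == param f (pt j))%MS.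
Hypothesis param0 : forall p, p != 0 -> param f p != 0.

Local Notation l := (comb f c).

Lemma ptD i j : i != j -> br (pt i) (pt j) != 0.
Proof. by move=> /pt_inj; apply: contraNN; rewrite br_eq0 //; apply: (param_par f_homog). Qed.

Lemma l_neq0 : l != 0.
Proof.
rewrite c_prod scaler_eq0 negb_or kn; apply/prodf_neq0 => i _.
exact: lin_neq0.
Qed.

Lemma l_root i : l.@[pt i 0] = 0.
Proof. by rewrite c_prod mevalZ (bigD1 i) //= mevalM lin_root mul0r mulr0. Qed.

Lemma l_dvd e y : y \is (e + d).-homog -> (forall i, y.@[pt i 0] = 0) ->
  exists2 z, z \is e.-homog & y = l * z.
Proof.
move=> hy y0; have [||z] := form_roots_in pt0 ptD (P := predT) _ hy.
- by rewrite card_ord leq_addl.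
- by move=> i _; apply: y0.
rewrite card_ord addnK => hz ->; exists (k^-1 *: z); first exact: rpredZ.
by rewrite c_prod -scalerAl -scalerAr scalerA divff // scale1r.
Qed.

(** [cg] is chosen to be nonzero at the points where [c] vanishes, which makes it independent of
    [c]; any row outside their span completes the basis. *)
Lemma frame : exists cg ch : 'rV[F]_3, (forall i, dot cg (param f (pt i)) != 0) /\
  forall a : 'rV[F]_3, exists x1 x2 x3 : F, a = x1 *: c + x2 *: cg + x3 *: ch.
Proof.
have [|cg Hcg] := @avoid_points _ _ [seq param f (pt i) | i <- enum 'I_d].
  by move=> _ /mapP [i _ ->]; apply: param0.
have Hg i : dot cg (param f (pt i)) != 0 by apply/Hcg/map_f; rewrite mem_enum.
pose M := col_mx c cg.
have [ch Hch] : exists ch : 'rV[F]_3, ~~ (ch <= M)%MS.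
  apply: contrapT => H; have : (1%:M <= M)%MS.
    by apply/row_subP => i; apply: contrapT => /negP Hi; apply: H; exists (row i 1%:M).
  by move/mxrankS; rewrite mxrank1 leqNgt ltnS rank_leq_row.
have fM : row_free M.
  apply: inj_row_free => v; rewrite -[v]hsubmxK mul_row_col.
  set v1 := lsubmx v; set v2 := rsubmx v; rewrite [v1]mx11_scalar [v2]mx11_scalar.
  rewrite !mul_scalar_mx => e; pose i0 : 'I_d := Ordinal (ltnW d_gt1).
  have : dot (v1 0 0 *: c + v2 0 0 *: cg) (param f (pt i0)) = 0.
    by rewrite e /dot big1 // => j _; rewrite mxE mul0r.
  rewrite dotDl !dotZl -[dot c _]comb_eval l_root mulr0 add0r => /eqP.
  rewrite mulf_eq0 (negPf (Hg _)) orbF => /eqP v20.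
  move: e; rewrite v20 scale0r addr0 => /eqP; rewrite scaler_eq0 => /orP [/eqP ->|/eqP c0].
    by rewrite !raddf0 row_mx0.
  by have := l_neq0; rewrite c0 /comb big1 ?eqxx // => j _; rewrite mxE scale0r.
have full : row_full (col_mx ch M).
  suff : row_free (col_mx ch M) by rewrite /row_free /row_full.
  apply: inj_row_free => v; rewrite -[v]hsubmxK mul_row_col.
  set v1 := lsubmx v; set v2 := rsubmx v; rewrite [v1]mx11_scalar mul_scalar_mx.
  have [->|v1n] := eqVneq (v1 0 0) 0.
    rewrite scale0r add0r raddf0 => /eqP; rewrite mulmx_free_eq0 // => /eqP ->.
    exact: row_mx0.
  move=> /eqP; rewrite addr_eq0 => /eqP e; case/negP: Hch; apply/submxP.
  exists (- (v1 0 0)^-1 *: v2); rewrite -scalemxAl scaleNr -scalerN -e scalerA.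
  by rewrite mulVf // scale1r.
exists cg, ch; split=> // a; have /submxP [u ->] : (a <= col_mx ch M)%MS by apply: submx_full.
rewrite -[u]hsubmxK mul_row_col -[rsubmx u]hsubmxK mul_row_col.
rewrite [lsubmx u]mx11_scalar [lsubmx (rsubmx u)]mx11_scalar [rsubmx (rsubmx u)]mx11_scalar.
rewrite !mul_scalar_mx addrC; eexists _, _, _; reflexivity.
Qed.

End GoodLine.
End CoordinateRing.

(* A line [c] meeting the curve transversally in [d] distinct points that have
   the preimages [pt i], completed to a coordinate system [c, cg, ch]. *)
Record is_frame (F : numClosedFieldType) (d : nat) (f : 3.-tuple {mpoly F[2]})
    (c cg ch : 'rV[F]_3) (pt : 'I_d -> 'rV[F]_2) : Prop := IsFrame {
  fr_pt0 : forall i, pt i != 0;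
  fr_ptD : forall i j, i != j -> br (pt i) (pt j) != 0;
  fr_par : forall i j, i != j -> ~~ (param f (pt i) == param f (pt j))%MS;
  fr_l0 : comb f c != 0;
  fr_root : forall i, (comb f c).@[pt i 0] = 0;
  fr_dvd : forall e y, y \is (e + d).-homog -> (forall i, y.@[pt i 0] = 0) ->
    exists2 z, z \is e.-homog & y = comb f c * z;
  fr_g : forall i, (comb f cg).@[pt i 0] != 0;
  fr_span : forall a : 'rV[F]_3, exists x1 x2 x3 : F, a = x1 *: c + x2 *: cg + x3 *: ch }.

Lemma frame_exists (F : numClosedFieldType) (d : nat) (f : 3.-tuple {mpoly F[2]})
    (s : seq 'rV[F]_3) : (1 < d)%N -> (forall j, tnth f j \is d.-homog) ->
  gcd_is_one f -> generically_one_to_one f -> (forall P, P \in s -> P != 0) ->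
  exists c cg ch (pt : 'I_d -> 'rV[F]_2),
    is_frame f c cg ch pt /\ forall P, P \in s -> dot c P != 0.
Proof.
move=> d1 hf fg fgen s0.
have [c [pt [k [cs p0 k0 eq pinj]]]] := good_line hf (ltnW d1) fg fgen s0.
have par0 p : p != 0 -> param f p != 0 := param_neq0 hf (ltnW d1) fg (p := p).
have [cg [ch [hg sp]]] := frame d1 p0 k0 eq par0.
exists c, cg, ch, pt; split=> //; split=> //.
- exact: (ptD hf p0 pinj).
- exact: (l_neq0 p0 k0 eq).
- exact: (l_root eq).
- exact: (l_dvd hf p0 k0 eq pinj).
- by move=> i; rewrite comb_eval.
Qed.

(** * Codimension of the curve forms among all binary forms *)

Section Split.
Variables (F : numClosedFieldType) (d : nat) (f : 3.-tuple {mpoly F[2]}).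
Hypothesis f_homog : forall j, tnth f j \is d.-homog.
Hypothesis d_gt1 : (1 < d)%N.
Variables (c cg ch : 'rV[F]_3) (pt : 'I_d -> 'rV[F]_2).
Hypothesis fr : is_frame f c cg ch pt.
Implicit Types (y : {mpoly F[2]}).

Local Notation l := (comb f c).
Local Notation g := (comb f cg).
Local Notation h := (comb f ch).
Local Notation Rg := (Rg f).

Let d_gt0 : (0 < d)%N := ltnW d_gt1.

Lemma fr_eq0 e y : (e < d)%N -> y \is e.-homog -> (forall i, y.@[pt i 0] = 0) -> y = 0.
Proof.
move=> ed hy y0; apply: (form_eq0 (fr_pt0 fr) (fr_ptD fr) (P := predT) _ hy).
  by rewrite card_ord.
by move=> i _; apply: y0.
Qed.

Lemma fr_interp e (v : 'I_d -> F) : (d <= e.+1)%N ->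
  exists2 y, y \is e.-homog & forall i, y.@[pt i 0] = v i.
Proof.
move=> de; have [|y hy yv] := form_interpolation (fr_pt0 fr) (fr_ptD fr) (P := predT) (e := e) v.
  by rewrite card_ord.
by exists y => // i; apply: yv.
Qed.

(* Multiplication by [h] maps the forms of degree [d - 1] into their
   combinations with coefficients linear in [l] and [g]; the determinant trick
   gives an equation of the curve that is monic in [h]. *)
Lemma curve_equation : exists D : {mpoly F[3]},
  [/\ D \is d.-homog, D \mPo [tuple l; g; h] = 0
    & D.@[(\row_(j < 3) (j == ord_max)%:R : 'rV[F]_3) 0] = 1].
Proof.
(* The Lagrange basis, at the points [pt], of the forms of degree d-1. *)
have /choice [e He] : forall a : 'I_d, exists y, y \is d.-1.-homog /\
    forall i, y.@[pt i 0] = (i == a)%:R.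
  move=> a; have [|y] := @fr_interp d.-1 (fun i => (i == a)%:R); first by rewrite prednK.
  by exists y.
have eE y : y \is d.-1.-homog -> y = \sum_b y.@[pt b 0] *: e b.
  move=> hy; apply/eqP; rewrite -subr_eq0; apply/eqP/(@fr_eq0 d.-1).
  - by rewrite prednK.
  - by apply: rpredB => //; apply: rpred_sum => b _; apply: rpredZ; case: (He b).
  move=> i; rewrite mevalB meval_sum (bigD1 i) //= mevalZ (He i).2 eqxx mulr1.
  rewrite big1 ?addr0 ?subrr // => b bi.
  by rewrite mevalZ (He b).2 eq_sym (negPf bi) mulr0.
(* [g * q] has the values of [h * e a] at every [pt], so the difference is divisible by [l]. *)
have /choice [XY HXY] : forall a, exists u : {mpoly F[2]} * {mpoly F[2]},
    [/\ u.1 \is d.-1.-homog, u.2 \is d.-1.-homog & h * e a = l * u.1 + g * u.2].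
  move=> a; have [|q hq qv] := @fr_interp d.-1 (fun i => (h * e a).@[pt i 0] / g.@[pt i 0]).
    by rewrite prednK.
  have [||p hp ep] := fr_dvd fr (e := d.-1) (y := h * e a - g * q).
  - rewrite addnC; apply: rpredB; apply: dhomogM => //; try exact: comb_homog.
    by case: (He a).
  - by move=> i; rewrite mevalB [(g * q).@[_]]mevalM qv mulrCA divff ?(fr_g fr) // mulr1 subrr.
  by exists (p, q); split=> //=; rewrite -ep subrK.
pose X a b := (XY a).1.@[pt b 0]; pose Y a b := (XY a).2.@[pt b 0].
(* After substitution of [l], [g], [h] the row of all [e b] is killed by this matrix; at the point
   (0 : 0 : 1) the matrix is the identity. *)
pose N : 'M[{mpoly F[3]}]_d :=
  \matrix_(b, a) ((b == a)%:R *: 'X_ord_max - X a b *: 'X_0 - Y a b *: 'X_1).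
exists (\det N); split.
- rewrite rpred_sum // => s _; rewrite mulr_sign.
  suff H : \prod_i N i (s i) \is d.-homog by case: (s : bool); rewrite ?rpredN.
  have := @homog_prod_var _ _ _ (index_enum 'I_d) predT (fun i => N i (s i)) (fun=> 1%N).
  rewrite sum1_card card_ord; apply=> i _; rewrite mxE.
  by apply: rpredB; [apply: rpredB|]; apply: rpredZ; apply: homogX.
- have := det_map_mx (comp_mpoly [tuple l; g; h]) N; move=> /= <-.
  apply/eqP/det0P; exists (\row_b e b).
    have i0 : 'I_d := Ordinal d_gt0.
    apply/eqP => /rowP /(_ i0); rewrite !mxE => e0.
    by have := (He i0).2 i0; rewrite e0 meval0 eqxx => /esym/eqP; rewrite oner_eq0.
  apply/rowP => a; rewrite !mxE.
  have [hX hY eXY] := HXY a.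
  have : h * e a - l * (\sum_b X a b *: e b) - g * (\sum_b Y a b *: e b) = 0.
    by rewrite -!eE // eXY addrAC addrK subrr.
  move=> H; rewrite -[RHS]H !mulr_sumr.
  have -> : h * e a = \sum_b (b == a)%:R *: (h * e b).
    rewrite (bigD1 a) //= eqxx scale1r big1 ?addr0 // => b /negPf ->.
    by rewrite scale0r.
  rewrite -!sumrB; apply: eq_bigr => b _; rewrite !mxE !comp_mpolyB !comp_mpolyZ.
  rewrite !comp_mpolyXi !(tnth_nth 0) /= !mulrBr -!scalerAr.
  by rewrite [e b * h]mulrC [e b * l]mulrC [e b * g]mulrC.
- have := det_map_mx (meval ((\row_(j < 3) (j == ord_max)%:R : 'rV[F]_3) 0)) N.
  move=> /= <-; rewrite (_ : map_mx _ _ = 1%:M) ?det1 //.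
  apply/matrixP => b a; rewrite !mxE !mevalB !mevalZ !mevalXU !mxE /=.
  by rewrite !mulr0 !subr0 mulr1.
Qed.

Lemma Rg_l m y : Rg m y -> Rg m.+1 (l * y).
Proof. by rewrite -add1n; apply: RgM; apply: Rg_comb. Qed.

(** The equation [D] and the d-th power of the last variable agree at (0 : 0 : 1), so their
    difference lies in the ideal of the first two variables. *)
Lemma h_pow : exists r r', [/\ Rg d.-1 r, Rg d.-1 r' & h ^+ d = l * r + g * r'].
Proof.
have [D [hD D0 D1]] := curve_equation; set P := (\row__ _ : 'rV[F]_3) in D1.
have hX : ('X_ord_max ^+ d : {mpoly F[3]}) \is d.-homog.
  by have := dhomogMn d (@homogX 3 F ord_max); rewrite mul1n.
have [|||B [hB eB]] := @homog_vanish _ _ d.-1 (D - 'X_ord_max ^+ d) P ord_max.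
- by rewrite mxE eqxx oner_eq0.
- by rewrite prednK //; apply: rpredB.
- by rewrite mevalB D1 rmorphXn /= mevalXU mxE eqxx expr1n subrr.
pose w := [tuple l; g; h].
have Rw j : Rg 1 (tnth w j).
  by case: j => -[|[|[|//]]] Hj; rewrite (tnth_nth 0) /=; apply: Rg_comb.
have RB i : Rg d.-1 (- (B i \mPo w)).
  by apply: RgN; apply: Rg_comp => //; apply: hB.
exists (- (B 0 \mPo w)), (- (B 1 \mPo w)); split=> //.
have : (D - 'X_ord_max ^+ d) \mPo w = - h ^+ d.
  by rewrite comp_mpolyB D0 sub0r rmorphXn /= comp_mpolyXi (tnth_nth 0).
rewrite eB raddf_sum /= !big_ord_recl big_ord0 addr0.
rewrite !rmorphM /= !mxE !comp_mpolyB !comp_mpolyZ !comp_mpolyXi.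
rewrite !(tnth_nth 0) /= !scale1r !scale0r !subr0 subrr mul0r addr0.
move=> /(congr1 -%R); rewrite opprK => <-; rewrite opprD !mulrN.
by congr (- (_ * (_ \mPo _)) - _ * (_ \mPo _)); congr B; apply/val_inj.
Qed.

Definition mon m i : {mpoly F[2]} := g ^+ (m - i) * h ^+ i.

(** Normal form modulo [l] in degree m+1: the exponent i of [h] is at most m+1 by degree, and below
    d because h^d can be rewritten. *)
Definition split_form m y : Prop := exists y' (k : nat -> F),
  Rg m y' /\ y = l * y' + \sum_(0 <= i < minn d m.+2) k i *: mon m.+1 i.

Lemma Rg_mon m i : (i <= m)%N -> Rg m (mon m i).
Proof.
move=> im; rewrite -{1}(subnK im); apply: RgM.
  by have := RgX (m - i) (Rg_comb f cg); rewrite mul1n.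
by have := RgX i (Rg_comb f ch); rewrite mul1n.
Qed.

Lemma subspace_split m : subspace (@homscale F 2) (split_form m).
Proof.
split=> [|a x y [x' [k [Rx ->]]] [y' [k' [Ry ->]]]].
  exists 0, (fun=> 0); split; first exact: (sub0 (subspace_Rg f m)).
  by rewrite mulr0 add0r big1 // => i _; rewrite scale0r.
exists (a *: x' + y'), (fun i => a * k i + k' i); split; first by apply: RgD => //; apply: RgZ.
under [in RHS]eq_bigr do rewrite scalerDl -scalerA.
rewrite big_split /= -scaler_sumr mulrDr -scalerAr /homscale scalerDr.
by rewrite addrACA.
Qed.

Lemma splitD m x y : split_form m x -> split_form m y -> split_form m (x + y).
Proof. exact: (subD (homscale_action F 2) (subspace_split m)). Qed.

Lemma splitZ m a x : split_form m x -> split_form m (a *: x).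
Proof. exact: (subZ (subspace_split m)). Qed.

Lemma split_sum m (I : Type) (r : seq I) (P : pred I) (G : I -> {mpoly F[2]}) :
  (forall i, P i -> split_form m (G i)) -> split_form m (\sum_(i <- r | P i) G i).
Proof. exact: (sub_sum (homscale_action F 2) (subspace_split m)). Qed.

Lemma split_l m y : Rg m y -> split_form m (l * y).
Proof.
move=> Ry; exists y, (fun=> 0); split=> //.
by rewrite big1 ?addr0 // => i _; rewrite scale0r.
Qed.

Lemma split_mon m i : (i < d)%N -> (i <= m.+1)%N -> split_form m (mon m.+1 i).
Proof.
move=> id im; exists 0, (fun j => (j == i)%:R); split.
  exact: (sub0 (subspace_Rg f m)).
rewrite mulr0 add0r (bigD1_seq i) ?iota_uniq ?mem_index_iota ?leq_min ?id //=.
by rewrite eqxx scale1r big1 ?addr0 // => j /negPf ->; rewrite scale0r.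
Qed.

Lemma split_g m y : split_form m y -> split_form m.+1 (g * y).
Proof.
move=> [y' [k [Ry ->]]]; rewrite mulrDr mulrCA; apply: splitD.
  by apply: split_l; rewrite -add1n; apply: RgM => //; apply: Rg_comb.
rewrite mulr_sumr big_nat; apply: split_sum => i /andP [_]; rewrite leq_min => /andP [id im].
rewrite -scalerAr /mon mulrA -exprS -subSn //; apply: splitZ; apply: split_mon => //.
exact: leqW.
Qed.

Lemma split_gX m y j : split_form m y -> split_form (m + j) (g ^+ j * y).
Proof.
move=> sy; elim: j => [|j IHj]; first by rewrite addn0 mul1r.
by rewrite addnS exprS -mulrA; apply: split_g.
Qed.

Lemma split_h m y : (m.+2 < d)%N \/ split_form d.-1 (h ^+ d) ->
  split_form m y -> split_form m.+1 (h * y).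
Proof.
move=> Hd [y' [k [Ry ->]]]; rewrite mulrDr mulrCA; apply: splitD.
  by apply: split_l; rewrite -add1n; apply: RgM => //; apply: Rg_comb.
rewrite mulr_sumr big_nat; apply: split_sum => i /andP [_]; rewrite leq_min => /andP [id im].
rewrite -scalerAr; apply: splitZ; rewrite /mon mulrCA -exprS.
have [id'|di] := ltnP i.+1 d; first by rewrite -subSS; apply: split_mon.
have ed : i.+1 = d by apply/eqP; rewrite eqn_leq id.
case: Hd => [|H]; first by move: im di; lia.
have := split_gX (m.+1 - i) H; rewrite ed (_ : (d.-1 + (m.+1 - i))%N = m.+1) //.
by move: im ed; lia.
Qed.

(** The disjunction breaks a circle. Reducing h^d requires the normal form of a cofactor of degree
    d-1, and in degrees below d the power h^d does not occur yet. *)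
Lemma split_Rg_if m y : (m.+1 < d)%N \/ split_form d.-1 (h ^+ d) ->
  Rg m.+1 y -> split_form m y.
Proof.
have ej j : exists x1 x2 x3, tnth f j = x1 *: l + x2 *: g + x3 *: h.
  have [x1 [x2 [x3 e]]] := fr_span fr (\row_i (i == j)%:R).
  exists x1, x2, x3; rewrite -!combZ -!combD -e /comb (bigD1 j) //= mxE eqxx scale1r.
  rewrite big1 ?addr0 // => i ij; by rewrite mxE (negPf ij) scale0r.
elim: m y => [|m IHm] y Hd /RgS [z [Rz ->]]; apply: split_sum => j _;
  have [x1 [x2 [x3 ->]]] := ej j; rewrite !mulrDl -!scalerAl.
  have [A hA ->] := Rz j; rewrite (homog0C hA) comp_mpolyC -alg_mpolyC -!scalerAr !mulr1.
  apply: splitD; first apply: splitD; do 2!apply: splitZ.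
  - by rewrite -[l]mulr1; apply: split_l; apply: Rg1.
  - by have := @split_mon 0 0; rewrite /mon subn0 mulr1 expr1; apply.
  - by have := @split_mon 0 1; rewrite /mon subnn mul1r expr1; apply.
have sz : split_form m (z j) by apply: IHm (Rz j); case: Hd; [left; apply: ltnW | right].
apply: splitD; first apply: splitD; apply: splitZ.
- exact: split_l.
- exact: split_g.
- exact: split_h.
Qed.

Lemma split_Rg m y : Rg m.+1 y -> split_form m y.
Proof.
apply: split_Rg_if; right; have [r [r' [Rr Rr' ->]]] := h_pow.
apply: splitD; first exact: split_l.
have dE : d.-1 = d.-2.+1 by move: d_gt1; lia.
move: Rr'; rewrite dE => Rr'; apply: split_g; apply: split_Rg_if => //.
by left; rewrite -dE prednK.
Qed.

(** The affine coordinate of the image of [pt i] on the line [c]. *)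
Definition theta i := h.@[pt i 0] / g.@[pt i 0].

Lemma theta_inj : injective theta.
Proof.
move=> i j tij; apply: contrapT => /eqP ij; have /negP [] := fr_par fr ij.
have gi := fr_g fr i; have gj := fr_g fr j.
(* If the two coordinates agree, [c], [cg] and [ch] all vanish on [v], hence [v] is zero and the two
   images are parallel. *)
pose v := g.@[pt j 0] *: param f (pt i) - g.@[pt i 0] *: param f (pt j).
have dv a : dot a v = g.@[pt j 0] * (comb f a).@[pt i 0] - g.@[pt i 0] * (comb f a).@[pt j 0].
  rewrite /v; set x := g.@[pt j 0]; set z := g.@[pt i 0].
  rewrite !comb_eval /dot !mulr_sumr -sumrB; apply: eq_bigr => k _.
  rewrite !mxE; ring.
have v0 a : dot a v = 0.
  have [x1 [x2 [x3 ->]]] := fr_span fr a.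
  rewrite !dotDl !dotZl !dv !(fr_root fr) !mulr0 subrr mulr0 add0r.
  rewrite [g.@[pt j 0] * _]mulrC subrr mulr0 add0r.
  have -> : h.@[pt i 0] = theta i * g.@[pt i 0] by rewrite divfK.
  have -> : h.@[pt j 0] = theta i * g.@[pt j 0] by rewrite tij divfK.
  ring.
apply/eqmx_rVP; exists (g.@[pt i 0] / g.@[pt j 0]); first by rewrite mulf_neq0 ?invr_eq0.
apply/rowP => k; apply: (mulfI gj); rewrite !mxE mulrA mulrCA divff // mulr1.
have := v0 (\row_i (i == k)%:R); rewrite /dot (bigD1 k) //= !mxE eqxx mul1r big1 ?addr0.
  by move=> /eqP; rewrite subr_eq0 => /eqP.
by move=> m mk; rewrite mxE (negPf mk) mul0r.
Qed.

Lemma vandermonde_unit : Vandermonde d (\row_i theta i) \in unitmx.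
Proof.
rewrite unitmxE unitfE det_Vandermonde; apply/prodf_neq0 => i _; apply/prodf_neq0 => j ij.
rewrite !mxE subr_eq0; apply: contraTneq ij => /theta_inj ->; by rewrite ltnn.
Qed.

Lemma vandermondeE (k : nat -> F) i :
  (\row_(a < d) k a *m Vandermonde d (\row_i theta i)) 0 i = \sum_(0 <= a < d) k a * theta i ^+ a.
Proof. by rewrite mxE big_mkord; apply: eq_bigr => a _; rewrite !mxE. Qed.

Lemma vandermonde_span (v : 'I_d -> F) :
  exists k : nat -> F, forall i, \sum_(0 <= a < d) k a * theta i ^+ a = v i.
Proof.
pose r := (\row_i v i) *m invmx (Vandermonde d (\row_i theta i)).
exists (fun a => oapp (r 0) 0 (insub a)) => i; rewrite -vandermondeE.
rewrite (_ : \row__ _ = r); last by apply/rowP => a; rewrite mxE valK.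
by rewrite mulmxKV ?vandermonde_unit // mxE.
Qed.

Lemma vandermonde_free (k : nat -> F) :
  (forall i, \sum_(0 <= a < d) k a * theta i ^+ a = 0) -> forall a, (a < d)%N -> k a = 0.
Proof.
move=> H a ad; pose r : 'rV[F]_d := \row_(a < d) k a.
have : r *m Vandermonde d (\row_i theta i) = 0.
  by apply/rowP => i; rewrite vandermondeE H mxE.
move/(congr1 (mulmx^~ (invmx (Vandermonde d (\row_i theta i))))).
rewrite mulmxK ?vandermonde_unit // mul0mx => /rowP /(_ (Ordinal ad)).
by rewrite !mxE.
Qed.

Lemma mon_eval m a i : (a <= m)%N ->
  (mon m a).@[pt i 0] = g.@[pt i 0] ^+ m * theta i ^+ a.
Proof.
move=> am; rewrite /mon mevalM !rmorphXn /= /theta exprMn exprVn mulrCA mulrC.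
by rewrite -[in g.@[pt i 0] ^+ m](subnK am) exprD mulfK ?expf_neq0 ?(fr_g fr).
Qed.

(** Forms whose values at the [pt] are the powers of [theta], up to the common weight g^(m+1). Those
    with exponent at most m+1 come from the curve; the later ones are merely interpolated. *)
Lemma ladder m a : exists w : {mpoly F[2]}, [/\ w \is (m.+1 * d).-homog,
   forall i, w.@[pt i 0] = g.@[pt i 0] ^+ m.+1 * theta i ^+ a
   & (a <= m.+1)%N -> w = mon m.+1 a].
Proof.
have [am|am] := leqP a m.+1.
  exists (mon m.+1 a); split=> // [|i]; last exact: mon_eval.
  by apply: Rg_homog => //; apply: Rg_mon.
have [|w hw wv] := @fr_interp (m.+1 * d) (fun i => g.@[pt i 0] ^+ m.+1 * theta i ^+ a).
  by rewrite mulSn; move: (m * d)%N; lia.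
by exists w; split=> // /(leq_trans am); rewrite ltnn.
Qed.

(** In the normal form of [l * y] the monomial part vanishes at the [d] points, and the Vandermonde
    matrix of the distinct [theta] kills its coefficients, of which there are at most [d]. What is
    left is [l] times a curve form. *)
Lemma Rg_sat m y : y \is (m * d).-homog -> Rg m.+1 (l * y) -> Rg m y.
Proof.
move=> hy /split_Rg [y' [k [Ry' e]]].
have sum0 i : \sum_(0 <= a < minn d m.+2) k a * theta i ^+ a = 0.
  apply: (mulfI (expf_neq0 m.+1 (fr_g fr i))); rewrite mulr0.
  have /(congr1 (meval (pt i 0))) := e.
  rewrite mevalD !mevalM (fr_root fr) !mul0r add0r meval_sum => e0.
  rewrite [RHS]e0 mulr_sumr !big_nat; apply: eq_bigr => a /andP [_].
  by rewrite leq_min ltnS => /andP [_ am]; rewrite mevalZ mon_eval // mulrCA.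
suff k0 a : (a < minn d m.+2)%N -> k a = 0.
  move: e; rewrite big_nat big1 ?addr0 => [/(mulfI (fr_l0 fr)) ->|a /andP [_ /k0 ->]] //.
  exact: scale0r.
move=> am; have := @vandermonde_free (fun a => if (a < minn d m.+2)%N then k a else 0).
move=> /(_ _ a); rewrite am; apply; last by apply: leq_trans am (geq_minl _ _).
move=> i; rewrite (@big_cat_nat _ _ _ (minn d m.+2)) //= ?geq_minl //.
rewrite [X in _ + X]big_nat_cond [X in _ + X]big1 ?addr0.
  by rewrite -[RHS](sum0 i) !big_nat; apply: eq_bigr => b /andP [_ ->].
by move=> b /andP [/andP [bm _] _]; rewrite ltnNge bm mul0r.
Qed.

Lemma sum_split (V : zmodType) (G : nat -> V) m :
  \sum_(0 <= a < d) G a =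
  \sum_(0 <= a < minn d m) G a + \sum_(i < d - m) G (m + i)%N.
Proof.
rewrite (@big_cat_nat _ _ _ (minn d m)) //= ?geq_minl //; congr (_ + _).
have [dm|md] := leqP d m.
  by rewrite big_geq // big1 // => i _; have := ltn_ord i; move: dm; lia.
rewrite -{1}[m]add0n big_addn big_mkord.
by apply: eq_bigr => i _; rewrite addnC.
Qed.

Section Step.
Variables (m : nat) (w : nat -> {mpoly F[2]}).
Hypothesis Hw : forall a, [/\ w a \is (m.+1 * d).-homog,
   forall i, (w a).@[pt i 0] = g.@[pt i 0] ^+ m.+1 * theta i ^+ a
   & (a <= m.+1)%N -> w a = mon m.+1 a].

Let wtop (i : 'I_(d - m.+2)) := w (m.+2 + i)%N.

(** A combination of the ladder matches [y] at all [pt], so the difference is divisible by [l]; the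
    lower rungs belong to the curve and only [wtop] remains. *)
Lemma ladder_span y : y \is (m.+1 * d).-homog -> exists x u,
  x \is (m * d).-homog /\ Rg m.+1 (y - l * x - lcomb (@homscale F 2) u wtop).
Proof.
move=> hy.
have [k Hk] := vandermonde_span (fun i => y.@[pt i 0] / g.@[pt i 0] ^+ m.+1).
have [||x hx ex] := fr_dvd fr (e := m * d) (y := y - \sum_(0 <= a < d) k a *: w a).
- rewrite addnC -mulSn; apply: rpredB => //; apply: rpred_sum => a _; apply: rpredZ.
  by case: (Hw a).
- move=> i; rewrite mevalB meval_sum; apply/eqP; rewrite subr_eq0; apply/eqP.
  rewrite -[LHS](divfK (expf_neq0 m.+1 (fr_g fr i))) -Hk mulr_suml; apply: eq_bigr => a _.
  by rewrite mevalZ; case: (Hw a) => _ -> _; rewrite mulrAC mulrA.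
exists x, (\row_i k (m.+2 + i)%N); split=> //; rewrite -ex subKr (sum_split _ m.+2).
rewrite (_ : lcomb _ _ _ = \sum_(i < d - m.+2) k (m.+2 + i)%N *: w (m.+2 + i)%N); last first.
  by apply: eq_bigr => i _; rewrite mxE.
rewrite addrK big_nat; apply: Rg_sum => a /andP [_]; rewrite leq_min ltnS => /andP [_ am].
by apply: RgZ; case: (Hw a) => _ _ -> //; apply: Rg_mon.
Qed.

Lemma ladder_free x u : x \is (m * d).-homog ->
  Rg m.+1 (l * x + lcomb (@homscale F 2) u wtop) -> u = 0 /\ Rg m x.
Proof.
move=> hx RH; suff u0 : u = 0.
  split=> //; apply: Rg_sat => //.
  by move: RH; rewrite u0 (lcomb0 (homscale_action F 2)) addr0.
have [y' [k [_ e]]] := split_Rg RH.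
(* Low exponents carry the coefficients of the monomials with opposite sign, high ones carry [u].
   The default 0 is not reached for [a < d]. *)
pose K a := if (a < m.+2)%N then - k a else oapp (u 0) 0 (insub (a - m.+2)%N).
have H : forall a, (a < d)%N -> K a = 0.
  apply: vandermonde_free => i; rewrite (sum_split _ m.+2).
  apply: (mulfI (expf_neq0 m.+1 (fr_g fr i))); rewrite mulr0.
  have /(congr1 (meval (pt i 0))) := e.
  rewrite !mevalD !mevalM (fr_root fr) !mul0r !add0r /lcomb.
  rewrite [(\sum_(_ < _) homscale _ _).@[_]]meval_sum [(\sum_(0 <= _ < _) _).@[_]]meval_sum => e0.
  rewrite mulrDr !mulr_sumr; apply/eqP; rewrite addrC addr_eq0; apply/eqP.
  transitivity (\sum_(j < d - m.+2) (homscale (u 0 j) (wtop j)).@[pt i 0]).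
    apply: eq_bigr => j _; rewrite /K ltnNge leq_addr /= addKn valK /= /homscale mevalZ.
    by case: (Hw (m.+2 + j)) => _ -> _; rewrite mulrCA.
  rewrite e0 -sumrN !big_nat; apply: eq_bigr => a /andP [_].
  rewrite leq_min => /andP [_ am]; rewrite /K am mevalZ mon_eval //.
  by rewrite mulNr mulrN opprK mulrCA.
apply/rowP => j; rewrite mxE; have jd : (m.+2 + j < d)%N.
  by have := ltn_ord j; rewrite ltn_subRL.
by have := H _ jd; rewrite /K ltnNge leq_addr /= addKn valK.
Qed.

End Step.

Lemma ladder_seq m : exists w : nat -> {mpoly F[2]}, forall a, [/\ w a \is (m.+1 * d).-homog,
   forall i, (w a).@[pt i 0] = g.@[pt i 0] ^+ m.+1 * theta i ^+ a
   & (a <= m.+1)%N -> w a = mon m.+1 a].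
Proof. by have /choice [w] := ladder m; exists w. Qed.

Lemma Rg_surj m y : (d <= m.+2)%N -> y \is (m.+1 * d).-homog ->
  exists2 x, x \is (m * d).-homog & Rg m.+1 (y - l * x).
Proof.
move=> dm hy; have [w Hw] := ladder_seq m; have [x [u [hx H]]] := ladder_span Hw hy.
exists x => //; move: H; rewrite /lcomb big1 ?subr0 // => i.
by have := ltn_ord i; move: dm; lia.
Qed.

(** Multiplication by [l] from degree m to m+1 misses one dimension for each exponent from m+2 to
    d-1. Truncated subtraction gives 0 once no such exponent is left. *)
Lemma qdim_curve m : quotient_dim (@homscale F 2) (fun y => y \is (m * d).-homog) (Rg m)
  (\sum_(i < m) (d - i.+2)).
Proof.
elim: m => [|m IHm].
  apply/(qdimP (homscale_action F 2)); [exact: subspace_homog | exact: subspace_Rg |].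
  rewrite big_ord0; exists (fun=> 0); split=> [[]//|y|u _]; last by apply/rowP; case.
  rewrite mul0n => hy; exists 0; rewrite (lcomb0 (homscale_action F 2)) subr0.
  by rewrite (homog0C hy) -alg_mpolyC; apply: RgZ; apply: Rg1.
have [w Hw] := ladder_seq m; rewrite big_ord_recr /=.
apply: (qdim_step (homscale_action F 2) (homscale_action F 2) (phi := fun x => l * x)
   (V := fun y => y \is (m * d).-homog) (W := Rg m) (w := fun i => w (m.+2 + i)%N)) => //.
- by move=> a x y; rewrite /homscale mulrDr scalerAr.
- exact: subspace_homog.
- exact: subspace_Rg.
- exact: subspace_homog.
- exact: subspace_Rg.
- by move=> x hx; rewrite mulSn; apply: dhomogM => //; apply: comb_homog.
- exact: Rg_l.
- by move=> i; case: (Hw (m.+2 + i)%N).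
- by move=> y /(ladder_span Hw).
- by move=> x u; apply: ladder_free.
Qed.

Lemma sum_subn e m : (e <= m)%N -> (\sum_(i < m) (e - i) = (e.+1 * e) %/ 2)%N.
Proof.
elim: e m => [|e IHe] [|m] //; first by rewrite muln0 div0n big1.
  by move=> _; rewrite big1.
rewrite ltnS => /IHe H; rewrite big_ord_recl /= subn0.
rewrite (eq_bigr (fun i : 'I_m => e - i)%N) // H -divnMDl // -mulnDr mulnC.
by congr (_ * _ %/ 2)%N.
Qed.

Lemma qdim_curve_stable m : (d.-2 <= m)%N ->
  quotient_dim (@homscale F 2) (fun y => y \is (m * d).-homog) (Rg m)
    ((d - 1) * (d - 2) %/ 2).
Proof.
move=> dm; have := qdim_curve m; rewrite (eq_bigr (fun i : 'I_m => d.-2 - i)%N).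
  rewrite sum_subn // (_ : d.-2.+1 = d - 1)%N; last by move: d_gt1; lia.
  by rewrite (_ : d.-2 = d - 2)%N //; lia.
by move=> i _; lia.
Qed.

End Split.

(** * Function field and local rings *)

Section FieldLemmas.
Variable R : fieldType.
Implicit Types x y z t : R.

Lemma div_neq0 x y : x != 0 -> y != 0 -> x / y != 0.
Proof. by move=> x0 y0; rewrite mulf_neq0 // invr_eq0. Qed.

Lemma div_mul_div x y z : y != 0 -> (y / z) * (x / y) = x / z.
Proof. by move=> y0; rewrite mulrC mulf_div [y * z]mulrC -mulf_div divff // mulr1. Qed.

Lemma div_mulr x y z : z != 0 -> (x * z) / (y * z) = x / y.
Proof. by move=> z0; rewrite -mulf_div divff // mulr1. Qed.

Lemma div_mull x y z : z != 0 -> (z * x) / (z * y) = x / y.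
Proof. by move=> z0; rewrite -mulf_div divff // mul1r. Qed.

Lemma mul_div_swap x y : x != 0 -> y != 0 -> (x / y) * (y / x) = 1.
Proof. by move=> x0 y0; rewrite mulrA divfK // divff. Qed.

End FieldLemmas.

Section Values.
Variable F : numClosedFieldType.
Local Notation K := {fraction {mpoly F[2]}}.
Implicit Types (p q : 'rV[F]_2) (x y : K) (v w : F) (a b g : {mpoly F[2]}).

Definition fscale (a : F) (x : K) : K := tofrac a%:MP * x.

Lemma fscale_action : scalar_action fscale.
Proof.
split=> [a x y|a b x|a b x|x]; rewrite /fscale.
- exact: mulrDr.
- by rewrite mpolyCD tofracD mulrDl.
- by rewrite mpolyCM tofracM mulrA.
- by rewrite mpolyC1 tofrac1 mul1r.
Qed.

(** The fractions of degree 0, i.e. the function field of P^1; [FF_function_field] and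
    [function_field_FF] identify it with that of the curve. *)
Definition FF x : Prop := exists n a b,
  [/\ a \is n.-homog, b \is n.-homog, b != 0 & x = tofrac a / tofrac b].

(** A relation rather than a function: the value is read off a representation with nonvanishing
    denominator, which may not exist. [val_at_uniq] shows independence of the representation. *)
Definition val_at p x v : Prop := exists n a b,
  [/\ a \is n.-homog, b \is n.-homog, b.@[p 0] != 0, x = tofrac a / tofrac b
    & v = a.@[p 0] / b.@[p 0]].

Definition regular p x : Prop := exists v, val_at p x v.

Lemma frac_eq a b a' b' : b != 0 -> b' != 0 ->
  tofrac a / tofrac b = tofrac a' / tofrac b' :> K -> a * b' = a' * b.
Proof.
move=> b0 b'0 /eqP; rewrite eqr_div ?tofrac_eq0 // -!tofracM tofrac_eq.
by move/eqP.
Qed.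

Lemma neq0_eval n (u : 'I_n -> F) (h : {mpoly F[n]}) : h.@[u] != 0 -> h != 0.
Proof. by apply: contraNneq => ->; rewrite meval0. Qed.

Lemma val_at_uniq p x v w : val_at p x v -> val_at p x w -> v = w.
Proof.
move=> [n [a [b [_ _ b0 -> ->]]]] [m [a' [b' [_ _ b'0 e ->]]]].
have := frac_eq (neq0_eval b0) (neq0_eval b'0) e.
move/(congr1 (meval (p 0))); rewrite !mevalM => e'.
by apply/eqP; rewrite eqr_div // e'.
Qed.

Lemma val_atC p (v : F) : val_at p (tofrac v%:MP) v.
Proof.
exists 0%N, v%:MP, 1; split; rewrite ?meval1 ?oner_eq0 ?mevalC ?tofrac1 ?divr1 //.
- exact: homogC.
- exact: dhomog1.
Qed.

Lemma val_at0 p : val_at p 0 0.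
Proof. by have := val_atC p 0; rewrite mpolyC0 tofrac0. Qed.

Lemma val_at1 p : val_at p 1 1.
Proof. by have := val_atC p 1; rewrite mpolyC1 tofrac1. Qed.

Lemma val_atD p x y v w : val_at p x v -> val_at p y w -> val_at p (x + y) (v + w).
Proof.
move=> [n [a [b [ha hb b0 -> ->]]]] [m [a' [b' [ha' hb' b'0 -> ->]]]].
exists (n + m)%N, (a * b' + a' * b), (b * b'); split.
- by apply: rpredD; [apply: dhomogM | rewrite addnC; apply: dhomogM].
- exact: dhomogM.
- by rewrite mevalM mulf_neq0.
- by rewrite tofracD !tofracM addf_div ?tofrac_eq0 ?(neq0_eval b0) ?(neq0_eval b'0).
- by rewrite mevalD !mevalM addf_div.
Qed.

Lemma val_atM p x y v w : val_at p x v -> val_at p y w -> val_at p (x * y) (v * w).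
Proof.
move=> [n [a [b [ha hb b0 -> ->]]]] [m [a' [b' [ha' hb' b'0 -> ->]]]].
exists (n + m)%N, (a * a'), (b * b'); split; try exact: dhomogM.
- by rewrite mevalM mulf_neq0.
- by rewrite !tofracM mulf_div.
- by rewrite !mevalM mulf_div.
Qed.

Lemma val_atN p x v : val_at p x v -> val_at p (- x) (- v).
Proof.
by move=> /(val_atM (val_atC p (-1))); rewrite mpolyCN mpolyC1 tofracN tofrac1 !mulN1r.
Qed.

Lemma val_atX p x v n : val_at p x v -> val_at p (x ^+ n) (v ^+ n).
Proof.
move=> xv; elim: n => [|n IHn]; first by rewrite !expr0; apply: val_at1.
by rewrite !exprS; apply: val_atM.
Qed.

Lemma val_at_sum p (I : Type) (r : seq I) (P : pred I) (G : I -> K) (v : I -> F) :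
  (forall i, P i -> val_at p (G i) (v i)) ->
  val_at p (\sum_(i <- r | P i) G i) (\sum_(i <- r | P i) v i).
Proof. by move=> GV; elim/big_ind2: _ => // [|*]; [apply: val_at0 | apply: val_atD]. Qed.

Lemma val_atV p x v : val_at p x v -> v != 0 -> val_at p x^-1 v^-1.
Proof.
move=> [n [a [b [ha hb b0 -> ->]]]]; rewrite mulf_eq0 invr_eq0 negb_or => /andP [a0 _].
by exists n, b, a; split; rewrite ?invf_div.
Qed.

Lemma val_at_par p q x v : (q == p)%MS -> val_at p x v -> val_at q x v.
Proof.
move=> /eqmx_rVP [c c0 ->] [n [a [b [ha hb b0 -> ->]]]]; exists n, a, b.
by split=> //; rewrite ?(meval_rowZ _ _ ha) ?(meval_rowZ _ _ hb) ?mulf_neq0 ?expf_neq0 //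
  -mulf_div divff ?expf_neq0 // mul1r.
Qed.

Lemma FF_cancel n a b p : p != 0 -> a \is n.+1.-homog -> b \is n.+1.-homog ->
  b != 0 -> a.@[p 0] = 0 -> b.@[p 0] = 0 -> exists a' b',
  [/\ a' \is n.-homog, b' \is n.-homog, b' != 0
    & tofrac a / tofrac b = tofrac a' / tofrac b' :> K].
Proof.
move=> p0 ha hb b0 /(form_root p0 ha) [a' ha' ea] /(form_root p0 hb) [b' hb' eb].
exists a', b'; split=> //; first by apply: contraNneq b0; rewrite eb => ->; rewrite mulr0.
by rewrite ea eb !tofracM -mulf_div divff ?mul1r // tofrac_eq0 lin_neq0.
Qed.

(** Common factors [lin p] are cancelled until the numerator or the denominator is nonzero at [p].
    This plays the part of the valuation at [p]. *)
Lemma FF_valuation x p : p != 0 -> FF x -> regular p x \/ x != 0 /\ val_at p x^-1 0.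
Proof.
move=> p0 [n]; elim: n => [|n IHn] [a [b [ha hb b0 ex]]].
  left; exists (a.@[p 0] / b.@[p 0]), 0%N, a, b; split=> //.
  by apply: contraNneq b0 => /const_form_eq0 ->.
have [bp|bp] := eqVneq b.@[p 0] 0; last first.
  by left; exists (a.@[p 0] / b.@[p 0]), n.+1, a, b.
have [ap|ap] := eqVneq a.@[p 0] 0.
  by apply: IHn; have [a' [b' [*]]] := FF_cancel p0 ha hb b0 ap bp; exists a', b'; split; rewrite // ex.
right; split; first by rewrite ex mulf_neq0 ?invr_eq0 ?tofrac_eq0 // (neq0_eval ap).
by exists n.+1, b, a; split; rewrite // ?ex ?invf_div // bp mul0r.
Qed.

(** One fraction has to serve all points of [S]. If its denominator vanishes at one of them,
    regularity forces the numerator to vanish too, and cancelling lowers the degree. *)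
Lemma FF_regular x (S : 'rV[F]_2 -> Prop) : (forall p, S p -> p != 0) -> FF x ->
  (forall p, S p -> regular p x) -> exists n a b,
  [/\ a \is n.-homog, b \is n.-homog, b != 0, forall p, S p -> b.@[p 0] != 0
    & x = tofrac a / tofrac b].
Proof.
move=> S0 [n]; elim: n => [|n IHn] [a [b [ha hb b0 ex]]] Sx.
  by exists 0%N, a, b; split=> // p _; apply: contraNneq b0 => /(const_form_eq0 hb) ->.
case: (EM (forall p, S p -> b.@[p 0] != 0)) => [bS|]; first by exists n.+1, a, b.
case/existsNP => p /not_implyP [Sp /negP]; rewrite negbK => /eqP bp.
have ap : a.@[p 0] = 0.
  have [v [m [a' [b' [_ _ b'p ex' _]]]]] := Sx p Sp.
  have := frac_eq b0 (neq0_eval b'p) (etrans (esym ex) ex').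
  move/(congr1 (meval (p 0)))/eqP; rewrite !mevalM bp mulr0 mulf_eq0 (negPf b'p) orbF.
  by move/eqP.
have [a' [b' [ha' hb' b'0 e]]] := FF_cancel (S0 p Sp) ha hb b0 ap bp.
by apply: IHn Sx; exists a', b'; split; rewrite // ex.
Qed.

End Values.

(** * Affine coordinate rings of the curve and of its normalization *)

Section AffinePart.
Variables (F : numClosedFieldType) (d : nat) (f : 3.-tuple {mpoly F[2]}).
Hypothesis f_homog : forall j, tnth f j \is d.-homog.
Hypothesis d_gt1 : (1 < d)%N.
Variables (c cg ch : 'rV[F]_3) (pt : 'I_d -> 'rV[F]_2).
Hypothesis fr : is_frame f c cg ch pt.

Local Notation K := {fraction {mpoly F[2]}}.
Local Notation l := (comb f c).
Local Notation Rg := (Rg f).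
Local Notation N := ((d - 1) * (d - 2) %/ 2)%N.
Implicit Types (x t : K).

Let tl0 : tofrac l != 0 :> K. Proof. by rewrite tofrac_eq0 (fr_l0 fr). Qed.
Let tlX m : tofrac l ^+ m != 0 :> K. Proof. exact: expf_neq0. Qed.

(* Regular functions on the complement of the line [c], on the normalization
   [P^1] and on the curve itself. *)
Definition normal_affine x : Prop :=
  exists m g, g \is (m * d).-homog /\ x = tofrac g / tofrac l ^+ m.
Definition curve_affine x : Prop := exists m y, Rg m y /\ x = tofrac y / tofrac l ^+ m.
Local Notation T := normal_affine.
Local Notation Rl := curve_affine.

Lemma l_homog m : l ^+ m \is (m * d).-homog.
Proof. by rewrite mulnC; apply: dhomogMn; apply: comb_homog. Qed.

Lemma RgMl m e y : Rg m y -> Rg (m + e) (y * l ^+ e).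
Proof.
by move=> Ry; apply: RgM => //; have := RgX e (Rg_comb f c); rewrite mul1n.
Qed.

Lemma frac_addl (g g' : {mpoly F[2]}) m m' :
  tofrac g / tofrac l ^+ m + tofrac g' / tofrac l ^+ m' =
  tofrac (g * l ^+ m' + g' * l ^+ m) / tofrac l ^+ (m + m').
Proof. by rewrite (addf_div _ _ (tlX m) (tlX m')) tofracD !tofracM !tofracXn exprD. Qed.

Lemma Rl_T x : Rl x -> T x.
Proof. by case=> m [y [Ry ->]]; exists m, y; split=> //; apply: Rg_homog. Qed.

Lemma TD x y : T x -> T y -> T (x + y).
Proof.
move=> [m [g [hg ->]]] [m' [g' [hg' ->]]]; rewrite frac_addl; do 2!eexists; split=> //.
by rewrite mulnDl; apply: rpredD; [|rewrite addnC]; apply: dhomogM => //; apply: l_homog.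
Qed.

Lemma RlD x y : Rl x -> Rl y -> Rl (x + y).
Proof.
move=> [m [g [hg ->]]] [m' [g' [hg' ->]]]; rewrite frac_addl; do 2!eexists; split=> //.
by apply: RgD; [|rewrite addnC]; apply: RgMl.
Qed.

Lemma TM x y : T x -> T y -> T (x * y).
Proof.
move=> [m [g [hg ->]]] [m' [g' [hg' ->]]]; exists (m + m')%N, (g * g').
by rewrite mulf_div -tofracM -exprD mulnDl; split=> //; apply: dhomogM.
Qed.

Lemma RlM x y : Rl x -> Rl y -> Rl (x * y).
Proof.
move=> [m [g [hg ->]]] [m' [g' [hg' ->]]]; exists (m + m')%N, (g * g').
by rewrite mulf_div -tofracM -exprD; split=> //; apply: RgM.
Qed.

Lemma RlC a : Rl (tofrac a%:MP).
Proof.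
exists 0%N, a%:MP; rewrite expr0 divr1; split=> //.
by exists a%:MP; [apply: homogC | rewrite comp_mpolyC].
Qed.

Lemma Rl0 : Rl 0. Proof. by have := RlC 0; rewrite mpolyC0 tofrac0. Qed.
Lemma Rl1 : Rl 1. Proof. by have := RlC 1; rewrite mpolyC1 tofrac1. Qed.
Lemma RlN x : Rl x -> Rl (- x).
Proof. by move=> /(RlM (RlC (-1))); rewrite mpolyCN mpolyC1 tofracN tofrac1 mulN1r. Qed.
Lemma T0 : T 0. Proof. exact/Rl_T/Rl0. Qed.
Lemma RlX x n : Rl x -> Rl (x ^+ n).
Proof. by move=> Rx; elim: n => [|n IHn]; [exact: Rl1 | rewrite exprS; apply: RlM]. Qed.

Lemma subspace_T : subspace (@fscale F) T.
Proof. by split=> [|a x y Tx Ty]; [exact: T0 | apply: TD => //; apply: TM => //; apply/Rl_T/RlC]. Qed.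

Lemma subspace_Rl : subspace (@fscale F) Rl.
Proof. by split=> [|a x y Tx Ty]; [exact: Rl0 | apply: RlD => //; apply: RlM => //; apply: RlC]. Qed.

Lemma T_FF x : T x -> FF x.
Proof.
move=> [m [g [hg ->]]]; exists (m * d)%N, g, (l ^+ m).
by rewrite tofracXn expf_neq0 ?(fr_l0 fr) //; split=> //; apply: l_homog.
Qed.

Lemma T_regular (p : 'rV[F]_2) x : l.@[p 0] != 0 -> T x -> regular p x.
Proof.
move=> lp [m [g [hg ->]]]; exists (g.@[p 0] / (l ^+ m).@[p 0]), (m * d)%N, g, (l ^+ m).
by rewrite tofracXn rmorphXn /= expf_neq0 //; split=> //; apply: l_homog.
Qed.

Lemma Rg_satX m e y : y \is (m * d).-homog -> Rg (e + m) (l ^+ e * y) -> Rg m y.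
Proof.
move=> hy; elim: e => [|e IHe]; first by rewrite mul1r.
rewrite exprS -mulrA addSn => /(Rg_sat f_homog d_gt1 fr) H; apply/IHe/H.
by rewrite mulnDl; apply: dhomogM => //; apply: l_homog.
Qed.

(** In large degrees multiplication by [l] is onto modulo the curve forms, so the pole order along
    the line can be lowered to [d]. This turns a quotient of rings into one graded piece. *)
Lemma T_reduce e g : g \is ((d + e) * d).-homog -> exists2 x, x \is (d * d).-homog &
  Rl (tofrac g / tofrac l ^+ (d + e) - tofrac x / tofrac l ^+ d).
Proof.
elim: e g => [|e IHe] g hg.
  by exists g; rewrite ?addn0 in hg *; rewrite // subrr; exact: Rl0.
have [||x hx Rx] := Rg_surj f_homog d_gt1 fr (m := d + e) (y := g); rewrite -?addnS //.
  by rewrite !addnS; lia.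
have [z hz Rz] := IHe x hx; exists z => //.
have -> : tofrac g / tofrac l ^+ (d + e.+1) =
   tofrac (g - l * x) / tofrac l ^+ (d + e.+1) + tofrac x / tofrac l ^+ (d + e) :> K.
  have e2 : tofrac (l * x) / tofrac l ^+ (d + e).+1 = tofrac x / tofrac l ^+ (d + e) :> K.
    by rewrite tofracM exprS -mulf_div (divff tl0) mul1r.
  by rewrite addnS tofracB mulrBl e2 subrK.
rewrite -addrA; apply: RlD => //.
by exists (d + e.+1)%N, (g - l * x); rewrite addnS.
Qed.

Lemma qdim_T : quotient_dim (@fscale F) T Rl N.
Proof.
have Q := qdim_curve_stable f_homog d_gt1 fr (m := d).
rewrite -[X in quotient_dim _ _ _ X]addn0.
apply: (qdim_step (homscale_action F 2) (fscale_action F)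
   (phi := fun y : {mpoly F[2]} => tofrac y / tofrac l ^+ d) (V := fun y => y \is (d * d).-homog)
   (W := Rg d) (w := fun i : 'I_0 => 0)) => //.
- by move=> a x y; rewrite /homscale /fscale -mul_mpolyC tofracD tofracM mulrDl mulrA.
- exact: subspace_homog.
- exact: subspace_Rg.
- exact: subspace_T.
- exact: subspace_Rl.
- by move=> x hx; exists d, x.
- by move=> x hx; exists d, x.
- by case.
- move=> y [m [g [hg ->]]]; have [|x hx Rx] := @T_reduce m (g * l ^+ d).
    by rewrite addnC mulnDl; apply: dhomogM => //; apply: l_homog.
  exists x, 0; split=> //; rewrite (lcomb0 (fscale_action F)) subr0.
  by move: Rx; rewrite tofracM tofracXn exprD [tofrac g * _]mulrC -mulf_div (divff (tlX d)) mul1r.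
- move=> x u hx; rewrite (_ : u = 0); last by apply/rowP; case.
  rewrite (lcomb0 (fscale_action F)) addr0 => -[m [y [Ry]]].
  rewrite -!tofracXn => /frac_eq; rewrite !expf_neq0 ?(fr_l0 fr) // => /(_ isT isT) e.
  split=> //; apply: (@Rg_satX d m) => //; rewrite mulrC e.
  exact: RgMl.
- by apply: Q; lia.
Qed.

(** Birationality by counting: a multiplier [C] of degree k for which [a * C] and [b * C] are both
    curve forms has k+1 coefficients subject to 2N linear conditions. *)
Lemma FF_function_field x : FF x -> function_field f x.
Proof.
move=> [n [a [b [ha hb b0 ->]]]].
(* Large enough both for the stable dimension N in degree j and for [j * d] to exceed n + 2N. *)
pose j := (n + (d + (N + N).+1))%N; pose k := (j * d - n)%N.
have jd : (n + (N + N).+1 <= j * d)%N.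
  rewrite /j; move: (N + N).+1 => M; apply: leq_trans (leq_pmulr _ (ltnW d_gt1)).
  by rewrite leq_add2l leq_addl.
have jE : (n + k = j * d)%N by rewrite subnKC // (leq_trans (leq_addr _ _) jd).
have kN : (N + N < k.+1)%N by rewrite ltnS -(leq_add2l n) jE; move: jd; lia.
pose mo (i : 'I_k.+1) : 'X_{1..2} := (U_(ord0) *+ (k - i) + U_(ord_max) *+ i)%MM.
have moI : injective mo.
  move=> i i' /mnmP /(_ ord_max); rewrite !mnmDE !mulmnE !mnm1E /= !mul0n !add0n !mul1n.
  exact: val_inj.
have hmo i : ('X_[mo i] : {mpoly F[2]}) \is k.-homog.
  by rewrite dhomogX /= mdegD !mdegMn !mdeg1 !mul1n subnK // -ltnS.
have Q : quotient_dim (@homscale F 2) (fun y => y \is (j * d).-homog) (Rg j) N.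
  apply: (qdim_curve_stable f_homog d_gt1 fr); apply: leq_trans (leq_addl n _).
  by apply: leq_trans (leq_addr _ _); lia.
have rel g : g \is n.-homog -> exists A : 'M_(k.+1, N), forall u : 'rV_k.+1,
    u *m A = 0 -> Rg j (g * \sum_i u 0 i *: 'X_[mo i]).
  move=> hg; have [|A HA] := qdim_relations (homscale_action F 2)
      (subspace_homog F 2 _) (subspace_Rg f j) Q (y := fun i => g * 'X_[mo i]).
    by move=> i; rewrite -jE; apply: dhomogM.
  exists A => u /HA; congr (Rg j); rewrite mulr_sumr; apply: eq_bigr => i _.
  by rewrite /homscale scalerAr.
have [A HA] := rel a ha; have [B HB] := rel b hb.
have [u u0] := kernel_vector (row_mx A B) kN.
rewrite mul_mx_row -row_mx0 => /eq_row_mx [uA uB].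
set C := \sum_i u 0 i *: 'X_[mo i] in HA HB.
have C0 : C != 0.
  have [i ui] : exists i, u 0 i != 0 by apply/rV0Pn.
  apply: contraNneq ui => /(congr1 (mcoeff (mo i))).
  rewrite raddf_sum mcoeff0 (bigD1 i) //= mcoeffZ mcoeffX eqxx mulr1 big1 ?addr0 => [->//|i' ii'].
  by rewrite mcoeffZ mcoeffX (inj_eq moI) (negPf ii') mulr0.
have [A' hA' eA'] := HA u uA; have [B' hB' eB'] := HB u uB.
exists j, A', B'; split=> //; first by rewrite -eB' mulf_neq0.
have tC : tofrac C != 0 :> K by rewrite tofrac_eq0.
rewrite /Defs.ratio -eA' -eB'.
rewrite (tofracM a C) (tofracM b C) -mulf_div.
by rewrite (divff tC) mulr1.
Qed.

End AffinePart.

Section LocalRing.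
Variables (F : numClosedFieldType) (d : nat) (f : 3.-tuple {mpoly F[2]}).
Hypothesis f_homog : forall j, tnth f j \is d.-homog.
Local Notation K := {fraction {mpoly F[2]}}.
Implicit Types (x : K).

Lemma fiber_scale (P : 'rV[F]_3) p : in_fiber f P p ->
  exists2 k, k != 0 & param f p = k *: P.
Proof. by case=> _ /eqmx_rVP. Qed.

Lemma fiber_eval (P : 'rV[F]_3) p e (A : {mpoly F[3]}) : in_fiber f P p -> A \is e.-homog ->
  ((A \mPo f).@[p 0] == 0) = (A.@[P 0] == 0).
Proof.
move=> /fiber_scale [k k0 eP] hA; rewrite comp_eval eP (meval_rowZ _ _ hA).
by rewrite mulf_eq0 expf_eq0 (negPf k0) andbF.
Qed.

Lemma ratio_val (P : 'rV[F]_3) p e (A B : {mpoly F[3]}) : in_fiber f P p ->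
  A \is e.-homog -> B \is e.-homog -> B.@[P 0] != 0 ->
  val_at p (Defs.ratio f A B) (A.@[P 0] / B.@[P 0]).
Proof.
move=> Pp hA hB BP; exists (e * d)%N, (A \mPo f), (B \mPo f); split=> //.
- exact: homog_comp.
- exact: homog_comp.
- by rewrite (fiber_eval Pp hB).
have [k k0 eP] := fiber_scale Pp.
rewrite !comp_eval eP (meval_rowZ _ _ hA) (meval_rowZ _ _ hB) -mulf_div.
by rewrite divff ?mul1r // expf_neq0.
Qed.

Section AtPoint.
Variable P : 'rV[F]_3.
Hypothesis P_curve : on_curve f P.
Local Notation O := (local_ring f P).

Lemma local_den e (B : {mpoly F[3]}) : B \is e.-homog -> B.@[P 0] != 0 -> tofrac (B \mPo f) != 0 :> K.
Proof.
have [_ [p Pp]] := P_curve => hB BP; rewrite tofrac_eq0.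
by apply: (@neq0_eval _ _ (p 0)); rewrite (fiber_eval Pp hB).
Qed.

Lemma localD x x' : O x -> O x' -> O (x + x').
Proof.
move=> [e [A [B [hA hB BP ->]]]] [e' [A' [B' [hA' hB' BP' ->]]]].
exists (e + e')%N, (A * B' + A' * B), (B * B'); split.
- by apply: rpredD; [|rewrite addnC]; apply: dhomogM.
- exact: dhomogM.
- by rewrite mevalM mulf_neq0.
rewrite /Defs.ratio (addf_div _ _ (local_den hB BP) (local_den hB' BP')).
rewrite comp_mpolyD !comp_mpolyM.
move: (A \mPo f) (B \mPo f) (A' \mPo f) (B' \mPo f) => a b a' b'.
by rewrite (tofracD (a * b')) !tofracM.
Qed.

Lemma localM x x' : O x -> O x' -> O (x * x').
Proof.
move=> [e [A [B [hA hB BP ->]]]] [e' [A' [B' [hA' hB' BP' ->]]]].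
exists (e + e')%N, (A * A'), (B * B'); split; try exact: dhomogM.
- by rewrite mevalM mulf_neq0.
rewrite /Defs.ratio mulf_div !comp_mpolyM.
move: (A \mPo f) (B \mPo f) (A' \mPo f) (B' \mPo f) => a b a' b'.
by rewrite !tofracM.
Qed.

Lemma localC a : O (tofrac a%:MP).
Proof.
exists 0%N, a%:MP, 1; split; [exact: homogC | exact: dhomog1 | by rewrite meval1 oner_eq0 |].
by rewrite /Defs.ratio comp_mpolyC comp_mpoly1 tofrac1 divr1.
Qed.

Lemma local0 : O 0. Proof. by have := localC 0; rewrite mpolyC0 tofrac0. Qed.

Lemma local1 : O 1. Proof. by have := localC 1; rewrite mpolyC1 tofrac1. Qed.

Lemma subspace_local : subspace (@fscale F) O.
Proof.
split=> [|a x x' Ox Ox']; first exact: local0.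
by apply: localD => //; apply: localM => //; apply: localC.
Qed.

Lemma localN x : O x -> O (- x).
Proof. exact: (subN (fscale_action F) subspace_local). Qed.

Lemma localX x n : O x -> O (x ^+ n).
Proof. by move=> Ox; elim: n => [|n IHn]; [exact: local1 | rewrite exprS; apply: localM]. Qed.

(** The value depends only on [P], so it is shared by the whole fiber; this constraint is absent
    from [hat_ring]. *)
Lemma local_val x : O x -> exists v, forall p, in_fiber f P p -> val_at p x v.
Proof.
move=> [e [A [B [hA hB BP ->]]]]; exists (A.@[P 0] / B.@[P 0]) => p Pp.
exact: (ratio_val Pp hA hB BP).
Qed.

Lemma localV x p v : O x -> in_fiber f P p -> val_at p x v -> v != 0 -> O x^-1.
Proof.
move=> [e [A [B [hA hB BP ->]]]] Pp /val_at_uniq /(_ (ratio_val Pp hA hB BP)) ->.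
rewrite mulf_eq0 invr_eq0 negb_or => /andP [AP _].
by exists e, B, A; split=> //; rewrite /Defs.ratio invf_div.
Qed.

Lemma function_field_FF x : function_field f x -> FF x.
Proof.
move=> [e [A [B [hA hB B0 ->]]]]; exists (e * d)%N, (A \mPo f), (B \mPo f).
by split=> //; apply: homog_comp.
Qed.

End AtPoint.

Lemma local_par P Q x : (P == Q)%MS -> local_ring f P x -> local_ring f Q x.
Proof.
move=> PQ [e [A [B [hA hB BP ->]]]]; exists e, A, B; split=> //.
by apply: contraNneq BP => BQ; apply/eqP/(form_par hB PQ).
Qed.

(* This turns out to be the normalization of the local ring at [P]. *)
Definition hat_ring P x : Prop := FF x /\ forall p, in_fiber f P p -> regular p x.

Lemma separating_form (P Q : 'rV[F]_3) : P != 0 -> Q != 0 -> ~~ (P == Q)%MS ->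
  exists2 a, dot a Q = 0 & dot a P != 0.
Proof.
move=> P0 Q0; apply: contraNP => H.
have [j Qj] : exists j, Q 0 j != 0 by apply/rV0Pn.
have PE i : Q 0 j * P 0 i = Q 0 i * P 0 j.
  (* This line passes through [Q]. If all lines of this kind pass through [P], the coordinates of
     [P] and [Q] are proportional. *)
  pose a : 'rV[F]_3 := \row_k (Q 0 j * (k == i)%:R - Q 0 i * (k == j)%:R).
  have dotE R : dot a R = Q 0 j * R 0 i - Q 0 i * R 0 j.
    rewrite /dot; under eq_bigr do rewrite mxE mulrBl.
    rewrite sumrB; congr (_ - _).
      rewrite (bigD1 i) //= eqxx mulr1 big1 ?addr0 // => k /negPf ->.
      by rewrite mulr0 mul0r.
    rewrite (bigD1 j) //= eqxx mulr1 big1 ?addr0 // => k /negPf ->.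
    by rewrite mulr0 mul0r.
  apply/eqP; rewrite -subr_eq0 -dotE; apply: contrapT => /negP aP; apply: H.
  by exists a => //; rewrite dotE mulrC subrr.
apply/eqmx_rVP; exists (P 0 j / Q 0 j).
  rewrite mulf_neq0 ?invr_eq0 //; apply: contraNneq P0 => Pj; apply/eqP/rowP => i.
  by apply: (mulfI Qj); rewrite PE Pj mxE !mulr0.
by apply/rowP => i; apply: (mulfI Qj); rewrite PE mxE mulrA mulrCA divff // mulr1 mulrC.
Qed.

End LocalRing.

(** * Normalization of the local rings *)

Section Normalization.
Variables (F : numClosedFieldType) (d : nat) (f : 3.-tuple {mpoly F[2]}).
Hypothesis f_homog : forall j, tnth f j \is d.-homog.
Hypothesis d_gt1 : (1 < d)%N.
Variables (c cg ch : 'rV[F]_3) (pt : 'I_d -> 'rV[F]_2).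
Hypothesis fr : is_frame f c cg ch pt.
Hypothesis param0 : forall p, p != 0 -> param f p != 0.

Local Notation K := {fraction {mpoly F[2]}}.
Local Notation l := (comb f c).
Local Notation Rg := (Rg f).
Local Notation N := ((d - 1) * (d - 2) %/ 2)%N.
Local Notation T := (normal_affine d f c).
Local Notation Rl := (curve_affine f c).
Local Notation O := (local_ring f).
Local Notation H := (hat_ring f).
Implicit Types (x t u : K) (P Q : 'rV[F]_3) (p q : 'rV[F]_2).

Let d_gt0 : (0 < d)%N := ltnW d_gt1.
Let tl0 : tofrac l != 0 :> K. Proof. by rewrite tofrac_eq0 (fr_l0 fr). Qed.
Let tlX m : tofrac l ^+ m != 0 :> K. Proof. exact: expf_neq0. Qed.

Lemma linform_pow m : linform c ^+ m \mPo f = l ^+ m.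
Proof. by rewrite rmorphXn /= linform_comp. Qed.

Lemma linform_pow_homog (a : 'rV[F]_3) m : linform a ^+ m \is m.-homog.
Proof. by have := dhomogMn m (linform_homog a); rewrite mul1n. Qed.

Lemma fiber_l P p : dot c P != 0 -> in_fiber f P p -> l.@[p 0] != 0.
Proof.
move=> cP /fiber_scale [k k0 e]; rewrite comb_eval e dotZr.
exact: mulf_neq0.
Qed.

Lemma Rl_ratio e A : A \is e.-homog -> tofrac (A \mPo f) / tofrac l ^+ e =
  Defs.ratio f A (linform c ^+ e).
Proof. by rewrite /Defs.ratio linform_pow tofracXn. Qed.

Lemma Rl_intro e A : A \is e.-homog -> Rl (Defs.ratio f A (linform c ^+ e)).
Proof. by move=> hA; rewrite -Rl_ratio //; exists e, (A \mPo f); split=> //; exists A. Qed.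

Lemma linform_pow_eval P e : dot c P != 0 -> (linform c ^+ e).@[P 0] != 0.
Proof. by move=> cP; rewrite rmorphXn /= linform_eval expf_neq0. Qed.

Lemma Rl_local P x : dot c P != 0 -> Rl x -> O P x.
Proof.
move=> cP [e [y [[A hA ->] ->]]]; exists e, A, (linform c ^+ e).
split; [by [] | exact: linform_pow_homog | exact: linform_pow_eval |].
exact: Rl_ratio.
Qed.

Lemma T_hat P x : dot c P != 0 -> T x -> H P x.
Proof.
move=> cP Tx; split; first exact: (T_FF f_homog fr Tx).
by move=> p /(fiber_l cP) lp; apply: (T_regular f_homog lp Tx).
Qed.

Lemma hatD P x t : H P x -> H P t -> H P (x + t).
Proof.
move=> [[n [a [b [ha hb b0 ex]]]] Rx] [[n' [a' [b' [ha' hb' b'0 et]]]] Rt]; split.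
  exists (n + n')%N, (a * b' + a' * b), (b * b'); split.
  - by apply: rpredD; [|rewrite addnC]; apply: dhomogM.
  - exact: dhomogM.
  - exact: mulf_neq0.
  have tb : tofrac b != 0 :> K by rewrite tofrac_eq0.
  have tb' : tofrac b' != 0 :> K by rewrite tofrac_eq0.
  by rewrite ex et (addf_div _ _ tb tb') tofracD !tofracM.
move=> p Pp; have [v Hv] := Rx p Pp; have [w Hw] := Rt p Pp.
by exists (v + w); apply: val_atD.
Qed.

Lemma hatM P x t : H P x -> H P t -> H P (x * t).
Proof.
move=> [[n [a [b [ha hb b0 ex]]]] Rx] [[n' [a' [b' [ha' hb' b'0 et]]]] Rt]; split.
  exists (n + n')%N, (a * a'), (b * b'); split; try exact: dhomogM.
    exact: mulf_neq0.
  by rewrite ex et mulf_div !tofracM.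
move=> p Pp; have [v Hv] := Rx p Pp; have [w Hw] := Rt p Pp.
by exists (v * w); apply: val_atM.
Qed.

Lemma hatC P a : H P (tofrac a%:MP).
Proof.
split=> [|p _]; last by exists a; apply: val_atC.
exists 0%N, a%:MP, 1; split; [exact: homogC | exact: dhomog1 | exact: oner_neq0 |].
by rewrite tofrac1 divr1.
Qed.

Lemma subspace_hat P : subspace (@fscale F) (H P).
Proof.
split=> [|a x t Hx Ht]; first by have := hatC P 0; rewrite mpolyC0 tofrac0.
by apply: hatD => //; apply: hatM => //; apply: hatC.
Qed.

(* A form with no zero in the fiber over [P] divides one coming from the
   curve: separate each of its zeros from [P] by a line. *)
Lemma norm_form P (s : seq 'rV[F]_2) : P != 0 -> (forall q, q \in s -> q != 0) ->
  (forall q, q \in s -> ~ in_fiber f P q) -> exists A k,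
  [/\ A \is (size s).-homog, A.@[P 0] != 0, k \is (size s * d.-1).-homog
    & A \mPo f = (\prod_(q <- s) lin q) * k].
Proof.
move=> P0; elim: s => [|q s IHs] sn sP.
  exists 1, 1; rewrite big_nil mulr1 comp_mpoly1 meval1 oner_eq0 mul0n.
  by split=> //; apply: dhomog1.
have [||A [k [hA AP hk eA]]] := IHs.
- by move=> r rs; apply: sn; rewrite inE rs orbT.
- by move=> r rs; apply: sP; rewrite inE rs orbT.
have qn := sn q (mem_head _ _).
have nq : ~~ (P == param f q)%MS.
  by apply/negP => e; apply: (sP q (mem_head _ _)); split=> //; rewrite par_sym.
have [a aq aP] := separating_form P0 (param0 qn) nq.
have hq : comb f a \is d.-1.+1.-homog by rewrite prednK //; apply: comb_homog.
have [|z hz ez] := form_root qn hq; first by rewrite comb_eval.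
exists (linform a * A), (z * k); split.
- by rewrite /= -[(size s).+1]add1n; apply: dhomogM => //; apply: linform_homog.
- by rewrite mevalM linform_eval mulf_neq0.
- by rewrite /= mulSn; apply: dhomogM.
by rewrite comp_mpolyM linform_comp ez eA big_cons mulrACA.
Qed.

(** A denominator of [x] without zeros in the fiber divides, by [norm_form], the pullback of a form
    that is nonzero at [P]. Dividing by a power of [l] makes numerator and denominator affine
    functions. *)
Lemma hat_frac P x : P != 0 -> dot c P != 0 -> H P x -> exists t u v,
  [/\ T t, Rl u, v != 0, forall p, in_fiber f P p -> val_at p u v & x * u = t].
Proof.
move=> P0 cP [Fx Rx]; have [|n [a [b [ha hb b0 bP ex]]]] := FF_regular _ Fx Rx.
  by move=> p [].
have [k [s [sz sn eb]]] := form_factor hb.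
have kn : k != 0 by apply: contraNneq b0 => k0; rewrite eb k0 scale0r.
have sP q : q \in s -> ~ in_fiber f P q.
  move=> qs /bP; rewrite eb mevalZ (perm_big _ (perm_to_rem qs)) big_cons mevalM lin_root.
  by rewrite mul0r mulr0 eqxx.
have [A [z [hA AP hz eA]]] := norm_form P0 sn sP; rewrite sz in hA hz.
have bz : A \mPo f = b * (k^-1 *: z).
  by rewrite eA eb -scalerAl -scalerAr scalerA divff // scale1r.
exists (tofrac (a * (k^-1 *: z)) / tofrac l ^+ n), (Defs.ratio f A (linform c ^+ n)).
exists (A.@[P 0] / (linform c ^+ n).@[P 0]); split.
- exists n, (a * (k^-1 *: z)); split=> //.
  have -> : (n * d = n + n * d.-1)%N by rewrite -mulnS prednK.
  by apply: dhomogM => //; apply: rpredZ.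
- exact: Rl_intro.
- by rewrite mulf_neq0 // invr_eq0 linform_pow_eval.
- move=> p Pp; apply: (ratio_val f_homog Pp hA (linform_pow_homog c n)).
  exact: linform_pow_eval.
have tb : tofrac b != 0 :> K by rewrite tofrac_eq0.
rewrite -Rl_ratio // bz ex; move: (k^-1 *: z) => y.
rewrite (tofracM b) (tofracM a) mulrA; congr (_ / _).
by rewrite mulrA divfK.
Qed.

Let sT := subspace_T f_homog fr.
Let sRl := subspace_Rl fr.
Let FA := fscale_action F.

(** The N+1 functions v^i t are dependent modulo [Rl]. Factoring the lowest power v^j out of a
    dependency leaves a cofactor with nonzero constant term; it is a unit of the local ring because
    [v] vanishes on the fiber. So already v^j t is local, and j <= N. *)
Lemma nilpotent_local Q t v : on_curve f Q -> dot c Q != 0 -> Rl v ->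
  (forall q, in_fiber f Q q -> val_at q v 0) -> T t -> O Q (v ^+ N * t).
Proof.
move=> oQ cQ Rv v0 Tt; have [_ [q Qq]] := oQ.
have TX i : T (v ^+ i * t).
  by apply: TM => //; apply: (Rl_T f_homog); apply: RlX.
have [|u u0 RH] := qdim_dep FA sT sRl (qdim_T f_homog d_gt1 fr) (ltnSn N)
   (y := fun i : 'I_N.+1 => v ^+ i * t); first by move=> i; apply: TX.
have [j uj jmin] : exists2 j, u 0 j != 0 & forall i : 'I_N.+1, (i < j)%N -> u 0 i = 0.
  have [i0 ui0] : exists i, u 0 i != 0 by apply/rV0Pn.
  case: (arg_minnP (fun i : 'I_N.+1 => i : nat) (P := fun i => u 0 i != 0) ui0) => j uj H.
  by exists j => // i; apply: contraTeq => /H; rewrite -leqNgt.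
pose w := \sum_(i < N.+1 | (j <= i)%N) fscale (u 0 i) (v ^+ (i - j)).
have Rw : Rl w.
  apply: (sub_sum FA sRl) => i _; apply: (subZ sRl); exact: RlX.
have vw : val_at q w (u 0 j).
  have : val_at q w (\sum_(i < N.+1 | (j <= i)%N) u 0 i * 0 ^+ (i - j)).
    by apply: val_at_sum => i _; apply: val_atM; [apply: val_atC | apply: val_atX; apply: v0].
  rewrite (bigD1 j) //= subnn mulr1 big1 ?addr0 // => i /andP [ji ij].
  rewrite expr0n (_ : (i - j == 0)%N = false) ?mulr0 //.
  by move: ij; rewrite -val_eqE /=; move: ji; lia.
have eH : lcomb (@fscale F) u (fun i : 'I_N.+1 => v ^+ i * t) = v ^+ j * t * w.
  rewrite /lcomb (bigID (fun i : 'I_N.+1 => (j <= i)%N)) /= [X in _ + X]big1 ?addr0; last first.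
    by move=> i; rewrite -ltnNge => /jmin ->; rewrite (act0l FA).
  rewrite /w mulr_sumr; apply: eq_bigr => i ji; rewrite /fscale -{1}(subnK ji) exprD.
  move: (v ^+ (i - j)) (v ^+ j) (tofrac _) => y z k; ring.
have Oj : O Q (v ^+ j * t).
  have w0 : w != 0.
    apply: contraNneq uj => w0; rewrite w0 in vw.
    by rewrite (val_at_uniq vw (val_at0 q)).
  rewrite -[_ * t](mulfK w0) -eH; apply: localM => //; first exact: Rl_local.
  by apply: (localV f_homog (Rl_local cQ Rw) Qq vw uj).
have jN : (j <= N)%N by rewrite -ltnS.
rewrite -(subnK jN) exprD -mulrA; apply: localM => //.
by apply: localX => //; apply: Rl_local.
Qed.

(** A product of quotients of linear forms, one for each [Q] in [s]: the numerator passes through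
    [Q] and not through [P], the denominator is the line [c]. *)
Lemma separating_function P (s : seq 'rV[F]_3) : on_curve f P -> dot c P != 0 ->
  (forall Q, Q \in s -> [/\ on_curve f Q, dot c Q != 0 & ~~ (P == Q)%MS]) ->
  exists v w, [/\ Rl v, w != 0, forall p, in_fiber f P p -> val_at p v w
    & forall Q, Q \in s -> forall q, in_fiber f Q q -> val_at q v 0].
Proof.
move=> [P0 oP] cP; elim: s => [|Q s IHs] sP.
  exists 1, 1; split=> //; [exact: Rl1 | exact: oner_neq0 | move=> p _; exact: val_at1].
have [|v [w [Rv w0 vP vs]]] := IHs; first by move=> R Rs; apply: sP; rewrite inE Rs orbT.
have [[Q0 oQ] cQ PQ] := sP Q (mem_head _ _).
have [a aQ aP] := separating_form P0 Q0 PQ.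
have hc := linform_pow_homog c 1; have ha := linform_homog a.
have cE R : dot c R != 0 -> (linform c ^+ 1).@[R 0] != 0 by apply: linform_pow_eval.
pose r := Defs.ratio f (linform a) (linform c ^+ 1).
exists (r * v), ((linform a).@[P 0] / (linform c ^+ 1).@[P 0] * w); split.
- by apply: RlM => //; apply: Rl_intro.
- by rewrite mulf_neq0 // mulf_neq0 ?invr_eq0 ?cE // linform_eval.
- move=> p Pp; apply: val_atM; last exact: vP.
  by apply: (ratio_val f_homog Pp ha hc); apply: cE.
move=> R; rewrite inE => /orP [/eqP ->|Rs] q Rq.
  have [y Hy] : exists y, val_at q v y by apply: (T_regular f_homog (fiber_l cQ Rq)); apply: (Rl_T f_homog).
  have := ratio_val f_homog Rq ha hc (cE _ cQ); rewrite linform_eval aQ mul0r => H0.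
  by rewrite -(mul0r y); apply: val_atM.
have [_ cR _] : [/\ on_curve f R, dot c R != 0 & ~~ (P == R)%MS].
  by apply: sP; rewrite inE Rs orbT.
by rewrite -(mulr0 ((linform a).@[R 0] / (linform c ^+ 1).@[R 0])); apply: val_atM;
  [apply: (ratio_val f_homog Rq ha hc); apply: cE | apply: vs Rq].
Qed.

Lemma one_minus_pow w n : Rl w -> exists2 h, Rl h & (1 - w) ^+ n = 1 - w * h.
Proof.
move=> Rw; elim: n => [|n [h Rh IHn]].
  by exists 0; [exact: Rl0 | rewrite mulr0 subr0].
exists (h + (1 - w * h)).
  apply: (RlD fr) => //; apply: (RlD fr); first exact: Rl1.
  by apply: RlN; apply: RlM.
rewrite exprS IHn; ring.
Qed.

(** Near [P] write x = t / u. The function w = k u v^N has value 1 over [P], and (1 - w)^N = 1 - w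
    h. For y = k v^N h t this gives y - x = - (1 - w)^N t / u, which [nilpotent_local] makes local
    at [P]; the factor v^N makes [y] local at the points of [s]. *)
Lemma curve_chinese P (s : seq 'rV[F]_3) x : on_curve f P -> dot c P != 0 ->
  (forall Q, Q \in s -> [/\ on_curve f Q, dot c Q != 0 & ~~ (P == Q)%MS]) ->
  H P x -> exists y, [/\ T y, O P (y - x) & forall Q, Q \in s -> O Q y].
Proof.
move=> oP cP sP /(hat_frac oP.1 cP) [t [u [a [Tt Ru a0 ua xu]]]].
have [_ [p Pp]] := oP.
have [v [b [Rv b0 vP vs]]] := separating_function oP cP sP.
pose k := tofrac ((a * b ^+ N)^-1)%:MP : K.
have Rk : Rl k by apply: RlC.
pose w := k * (u * v ^+ N).
have Rw : Rl w by do 2!apply: RlM => //; apply: RlX.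
have w1 q : in_fiber f P q -> val_at q w 1.
  move=> Pq; rewrite -(mulVf (_ : a * b ^+ N != 0)); last by rewrite mulf_neq0 ?expf_neq0.
  by apply: val_atM; [apply: val_atC | apply: val_atM; [apply: ua | apply: val_atX; apply: vP]].
have [h Rh eh] := one_minus_pow N Rw.
have Thk : T (k * (h * t)).
  by apply: TM; [apply: (Rl_T f_homog) | apply: TM; first apply: (Rl_T f_homog)].
have Rv' : T (v ^+ N) by apply: (Rl_T f_homog); apply: RlX.
exists (v ^+ N * (k * (h * t))); split; first exact: TM.
- have R1w : Rl (1 - w) by apply: (RlD fr); [exact: Rl1 | apply: RlN].
  have v1w q : in_fiber f P q -> val_at q (1 - w) 0.
    by move=> Pq; rewrite -(subrr 1); apply: val_atD; [apply: val_at1 | apply: val_atN; apply: w1].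
  have := nilpotent_local oP cP R1w v1w Tt; rewrite eh => Ot.
  have u0 : u != 0.
    apply: contraNneq a0 => u0; move: (ua p Pp); rewrite u0 => /val_at_uniq /(_ (val_at0 p)) ->.
    by [].
  have -> : v ^+ N * (k * (h * t)) - x = - (((1 - w * h) * t) / u).
    apply: (mulIf u0); rewrite mulrBl xu mulNr divfK // /w; ring.
  apply: (localN oP); apply: (localM) => //.
  by apply: (localV f_homog (Rl_local cP Ru) Pp (ua p Pp) a0).
- move=> Q Qs; have [oQ cQ _] := sP Q Qs.
  by apply: nilpotent_local => //; apply: vs.
Qed.

End Normalization.

Lemma degree_count b d e m s : (0 < d)%N -> (e + s = m * d)%N ->
  (b * d + d.-1 + e + s.+1 = (b.+1 + m) * d)%N.
Proof. by move=> d0 em; rewrite mulnDl -em mulSn; move: (b * d)%N d0 => ?; lia. Qed.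

(** * Splitting the affine quotient into local quotients *)

Section Delta.
Variables (F : numClosedFieldType) (d : nat) (f : 3.-tuple {mpoly F[2]}).
Hypothesis f_homog : forall j, tnth f j \is d.-homog.
Hypothesis d_gt1 : (1 < d)%N.
Variables (c cg ch : 'rV[F]_3) (pt : 'I_d -> 'rV[F]_2).
Hypothesis fr : is_frame f c cg ch pt.
Hypothesis param0 : forall p, p != 0 -> param f p != 0.

Local Notation K := {fraction {mpoly F[2]}}.
Local Notation l := (comb f c).
Local Notation Rg := (Rg f).
Local Notation N := ((d - 1) * (d - 2) %/ 2)%N.
Local Notation T := (normal_affine d f c).
Local Notation Rl := (curve_affine f c).
Local Notation O := (local_ring f).
Local Notation H := (hat_ring f).
Implicit Types (x t u : K) (P Q : 'rV[F]_3) (p q : 'rV[F]_2).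

Let d_gt0 : (0 < d)%N := ltnW d_gt1.
Let tl0 : tofrac l != 0 :> K. Proof. by rewrite tofrac_eq0 (fr_l0 fr). Qed.
Let tlX m : tofrac l ^+ m != 0 :> K. Proof. exact: expf_neq0. Qed.
Let sT := subspace_T f_homog fr.
Let sRl := subspace_Rl fr.
Let FA := fscale_action F.

Lemma denominator x : function_field f x -> exists r, [/\ Rl r, r != 0 & Rl (r * x)].
Proof.
move=> [e [A [B [hA hB B0 ->]]]].
have tB : tofrac (B \mPo f) != 0 :> K by rewrite tofrac_eq0.
exists (tofrac (B \mPo f) / tofrac l ^+ e); split.
- by exists e, (B \mPo f); split=> //; exists B.
- exact: (div_neq0 tB (tlX e)).
exists e, (A \mPo f); split; first by exists A.
exact: (div_mul_div _ _ tB).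
Qed.

(** Finitely many functions span [T] modulo [Rl], and each is a fraction of the curve; the product
    of their denominators works for all of [T]. *)
Lemma conductor : exists r, [/\ Rl r, r != 0 & forall t, T t -> Rl (r * t)].
Proof.
have [b [Tb span _]] := (qdimP FA _ sT sRl).1 (qdim_T f_homog d_gt1 fr).
have [r [Rr r0 Hr]] : exists r, [/\ Rl r, r != 0 & forall i, Rl (r * b i)].
  have dn i : exists r, [/\ Rl r, r != 0 & Rl (r * b i)].
    exact/denominator/(FF_function_field f_homog d_gt1 fr)/(T_FF f_homog fr).
  have /choice [r Hr] := dn; exists (\prod_i r i); split.
  - by elim/big_ind: _ => [|*|i _]; [exact: Rl1 | exact: RlM | case: (Hr i)].
  - by apply/prodf_neq0 => i _; case: (Hr i).
  move=> i; rewrite (bigD1 i) //= mulrAC; apply: RlM; first by case: (Hr i).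
  by elim/big_ind: _ => [|*|j _]; [exact: Rl1 | exact: RlM | case: (Hr j)].
exists r; split=> // t /span [u Ru].
rewrite -[t](subrK (lcomb (@fscale F) u b)) mulrDr; apply: (RlD fr); first exact: RlM.
rewrite /lcomb mulr_sumr; apply: (sub_sum FA sRl) => i _.
by rewrite /fscale mulrCA; apply: RlM => //; apply: RlC.
Qed.

(** If [a] suits the earlier points and [a'] is a denominator of [x] at the image of [p], a general
    a + tau a' is nonzero at all the listed points off the line. *)
Lemma common_denominator x (ps : seq 'rV[F]_2) :
  (forall P, on_curve f P -> dot c P != 0 -> O P x) ->
  (forall p, p \in ps -> p != 0) -> exists a, [/\ Rl a, Rl (a * x)
    & forall p, p \in ps -> l.@[p 0] != 0 -> exists2 w, val_at p a w & w != 0].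
Proof.
move=> Ox; elim: ps => [|p ps IHps] ps0.
  by exists 0; rewrite mul0r; split=> //; exact: Rl0.
have [|a [Ra Rax Ha]] := IHps; first by move=> q qs; apply: ps0; rewrite inE qs orbT.
have [lp|lp] := eqVneq l.@[p 0] 0.
  exists a; split=> // q; rewrite inE => /orP [/eqP ->|/Ha //].
  by rewrite lp eqxx.
have pn := ps0 p (mem_head _ _).
have oP : on_curve f (param f p) by split; [apply: param0 | exists p; split=> //; exact: par_refl].
have cP : dot c (param f p) != 0 by rewrite -comb_eval.
have [e [A [B [hA hB BP ex]]]] := Ox _ oP cP.
have Pp : in_fiber f (param f p) p by split=> //; exact: par_refl.
pose a' := Defs.ratio f B (linform c ^+ e).
have Ra' : Rl a' by apply: (Rl_intro f c).
have Rax' : Rl (a' * x).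
  have -> : a' * x = Defs.ratio f A (linform c ^+ e).
    have tB := local_den oP hB BP.
    by rewrite /a' ex; apply: (div_mul_div _ _ tB).
  exact: (Rl_intro f c).
have [w' Hw' w'0] : exists2 w, val_at p a' w & w != 0.
  exists (B.@[param f p 0] / (linform c ^+ e).@[param f p 0]).
    by apply: (ratio_val f_homog Pp hB (linform_pow_homog c e)); apply: linform_pow_eval.
  by rewrite mulf_neq0 // invr_eq0 linform_pow_eval.
have vals y q : Rl y -> exists w, l.@[q 0] != 0 -> val_at q y w.
  move=> Ry; have [lq|lq] := eqVneq l.@[q 0] 0; first by exists 0.
  have [w Hw] := T_regular f_homog lq (Rl_T f_homog Ry); by exists w.
have /choice [va Hva] := fun q => vals a q Ra.
have /choice [va' Hva'] := fun q => vals a' q Ra'.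
pose S := [seq (va q, va' q) | q <- [seq q : 'rV[F]_2 <- p :: ps | l.@[q 0] != 0]].
have [|tau Htau] := @avoid_pencil _ S.
  move=> u /mapP [q]; rewrite mem_filter => /andP [lq qs] ->.
  rewrite -pair_eqE /= negb_and; move: qs; rewrite inE => /orP [/eqP eq|qs]; apply/orP.
    by right; rewrite eq -(val_at_uniq Hw' (Hva' _ lp)).
  by left; have [w Hw w0] := Ha q qs lq; rewrite -(val_at_uniq Hw (Hva _ lq)).
exists (a + tofrac tau%:MP * a'); split.
- by apply: (RlD fr) => //; apply: RlM => //; apply: RlC.
- by rewrite mulrDl -mulrA; apply: (RlD fr) => //; apply: RlM => //; apply: RlC.
move=> q qs lq; exists (va q + tau * va' q).
  by apply: val_atD; [apply: Hva | apply: val_atM; [apply: val_atC | apply: Hva']].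
have /Htau : (va q, va' q) \in S by apply/mapP; exists q; rewrite // mem_filter lq.
by [].
Qed.

(* [prod_p (a - a p)], over the points [p] of [ps] off the line, is divisible
   by the product of the linear forms vanishing on [ps]. *)
Lemma vanishing_product a (ps : seq 'rV[F]_2) : Rl a -> (forall p, p \in ps -> p != 0) ->
  (forall p, p \in ps -> l.@[p 0] != 0 -> exists2 w, val_at p a w & w != 0) ->
  exists v h e (al : {mpoly F[2]}) m, [/\ v != 0, Rl h, al \is e.-homog, (e + size ps = m * d)%N
    & tofrac v%:MP + a * h = tofrac ((\prod_(p <- ps) lin p) * al) / tofrac l ^+ m].
Proof.
move=> Ra; elim: ps => [|p ps IHps] ps0 Ha.
  exists 1, 0, 0%N, 1, 0%N; split=> //; [exact: oner_neq0 | exact: Rl0 | exact: dhomog1 |].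
  by rewrite mulr0 addr0 big_nil mulr1 expr0 divr1 mpolyC1.
have [||v [h [e [al [m [v0 Rh hal em eq]]]]]] := IHps.
- by move=> q qs; apply: ps0; rewrite inE qs orbT.
- by move=> q qs; apply: Ha; rewrite inE qs orbT.
have pn := ps0 p (mem_head _ _).
have hl : l \is d.-1.+1.-homog by rewrite prednK //; apply: comb_homog.
have [lp|lp] := eqVneq l.@[p 0] 0.
  (* Here [lin p] divides [l], so multiplying numerator and denominator by [l] already supplies this
     factor. *)
  have [k hk ek] := form_root pn hl lp.
  exists v, h, (d.-1 + e)%N, (k * al), m.+1; split=> //; first exact: dhomogM.
    by have := degree_count 0 d_gt0 em; rewrite mul0n !add0n add1n.
  rewrite eq big_cons.
  have -> : lin p * \prod_(j <- ps) lin j * (k * al) = l * (\prod_(j <- ps) lin j * al).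
    by rewrite ek; ring.
  rewrite exprS; move: (\prod_(j <- ps) lin j * al) => y.
  by rewrite (tofracM l y); symmetry; apply: (div_mull _ _ tl0).
have [w Hw w0] := Ha p (mem_head _ _) lp.
have [b [y [[A hA ey] ea]]] := Ra.
have hy : y \is (b * d).-homog by rewrite ey; apply: homog_comp.
have hy' : y * l - w *: l ^+ b.+1 \is ((b * d) + d.-1).+1.-homog.
  rewrite -addnS prednK //; apply: rpredB; first by apply: dhomogM => //; apply: comb_homog.
  by rewrite addnC -mulSn; apply: rpredZ; apply: l_homog.
have wE : w = y.@[p 0] / l.@[p 0] ^+ b.
  apply: (val_at_uniq Hw); exists (b * d)%N, y, (l ^+ b).
  by rewrite tofracXn rmorphXn /= expf_neq0 //; split=> //; apply: l_homog.
have [|k hk ek] := form_root pn hy'.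
  rewrite mevalB mevalM mevalZ rmorphXn /= wE exprSr mulrA divfK ?subrr //.
  exact: expf_neq0.
have eaw : a - tofrac w%:MP = tofrac (lin p * k) / tofrac l ^+ b.+1.
  rewrite -ek ea tofracB -mul_mpolyC (tofracM y) (tofracM w%:MP) tofracXn mulrBl.
  rewrite (mulfK (tlX b.+1)); congr (_ - _); rewrite exprSr; symmetry.
  exact: (div_mulr _ _ tl0).
(* The expansion of (a - w)(v + a h): constant term - v w, and the rest divisible by [a]. *)
exists (- (v * w)), (tofrac v%:MP + a * h - tofrac w%:MP * h), ((b * d + d.-1) + e)%N, (k * al).
exists (b.+1 + m)%N; split.
- by rewrite oppr_eq0 mulf_neq0.
- apply: (RlD fr); first by apply: (RlD fr); [exact: RlC | exact: RlM].
  by apply: RlN; apply: RlM => //; apply: RlC.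
- exact: dhomogM.
- exact: degree_count.
rewrite mpolyCN mpolyCM tofracN tofracM.
transitivity ((a - tofrac w%:MP) * (tofrac v%:MP + a * h)); first by ring.
rewrite eaw eq big_cons exprD mulf_div -tofracM.
by congr (tofrac _ / _); ring.
Qed.

(** The conductor element [r] has finitely many zeros, and some [a] with [a * x] in [Rl] is nonzero
    at those off the line. Then a nonzero constant v equals r t - a h with [t] in [T] and [h] in
    [Rl], so that v x = r (t x) - h (a x) is in [Rl]. *)
Lemma affine_intersection x : T x ->
  (forall P, on_curve f P -> dot c P != 0 -> O P x) -> Rl x.
Proof.
move=> Tx Ox; have [r [Rr r0 rT]] := conductor.
have [k [rho [Rrho er]]] := Rr.
have rho0 : rho != 0 by apply: contraNneq r0 => e; rewrite er e tofrac0 mul0r.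
have [kap [ps [sz ps0 erho]]] := form_factor (Rg_homog f_homog Rrho).
have kn : kap != 0 by apply: contraNneq rho0 => e; rewrite erho e scale0r.
have [a [Ra Rax Ha]] := common_denominator Ox ps0.
have [v [h [e [al [m [v0 Rh hal em eq]]]]]] := vanishing_product Ra ps0 Ha.
have km : (k <= m)%N by rewrite -(leq_pmul2r d_gt0) -sz -em leq_addl.
pose t := tofrac (kap^-1 *: al) / tofrac l ^+ (m - k) : K.
have Tt : T t.
  exists (m - k)%N, (kap^-1 *: al); split=> //; apply: rpredZ.
  by rewrite (_ : (m - k) * d = e)%N // mulnBl -em sz addnK.
have ert : tofrac v%:MP + a * h = r * t.
  rewrite eq er /t mulf_div -exprD subnKC //; congr (_ / _).
  by rewrite -tofracM erho -scalerAl -scalerAr scalerA divff // scale1r.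
have tv : tofrac v%:MP != 0 :> K by rewrite tofrac_eq0 mpolyC_eq0.
have -> : x = tofrac v^-1%:MP * (r * (t * x) - h * (a * x)).
  have -> : r * (t * x) - h * (a * x) = tofrac v%:MP * x.
    by rewrite [r * (t * x)]mulrA -ert; ring.
  by rewrite mulrA -tofracM -mpolyCM mulVf // mpolyC1 tofrac1 mul1r.
apply: RlM; first exact: RlC.
by apply: (RlD fr); [apply/rT/TM | apply: RlN; apply: RlM].
Qed.

(** By [curve_chinese] with no further points, [T] meets every class of [hat_ring] modulo the local
    ring, so both have the same quotient; it is finite because [Rl] is contained in the local
    ring. *)
Lemma qdim_hat P : on_curve f P -> dot c P != 0 ->
  exists n, quotient_dim (@fscale F) T (O P) n /\ quotient_dim (@fscale F) (H P) (O P) n.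
Proof.
move=> oP cP; have sO := subspace_local oP.
have [n Qn] := qdim_coarser FA sT sRl sO (fun x => Rl_local cP (x := x)) (qdim_T f_homog d_gt1 fr).
exists n; split=> //; rewrite -[n]addn0.
apply: (qdim_step FA FA (phi := id) (V := T) (W := O P) (w := fun i : 'I_0 => 0)) => //.
- exact: subspace_hat.
- by move=> x; apply: (T_hat f_homog fr).
- by case.
- move=> y Hy.
  have CR := curve_chinese f_homog d_gt1 fr param0 oP cP.
  have [|z [Tz Oz _]] := CR [::] y _ Hy; first by [].
  exists z, 0; split=> //; rewrite (lcomb0 FA) subr0.
  exact: (subBC FA sO).
- move=> x u Tx; rewrite (_ : u = 0); last by apply/rowP; case.
  by rewrite (lcomb0 FA) addr0.
Qed.

Lemma qdim_intersection (s : seq 'rV[F]_3) (delta : 'rV[F]_3 -> nat) :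
  (forall P, P \in s -> on_curve f P /\ dot c P != 0) ->
  pairwise (fun P Q => ~~ (P == Q)%MS) s ->
  (forall P, P \in s -> quotient_dim (@fscale F) T (O P) (delta P)) ->
  quotient_dim (@fscale F) T (fun x => forall P, P \in s -> O P x) (\sum_(P <- s) delta P).
Proof.
elim: s => [|P s IHs] sP /=; last first.
  case/andP => /allP PQ ps Hd.
  have oP := (sP P (mem_head _ _)).1; have cP := (sP P (mem_head _ _)).2.
  have sP' Q : Q \in s -> on_curve f Q /\ dot c Q != 0 by move=> Qs; apply: sP; rewrite inE Qs orbT.
  have Qs := IHs sP' ps (fun Q Qs => Hd Q (mem_behead (s := P :: s) Qs)).
  have sO := subspace_local oP.
  have sS : subspace (@fscale F) (fun x => forall Q, Q \in s -> O Q x).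
    split=> [Q Qs'|a x y Ox Oy Q Qs']; first exact: local0.
    have sQ := subspace_local (sP' Q Qs').1.
    by apply: (subD FA sQ); [apply: (subZ sQ); apply: Ox | apply: Oy].
  have crt x : T x -> exists y, [/\ T y, O P (y - x) & forall Q, Q \in s -> O Q y].
    move=> Tx; apply: (curve_chinese f_homog d_gt1 fr param0 oP cP).
      by move=> Q Qs'; have [oQ cQ] := sP' Q Qs'; split=> //; apply: PQ.
    exact: (T_hat f_homog fr).
  rewrite big_cons.
  have := qdimI FA sT sO sS crt _ (Hd P (mem_head _ _)) Qs.
  move=> QQ; apply: (qdim_ext FA _ _ sT (QQ _)) => // [x Tx|x Tx].
    split=> [[OP OS] Q|OS]; first by rewrite inE => /orP [/eqP ->|/OS].
    by split=> [|Q Qs']; apply: OS; rewrite inE ?eqxx ?Qs' ?orbT.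
  have [y [Ty Oy Sy]] := crt x Tx; exists (x - y); split.
  - exact: (subB FA sT).
  - by move=> Q Qs'; rewrite addrAC subrr add0r; apply: (localN (sP' Q Qs').1); apply: Sy.
  - exact: (subBC FA sO).
move=> _ _; rewrite big_nil; apply/(qdimP FA) => //.
exists (fun=> 0); split=> [[]//|x Tx|u _]; first by exists 0.
by apply/rowP; case.
Qed.

End Delta.

(** * Singular points and delta invariants *)

Section Nonsingular.
Variables (F : numClosedFieldType) (d : nat) (f : 3.-tuple {mpoly F[2]}).
Hypothesis f_homog : forall j, tnth f j \is d.-homog.
Hypothesis d_gt0 : (0 < d)%N.
Hypothesis param0 : forall p, p != 0 -> param f p != 0.
Local Notation K := {fraction {mpoly F[2]}}.
Local Notation O := (local_ring f).
Implicit Types (x : K) (P Q : 'rV[F]_3) (p q : 'rV[F]_2).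

Lemma form_neq0_nonroot e (g : {mpoly F[2]}) : g \is e.-homog -> g != 0 ->
  exists2 p : 'rV[F]_2, p != 0 & g.@[p 0] != 0.
Proof.
move=> hg g0; have [s [s0 Hs]] := form_zeros hg g0.
pose perp (q : 'rV[F]_2) : 'rV[F]_2 := \row_i (if i == 0 then q 0 1 else - q 0 0).
have dotE v (q : 'rV[F]_2) : dot v (perp q) = br q v.
  rewrite /dot !big_ord_recl big_ord0 /br !mxE /= addr0.
  have -> : lift ord0 (ord0 : 'I_1) = 1 :> 'I_2 by apply/val_inj.
  have -> : (ord0 : 'I_2) = 0 by apply/val_inj.
  ring.
have perp0 q : q != 0 -> perp q != 0.
  rewrite !rV2_neq0 !mxE /= oppr_eq0 orbC //.
have [|v Hv] := @avoid_points _ _ [seq perp q | q <- (\row_i (i == 0)%:R) :: s].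
  move=> u /mapP [q]; rewrite inE => qs ->; apply: perp0.
  by case/orP: qs => [/eqP ->|/s0 //]; rewrite rV2_neq0 !mxE /= oner_eq0.
have vn : v != 0.
  have := Hv _ (map_f _ (mem_head _ _)); apply: contraNneq => ->.
  by rewrite /dot big1 // => j _; rewrite mxE mul0r.
exists v => //; apply/eqP => /(Hs _ vn) [z zs vz].
have := Hv (perp z) (map_f _ (mem_behead (s := _ :: s) zs)).
by rewrite dotE (br_eq0 (s0 _ zs) vn) par_sym vz.
Qed.

Lemma vanishing_comp e (G : {mpoly F[3]}) : G \is e.-homog ->
  vanishes_on_curve f G -> G \mPo f = 0.
Proof.
move=> hG G0; apply: contrapT => /eqP /(form_neq0_nonroot (homog_comp f_homog hG)).
case=> p pn /eqP; rewrite comp_eval; apply; apply: G0; split; first exact: param0.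
by exists p; split=> //; exact: par_refl.
Qed.

Lemma comp_vanishing e (G : {mpoly F[3]}) : G \is e.-homog ->
  G \mPo f = 0 -> vanishes_on_curve f G.
Proof.
by move=> hG G0 P [_ [p Pp]]; apply/eqP; rewrite -(fiber_eval Pp hG) G0 meval0.
Qed.

Section AtPoint.
Variables (P : 'rV[F]_3) (p : 'rV[F]_2).
Hypothesis Pp : in_fiber f P p.
Hypothesis P_curve : on_curve f P.

Variables (j a b : 'I_3).
Hypothesis Pj : P 0 j != 0.
Hypothesis jab : forall V : zmodType, forall z : 'I_3 -> V, z j = 0 -> \sum_i z i = z a + z b.
Let X i : {mpoly F[3]} := P 0 j *: 'X_i - P 0 i *: 'X_j.

Variables (eG : nat) (Ga Gb : {mpoly F[3]}).
Hypothesis hGa : Ga \is eG.-homog.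
Hypothesis hGb : Gb \is eG.-homog.
Hypothesis Gb_unit : Gb.@[P 0] != 0.
Hypothesis relG : (X a * Ga + X b * Gb) \mPo f = 0.

Let pn : p != 0. Proof. by case: Pp. Qed.
Let hX i : X i \is 1.-homog.
Proof. by apply: rpredB; apply: rpredZ; apply: homogX. Qed.
Let XP i : (X i).@[P 0] = 0.
Proof. by rewrite mevalB !mevalZ !mevalXU mulrC subrr. Qed.
Let hL : ('X_j : {mpoly F[3]}) \is 1.-homog. Proof. exact: homogX. Qed.
Let LP : ('X_j : {mpoly F[3]}).@[P 0] != 0. Proof. by rewrite mevalXU. Qed.

(** A generator of the maximal ideal at [P]: since [Gb] is a unit there, [relG] makes [X b] a
    multiple of [X a] locally. The hypothesis [jab] says that [j], [a], [b] are the three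
    indices. *)
Let pi_ := Defs.ratio f (X a) 'X_j.

Let pi_local : O P pi_.
Proof. by exists 1%N, (X a), 'X_j; split. Qed.

Let pi_val : val_at p pi_ 0.
Proof. by have := ratio_val f_homog Pp (hX a) hL LP; rewrite XP mul0r. Qed.

Lemma uniformize_unit e (A B : {mpoly F[3]}) : A \is e.-homog -> B \is e.-homog ->
  B.@[P 0] != 0 -> A.@[P 0] != 0 ->
  exists k u v, [/\ O P u, val_at p u v, v != 0 & Defs.ratio f A B = pi_ ^+ k * u].
Proof.
move=> hA hB BP AP; exists 0%N, (Defs.ratio f A B), (A.@[P 0] / B.@[P 0]).
rewrite expr0 mul1r; split=> //.
- by exists e, A, B.
- exact: (ratio_val f_homog Pp hA hB BP).
- exact: div_neq0.
Qed.

(** Induction on a bound for the order at [p] of the pullback of [A]. If [A] vanishes at [P],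
    expanding it in [X a] and [X b] and using [relG] gives A Gb X_j = (X a) A' on the curve, so a
    factor [pi_] splits off and the order drops. *)
Lemma uniformize m e (A B : {mpoly F[3]}) : A \is e.-homog -> B \is e.-homog ->
  B.@[P 0] != 0 -> (exists m' h, [/\ (m' <= m)%N, h.@[p 0] != 0 & A \mPo f = lin p ^+ m' * h]) ->
  exists k u v, [/\ O P u, val_at p u v, v != 0 & Defs.ratio f A B = pi_ ^+ k * u].
Proof.
elim: m e A B => [|m IHm] e A B hA hB BP [m' [h [mm hp eA]]];
  have [AP|AP] := eqVneq A.@[P 0] 0; try exact: (uniformize_unit hA hB BP AP).
  have : (A \mPo f).@[p 0] == 0 by rewrite (fiber_eval Pp hA) AP.
  move: mm; rewrite leqn0 => /eqP m0; rewrite eA m0 expr0 mul1r => hp0.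
  by rewrite hp0 in hp.
have Af0 : A \mPo f != 0.
  by rewrite eA mulf_neq0 ?expf_neq0 ?(neq0_eval hp) ?(lin_neq0 pn).
case: e hA hB => [|e] hA hB.
  by move: Af0; rewrite (const_form_eq0 hA AP) comp_mpoly0 eqxx.
have [Ai [hAi eAi]] := homog_vanish Pj hA AP.
have eAab : A = X a * Ai a + X b * Ai b.
  rewrite eAi; apply: (jab (z := fun i => X i * Ai i)).
  by rewrite /X subrr mul0r.
pose A' := 'X_j * (Ai a * Gb - Ga * Ai b); pose B' := B * Gb.
have hA' : A' \is (e.+1 + eG).-homog.
  rewrite addSn -[(e + eG).+1]add1n; apply: dhomogM => //; apply: rpredB; first exact: dhomogM.
  by rewrite addnC; apply: dhomogM.
have hB' : B' \is (e.+1 + eG).-homog by apply: dhomogM.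
have B'P : B'.@[P 0] != 0 by rewrite mevalM mulf_neq0.
have key : (A \mPo f) * (Gb \mPo f) * ('X_j \mPo f) = (X a \mPo f) * (A' \mPo f).
  move: relG; rewrite eAab /A' 2!comp_mpolyD !comp_mpolyM.
  rewrite [(_ * _ - _ * _) \mPo f]comp_mpolyB !comp_mpolyM.
  move: (X a \mPo f) (X b \mPo f) (Ga \mPo f) (Gb \mPo f) (Ai a \mPo f) (Ai b \mPo f) ('X_j \mPo f).
  move=> xa xb ga gb aa ab xj rel.
  transitivity ((xa * aa * gb + (xa * ga + xb * gb - xa * ga) * ab) * xj); first by ring.
  by rewrite rel; ring.
have key0 : (A \mPo f) * (Gb \mPo f) * ('X_j \mPo f) != 0.
  rewrite !mulf_neq0 //; apply: (@neq0_eval _ _ (p 0)); first by rewrite (fiber_eval Pp hGb).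
  by rewrite (fiber_eval Pp hL).
have A'0 : A' \mPo f != 0 by move: key0; rewrite key mulf_eq0 negb_or => /andP [].
have [m2 [h2 [_ _ h2p eA']]] := form_order pn (homog_comp f_homog hA') A'0.
have [z ez] : exists z, X a \mPo f = lin p * z.
  have hXf : X a \mPo f \is d.-1.+1.-homog.
    by have := homog_comp f_homog (hX a); rewrite mul1n prednK.
  have [|z _ ez] := form_root pn hXf; last by exists z.
  by apply/eqP; rewrite (fiber_eval Pp (hX a)) XP.
(* The pullback of [X a] vanishes at [p], those of [Gb] and ['X_j] do not, so [A'] has smaller order
   than [A]. *)
have lt_m : (m2 < m')%N.
  rewrite ltnNge; apply/negP => le_m.
  have : h * (Gb \mPo f) * ('X_j \mPo f) = lin p * (z * lin p ^+ (m2 - m') * h2).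
    apply: (mulfI (expf_neq0 m' (lin_neq0 pn))).
    transitivity ((A \mPo f) * (Gb \mPo f) * ('X_j \mPo f)); first by rewrite eA; ring.
    rewrite key ez eA' -{1}(subnKC le_m) exprD.
    move: (lin p ^+ m') (lin p ^+ (m2 - m')) (lin p) => y1 y2 y3; ring.
  move/(congr1 (meval (p 0)))/eqP; rewrite !mevalM lin_root mul0r !mulf_eq0 (negPf hp).
  by rewrite (fiber_eval Pp hGb) (fiber_eval Pp hL) (negPf Gb_unit) (negPf LP).
have [|k [u [v [Ou uv v0 eu]]]] := IHm _ A' B' hA' hB' B'P.
  by exists m2, h2; split=> //; rewrite -ltnS; apply: leq_trans lt_m mm.
exists k.+1, u, v; split=> //; rewrite exprS -mulrA -eu.
have tL : tofrac ('X_j \mPo f) != 0 :> K := local_den P_curve hL LP.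
have tG : tofrac (Gb \mPo f) != 0 :> K := local_den P_curve hGb Gb_unit.
rewrite /pi_ /Defs.ratio mulf_div -(tofracM (X a \mPo f)) -key /B' comp_mpolyM.
move: tL tG; move: (A \mPo f) (Gb \mPo f) ('X_j \mPo f) (B \mPo f) => y1 y2 y3 y4 ty3 ty2.
rewrite (tofracM (y1 * y2)) (tofracM y1) (tofracM y4) [_ * tofrac y3]mulrC.
by rewrite (div_mull _ _ ty3) (div_mulr _ _ ty2).
Qed.

(** Numerator and denominator are powers of [pi_] times local units. If the denominator had the
    larger power, [x] times a positive power of [pi_] would be a unit with value 0 at [p]. *)
Lemma nonsingular_regular x : function_field f x -> regular p x -> O P x.
Proof.
move=> [e [A [B [hA hB B0 ex]]]] [w Hw].
have [x0|x0] := eqVneq x 0; first by rewrite x0; apply: local0.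
have A0 : A \mPo f != 0.
  apply: contraNneq x0 => A0; by rewrite ex /Defs.ratio A0 tofrac0 mul0r.
have hLe : ('X_j ^+ e : {mpoly F[3]}) \is e.-homog by have := dhomogMn e hL; rewrite mul1n.
have LeP : ('X_j ^+ e : {mpoly F[3]}).@[P 0] != 0 by rewrite rmorphXn /= expf_neq0.
have unif (C : {mpoly F[3]}) : C \is e.-homog -> C \mPo f != 0 ->
    exists k u v, [/\ O P u, val_at p u v, v != 0 & Defs.ratio f C ('X_j ^+ e) = pi_ ^+ k * u].
  move=> hC C0; have [m [h [_ _ hp eC]]] := form_order pn (homog_comp f_homog hC) C0.
  by apply: (@uniformize m e C); rewrite // ; exists m, h.
have [k1 [u1 [v1 [Ou1 uv1 v10 e1]]]] := unif A hA A0.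
have [k2 [u2 [v2 [Ou2 uv2 v20 e2]]]] := unif B hB B0.
have tLe := local_den P_curve hLe LeP.
have tB : tofrac (B \mPo f) != 0 :> K by rewrite tofrac_eq0.
have ex2 : x * (pi_ ^+ k2 * u2) = pi_ ^+ k1 * u1.
  rewrite -e1 -e2 ex /Defs.ratio mulrC; exact: (div_mul_div _ _ tB).
have u20 : u2 != 0.
  by apply: contraNneq v20 => u20; rewrite u20 in uv2; rewrite (val_at_uniq uv2 (val_at0 p)).
have Ou2V := localV f_homog Ou2 Pp uv2 v20.
have u2V := val_atV uv2 v20.
have xE : x * pi_ ^+ k2 = pi_ ^+ k1 * (u1 * u2^-1).
  by rewrite -[LHS](mulfK u20) -[x * _ * u2]mulrA ex2 mulrA.
have pi0 : pi_ != 0 \/ k2 = 0%N.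
  case: k2 e2 {ex2 xE} => [|k2] e2; [by right | left].
  apply: contraTneq (div_neq0 tB tLe) => pi0; rewrite negbK.
  by rewrite -[_ / _]/(Defs.ratio f B ('X_j ^+ e)) e2 pi0 exprS !mul0r.
have [le21|lt12] := leqP k2 k1.
  have -> : x = pi_ ^+ (k1 - k2) * (u1 * u2^-1).
    case: pi0 => [pi0|k20]; last by rewrite k20 subn0 -xE k20 expr0 mulr1.
    apply: (mulIf (expf_neq0 k2 pi0)); rewrite xE -{1}(subnK le21) exprD.
    move: (pi_ ^+ (k1 - k2)) (pi_ ^+ k2) (u1 * _) => y1 y2 y3; ring.
  by apply: localM => //; [apply: localX | apply: localM].
case: pi0 => [pi0|k20]; last by rewrite k20 in lt12.
have e3 : x * pi_ ^+ (k2 - k1).-1.+1 = u1 * u2^-1.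
  rewrite prednK ?subn_gt0 //; apply: (mulfI (expf_neq0 k1 pi0)); rewrite -xE mulrCA -exprD.
  by rewrite subnKC // ltnW.
have : val_at p (u1 * u2^-1) 0.
  by rewrite -e3 -(mulr0 w) -(mul0r (0 ^+ (k2 - k1).-1)) -exprS; apply: val_atM => //; apply: val_atX.
move/(val_at_uniq (val_atM uv1 u2V))/eqP.
by rewrite mulf_eq0 invr_eq0 (negPf v10) (negPf v20).
Qed.

End AtPoint.
(** A form with a nonzero derivative at [P] is expanded in the linear forms [X i]. These vanish at
    [P], so the derivative only involves the values of the cofactors, and one of index other than
    [j] is nonzero. *)
Lemma nonsingular_chart P : on_curve f P -> ~ singular_point f P ->
  exists j a b eG (Ga Gb : {mpoly F[3]}), [/\ P 0 j != 0,
   forall V : zmodType, forall z : 'I_3 -> V, z j = 0 -> \sum_i z i = z a + z b,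
   Ga \is eG.-homog /\ Gb \is eG.-homog, Gb.@[P 0] != 0
   & ((P 0 j *: 'X_a - P 0 a *: 'X_j) * Ga + (P 0 j *: 'X_b - P 0 b *: 'X_j) * Gb) \mPo f = 0].
Proof.
move=> oP nP; have [P0 _] := oP.
have [e [G [hG Gv [k Gk]]]] : exists e G, [/\ G \is e.-homog, vanishes_on_curve f G
    & exists k, G^`M(k).@[P 0] != 0].
  apply: contrapT => H; apply: nP; split=> // e G hG Gv k; apply: contrapT => /eqP Gk.
  by apply: H; exists e, G; split=> //; exists k.
have [j Pj] : exists j, P 0 j != 0 by apply/rV0Pn.
case: e hG => [|e] hG.
  by move: Gk; rewrite (homog0C hG) mderivC meval0 eqxx.
have [B [hB eG]] := homog_vanish Pj hG (Gv P oP).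
pose X i : {mpoly F[3]} := P 0 j *: 'X_i - P 0 i *: 'X_j.
have [b Bb bj] : exists2 b, (B b).@[P 0] != 0 & b != j.
  apply: contrapT => H; move/negP: Gk; apply.
  rewrite eG mderiv_sum meval_sum big1 // => i _.
  rewrite mderivM mevalD !mevalM mevalB !mevalZ !mevalXU [P 0 j * P 0 i]mulrC subrr mul0r addr0.
  have [->|ij] := eqVneq i j; first by rewrite subrr mderiv0 meval0 mul0r.
  have [->|Bi] := eqVneq (B i).@[P 0] 0; first by rewrite mulr0.
  by case: H; exists i.
have [a aj ab] : exists2 a : 'I_3, a != j & a != b.
  (* The three indices add up to 3. *)
  have aE : (inord (3 - (j + b)) : 'I_3) = (3 - (j + b))%N :> nat.
    by rewrite inordK //; move: bj; rewrite -val_eqE /=; lia.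
  exists (inord (3 - (j + b))); rewrite -val_eqE /= aE;
    move: bj (ltn_ord j) (ltn_ord b); rewrite -val_eqE /=; lia.
have jab : forall V : zmodType, forall z : 'I_3 -> V, z j = 0 -> \sum_i z i = z a + z b.
  move=> V z zj; rewrite (bigD1 j) //= zj add0r (bigD1 a) //= (bigD1 b) /=; last by rewrite bj eq_sym.
  rewrite big1 ?addr0 // => i /andP [/andP [ij ia] ib].
  move: ij ia ib aj ab bj (ltn_ord i) (ltn_ord j) (ltn_ord a) (ltn_ord b).
  by rewrite -!val_eqE /=; lia.
exists j, a, b, e, (B a), (B b); split=> //.
rewrite -(vanishing_comp hG Gv) eG; congr (_ \mPo f); symmetry.
by apply: (jab _ (fun i => X i * B i)); rewrite /X subrr mul0r.
Qed.

End Nonsingular.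

Lemma comp_mpolyA (R : comNzRingType) n k m (D : {mpoly R[n]})
    (w : n.-tuple {mpoly R[k]}) (g : k.-tuple {mpoly R[m]}) :
  (D \mPo w) \mPo g = D \mPo [tuple (tnth w i) \mPo g | i < n].
Proof.
elim/mpolyind: D => [|c mo p _ _ IHp]; first by rewrite !comp_mpoly0.
rewrite !comp_mpolyD !comp_mpolyZ IHp !comp_mpolyX rmorph_prod /=.
by congr (_ *: _ + _); apply: eq_bigr => i _; rewrite rmorphXn /= tnth_mktuple.
Qed.

(** The rows of [ps] need not satisfy [Q]; they only bound the number of classes. A representative
    is added for each class that contains a row satisfying [Q] and is not yet represented. *)
Lemma parallel_representatives (F : fieldType) n (Q : 'rV[F]_n -> Prop) (ps : seq 'rV[F]_n) :
  (forall P, Q P -> exists2 z, z \in ps & (P == z)%MS) -> exists s,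
  [/\ forall P, P \in s -> Q P, forall P, Q P -> exists2 P', P' \in s & (P == P')%MS
    & pairwise (fun P P' => ~~ (P == P')%MS) s].
Proof.
move=> Qps; have [s [sQ sc sp]] : exists s, [/\ forall P, P \in s -> Q P,
    forall P, Q P -> (exists2 z, z \in ps & (P == z)%MS) -> exists2 P', P' \in s & (P == P')%MS
    & pairwise (fun P P' => ~~ (P == P')%MS) s].
  elim: ps {Qps} => [|z ps [s [sQ sc sp]]]; first by exists [::]; split=> // P _ [].
  case: (EM (exists P, [/\ Q P, (P == z)%MS & forall P', P' \in s -> ~~ (P == P')%MS])).
    move=> [P0 [QP0 P0z P0s]]; exists (P0 :: s); split.
    - by move=> P; rewrite inE => /orP [/eqP ->|/sQ].
    - move=> P QP [y]; rewrite inE => /orP [/eqP -> Pz|ys Py].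
        exists P0; first exact: mem_head.
        by apply: par_trans Pz _; rewrite par_sym.
      have [|P' P's PP'] := sc P QP; first by exists y.
      by exists P'; rewrite // inE P's orbT.
    - by rewrite /= sp andbT; apply/allP.
  move=> nP; exists s; split=> // P QP [y]; rewrite inE => /orP [/eqP -> Pz|ys Py].
    apply: contrapT => H; apply: nP; exists P; split=> // P' P's.
    by apply/negP => PP'; apply: H; exists P'.
  by apply: sc => //; exists y.
by exists s; split=> // P QP; apply: sc => //; apply: Qps.
Qed.

Section Delta.
Variables (F : numClosedFieldType) (d : nat) (f : 3.-tuple {mpoly F[2]}).
Hypothesis f_homog : forall j, tnth f j \is d.-homog.
Hypothesis d_gt1 : (1 < d)%N.
Hypothesis f_gcd : gcd_is_one f.
Hypothesis f_gen : generically_one_to_one f.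
Local Notation K := {fraction {mpoly F[2]}}.
Local Notation O := (local_ring f).
Local Notation H := (hat_ring f).
Local Notation N := ((d - 1) * (d - 2) %/ 2)%N.
Implicit Types (x : K) (P Q : 'rV[F]_3) (p q : 'rV[F]_2).

Let d_gt0 : (0 < d)%N := ltnW d_gt1.
Let param0 p : p != 0 -> param f p != 0.
Proof. exact: (param_neq0 f_homog d_gt0 f_gcd (p := p)). Qed.

Lemma frame_avoiding (s : seq 'rV[F]_3) : (forall P, P \in s -> on_curve f P) ->
  exists c cg ch (pt : 'I_d -> 'rV[F]_2),
    is_frame f c cg ch pt /\ forall P, P \in s -> dot c P != 0.
Proof. by move=> sP; apply: frame_exists => // P /sP []. Qed.

Lemma regular_function_field x : FF x -> function_field f x.
Proof.
have [|c [cg [ch [pt [fr _]]]]] := @frame_avoiding [::]; first by [].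
exact: (FF_function_field f_homog d_gt1 fr).
Qed.

Lemma nonsingular_local P p x : on_curve f P -> ~ singular_point f P ->
  in_fiber f P p -> FF x -> regular p x -> O P x.
Proof.
move=> oP nP Pp /regular_function_field Kx Rx.
have [j [a [b [eG [Ga [Gb [Pj jab [hGa hGb] GbP rel]]]]]]] :=
  nonsingular_chart f_homog d_gt0 param0 oP nP.
exact: (nonsingular_regular f_homog d_gt0 Pp oP Pj jab hGa hGb GbP rel).
Qed.

(** A function regular at [p] with a pole at [q] would be in the local ring of [P], hence would have
    a value at [q] too. *)
Lemma nonsingular_fiber P p q : on_curve f P -> ~ singular_point f P ->
  in_fiber f P p -> in_fiber f P q -> (p == q)%MS.
Proof.
move=> oP nP Pp Pq; have [pn _] := Pp; have [qn _] := Pq.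
rewrite -(br_eq0 pn qn); apply: contrapT => /negP pq.
have [m hm mq] := form_nonroot 1 qn.
have ln := lin_neq0 qn; have hq := lin_homog q.
pose x : K := tofrac m / tofrac (lin q).
have lqp : (lin q).@[p 0] != 0 by rewrite lin_eval brC oppr_eq0.
have Fx : FF x by exists 1%N, m, (lin q).
have Rx : regular p x by exists (m.@[p 0] / (lin q).@[p 0]), 1%N, m, (lin q).
have [w Hw] := local_val f_homog (nonsingular_local oP nP Pp Fx Rx).
have Hy : val_at q (tofrac (lin q) / tofrac m) 0.
  by exists 1%N, (lin q), m; rewrite lin_root mul0r.
have tm : tofrac m != 0 :> K by rewrite tofrac_eq0 (neq0_eval mq).
have tq : tofrac (lin q) != 0 :> K by rewrite tofrac_eq0.
have e1 : x * (tofrac (lin q) / tofrac m) = 1 := mul_div_swap tm tq.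
have := val_atM (Hw q Pq) Hy; rewrite e1 mulr0 => /val_at_uniq /(_ (val_at1 q)) /eqP.
by rewrite eq_sym oner_eq0.
Qed.

(** Taken of minimal degree among the nonzero forms vanishing on the curve: some derivative is a
    nonzero form of smaller degree, so it does not vanish on the curve. This makes the singular
    points finite in number. *)
Lemma curve_form : exists e (G : {mpoly F[3]}),
  [/\ G \is e.-homog, G \mPo f = 0 & exists j, G^`M(j) \mPo f != 0].
Proof.
have [|c [cg [ch [pt [fr _]]]]] := @frame_avoiding [::]; first by [].
have [D [hD D0 D1]] := curve_equation f_homog d_gt1 fr.
pose w := [tuple linform c; linform cg; linform ch].
have hw i : tnth w i \is 1.-homog.
  by case: i => -[|[|[|//]]] Hi; rewrite (tnth_nth 0) /=; apply: linform_homog.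
pose E := D \mPo w.
have hE : E \is d.-homog by rewrite -[d]muln1; apply: homog_comp.
have E0 : E \mPo f = 0.
  rewrite comp_mpolyA -[RHS]D0; congr (_ \mPo _); apply/eq_from_tnth => i.
  rewrite tnth_mktuple.
  by case: i => -[|[|[|//]]] Hi; rewrite !(tnth_nth 0) /= linform_comp.
have En : E != 0.
  have /choice [X HX] : forall i : 'I_3, exists x : F * F * F,
      (\row_j (j == i)%:R : 'rV[F]_3) = x.1.1 *: c + x.1.2 *: cg + x.2 *: ch.
    by move=> i; have [x1 [x2 [x3 e]]] := fr_span fr (\row_j (j == i)%:R); exists (x1, x2, x3).
  pose M : 'M[F]_3 := \matrix_(a, j) (tnth [tuple c; cg; ch] a) 0 j.
  pose Y : 'M[F]_3 := \matrix_(i, a) tnth [tuple (X i).1.1; (X i).1.2; (X i).2] a.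
  have YM : Y *m M = 1%:M.
    apply/matrixP => i j; rewrite !mxE !big_ord_recl big_ord0 addr0 !mxE !(tnth_nth 0) /=.
    have /rowP /(_ j) := HX i; rewrite !mxE addrA eq_sym => ->.
    by [].
  have MY := mulmx1C YM.
  pose v : 'rV[F]_3 := \row_j Y j ord_max.
  have dv a : dot (tnth [tuple c; cg; ch] a) v = (a == ord_max)%:R.
    have /matrixP /(_ a ord_max) := MY; rewrite !mxE => <-.
    by rewrite /dot; apply: eq_bigr => j _; rewrite !mxE.
  (* In the frame, [v] has the coordinates (0, 0, 1), where [D] takes the value 1. *)
  apply: (@neq0_eval _ _ (v 0)); rewrite comp_mpoly_meval.
  rewrite (_ : D.@[_] = 1) ?oner_eq0 // -[RHS]D1; apply: meval_eq => a.
  rewrite !mxE -dv -linform_eval; congr (_.@[_]).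
  by case: a => -[|[|[|//]]] Ha; rewrite !(tnth_nth 0).
have [e [G [hG G0 Gn emin]]] : exists e (G : {mpoly F[3]}), [/\ G \is e.-homog, G \mPo f = 0, G != 0
    & forall e' (G' : {mpoly F[3]}), (e' < e)%N -> G' \is e'.-homog -> G' \mPo f = 0 -> G' = 0].
  elim/ltn_ind: d E hE E0 En => e IHe G hG G0 Gn.
  case: (EM (exists e' (G' : {mpoly F[3]}), [/\ (e' < e)%N, G' \is e'.-homog, G' \mPo f = 0 & G' != 0])).
    by move=> [e' [G' [lt hG' G'0 G'n]]]; apply: (IHe _ lt G').
  move=> nG; exists e, G; split=> // e' G' lt hG' G'0.
  by apply: contrapT => /eqP G'n; apply: nG; exists e', G'.
exists e, G; split=> //; case: e hG emin => [|e] hG emin.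
  by move: G0 Gn; rewrite (homog0C hG) comp_mpolyC => /eqP; rewrite !mpolyC_eq0 => /eqP ->; rewrite eqxx.
have [m Gm] : exists m, m \in msupp G.
  by exists (mlead G); apply: mlead_supp.
have [j mj] : exists j, m j != 0%N.
  apply: contrapT => Hm; have := homog_mdeg hG Gm; rewrite mdegE big1 // => j _.
  by apply: contrapT => mj; apply: Hm; exists j; apply/eqP.
exists j; apply/eqP => dG0; have := emin e _ (ltnSn e) (homog_deriv j hG) dG0.
move/(congr1 (mcoeff (m - U_(j)))); rewrite mcoeff_mderiv mcoeff0 submK ?lep1mP //.
move/eqP; rewrite mulrn_eq0 /= => /eqP Gm0.
by move: Gm; rewrite mcoeff_msupp Gm0 eqxx.
Qed.

Lemma singular_locus_exists : exists s, singular_locus f s.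
Proof.
have [e [G [hG G0 [j dG]]]] := curve_form.
have hd : G^`M(j) \is e.-1.-homog.
  case: e hG => [|e] hG; last exact: homog_deriv.
  by rewrite (homog0C hG) mderivC rpred0.
have [zs [zs0 Hzs]] := form_zeros (homog_comp f_homog hd) dG.
have [|s [s1 s2 s3]] := @parallel_representatives _ _ (singular_point f) [seq param f z | z <- zs].
  move=> P [oP sP]; have [_ [p Pp]] := oP; have [pn pP] := Pp.
  have : (G^`M(j) \mPo f).@[p 0] = 0.
    by apply/eqP; rewrite (fiber_eval Pp hd) (sP e G hG (comp_vanishing hG G0)).
  move=> /(Hzs _ pn) [z zz pz]; exists (param f z); first exact: map_f.
  by apply: par_trans (param_par f_homog pz); rewrite par_sym.
by exists s.
Qed.

(** At a pole of an integral element, dividing the equation by the top power of [x] and evaluating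
    would give 1 = 0. Conversely, the quotient by the local ring has finite dimension n, so a
    nontrivial constant combination of x, ..., x^(n+1) is local, and this is an integral equation up
    to a constant. *)
Lemma normalized_hat P x : on_curve f P -> normalized_local_ring f P x <-> H P x.
Proof.
move=> oP; split.
  move=> [Kx [h [hm hO hx]]]; have Fx := function_field_FF f_homog Kx; split=> // p Pp.
  have [pn _] := Pp; have [//|[x0 vx]] := FF_valuation pn Fx.
  have /choice [v Hv] := fun i => local_val f_homog (hO i).
  have : val_at p 0 1.
    have hs : (0 < size h)%N by rewrite lt0n size_poly_eq0 monic_neq0.
    have e0 : \sum_(i < size h) h`_i * x^-1 ^+ ((size h).-1 - i) = 0.
      have : h.[x] * x^-1 ^+ (size h).-1 = 0 by move/eqP: hx => ->; rewrite mul0r.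
      rewrite horner_coef mulr_suml => e1; rewrite -[RHS]e1; apply: eq_bigr => i _.
      have ih : (i <= (size h).-1)%N by rewrite -ltnS prednK.
      rewrite -mulrA; congr (_ * _); rewrite -{2}(subnKC ih) exprD mulrA -exprMn.
      by rewrite divff // expr1n mul1r.
    have : val_at p (\sum_(i < size h) h`_i * x^-1 ^+ ((size h).-1 - i))
        (\sum_(i < size h) v i * 0 ^+ ((size h).-1 - i)).
      by apply: val_at_sum => i _; apply: val_atM; [apply: Hv | apply: val_atX].
    have rh : ((size h).-1 < size h)%N by rewrite prednK.
    rewrite e0 (bigD1 (Ordinal rh)) //= subnn mulr1 [X in _ + X]big1 ?addr0 => [|i ir].
      rewrite (val_at_uniq (Hv (size h).-1 p Pp) (_ : val_at p _ 1)) //.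
      by have /monicP := hm; rewrite lead_coefE => ->; apply: val_at1.
    rewrite expr0n (_ : ((size h).-1 - i == 0)%N = false) ?mulr0 //.
    by move: ir (ltn_ord i); rewrite -val_eqE /=; clear; lia.
  by move/val_at_uniq => /(_ _ (val_at0 p)) /eqP; rewrite oner_eq0.
move=> Hx; split; first by apply: regular_function_field; case: Hx.
have [|c [cg [ch [pt [fr Hc]]]]] := @frame_avoiding [:: P].
  by move=> Q; rewrite inE => /eqP ->.
have cP : dot c P != 0 by apply: Hc; rewrite mem_head.
have [n [_ Q]] := qdim_hat f_homog d_gt1 fr param0 oP cP.
have FA := fscale_action F.
have Hpow i : H P (x ^+ i).
  elim: i => [|i IHi]; first by have := hatC f P 1; rewrite mpolyC1 tofrac1.
  by rewrite exprS; apply: hatM.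
have sO := subspace_local oP.
have [|u u0 Oy] := qdim_dep FA (subspace_hat f P) sO Q (ltnSn n) (y := fun i : 'I_n.+1 => x ^+ i.+1).
  by move=> i; apply: Hpow.
set y := lcomb _ _ _ in Oy.
(* Only the constant term [- y] is a general local element. The leading coefficient has positive
   index, so it is a nonzero constant and can be inverted. *)
pose E i : K := if i is i'.+1 then tofrac (oapp (u 0) 0 (insub i'))%:MP else - y.
pose h0 := \poly_(i < n.+2) E i.
have OE i : O P (E i) by case: i => [|i]; [apply: (localN oP) | apply: localC].
have h0x : h0.[x] = 0.
  rewrite horner_poly big_ord_recl /= expr0 mulr1 /y /lcomb addrC; apply/eqP.
  rewrite subr_eq0; apply/eqP; apply: eq_bigr => i _.
  by rewrite /E /= valK.
have [i ui] : exists i, u 0 i != 0 by apply/rV0Pn.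
have h0i : h0`_i.+1 != 0.
  by rewrite coef_poly ltnS ltn_ord /= valK /= tofrac_eq0 mpolyC_eq0.
have sz : (i.+1 < size h0)%N.
  by rewrite ltnNge; apply/negP => /leq_sizeP /(_ _ (leqnn _)) /eqP; rewrite (negPf h0i).
have h0n : h0 != 0 by rewrite -size_poly_gt0; apply: leq_ltn_trans sz.
have lcE : exists2 k, k != 0 & lead_coef h0 = tofrac k%:MP.
  have : lead_coef h0 != 0 by rewrite lead_coef_eq0.
  rewrite lead_coefE; case: (size h0) sz => [//|[//|m]] _ /=.
  rewrite coef_poly; case: ifP => _; last by rewrite eqxx.
  by rewrite /E tofrac_eq0 mpolyC_eq0 => k0; exists (oapp (u 0) 0 (insub m)).
have [k k0 lck] := lcE.
have lcn : lead_coef h0 != 0 by rewrite lead_coef_eq0.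
exists ((lead_coef h0)^-1 *: h0); split.
- by rewrite monicE lead_coefZ mulVf.
- move=> m; rewrite coefZ lck; apply: localM; last first.
    by rewrite coef_poly; case: ifP => _; [apply: OE | apply: local0].
  have -> : (tofrac k%:MP)^-1 = tofrac (k^-1)%:MP :> K.
    apply: (mulfI (_ : tofrac k%:MP != 0)); first by rewrite tofrac_eq0 mpolyC_eq0.
    by rewrite divff ?tofrac_eq0 ?mpolyC_eq0 // -tofracM -mpolyCM divff // mpolyC1 tofrac1.
  exact: localC.
- by rewrite rootZ ?invr_eq0 // /root h0x.
Qed.

(** The line is chosen to miss the singular points. Nonsingular points impose no condition on [T],
    so being local at the singular points already means lying in [Rl]; thus the local dimensions add
    up to that of [T] modulo [Rl]. *)
Lemma total_deltaE : total_delta f N.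
Proof.
have [s [s1 s2 s3]] := singular_locus_exists.
have oS P : P \in s -> on_curve f P by move=> /s1 [].
have [c [cg [ch [pt [fr Hc]]]]] := frame_avoiding oS.
have FA := fscale_action F.
have sT := subspace_T f_homog fr; have sRl := subspace_Rl fr.
have /choice [delta Hd] : forall P, exists n, P \in s ->
    quotient_dim (@fscale F) (normal_affine d f c) (O P) n /\
    quotient_dim (@fscale F) (H P) (O P) n.
  move=> P; have [Ps|] := boolP (P \in s); last by exists 0%N.
  by have [n Hn] := qdim_hat f_homog d_gt1 fr param0 (oS P Ps) (Hc P Ps); exists n.
exists s, delta; split=> //.
  move=> P Ps; apply: (qdim_ext FA _ _ (subspace_hat f P) (Hd P Ps).2) => // x.
  by split=> /(normalized_hat x (oS P Ps)).
have Q := qdim_intersection f_homog d_gt1 fr param0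
  (fun P Ps => conj (oS P Ps) (Hc P Ps)) s3 (fun P Ps => (Hd P Ps).1).
apply: (qdim_uniq FA sT sRl (qdim_T f_homog d_gt1 fr)).
apply: (qdim_ext FA _ _ sT Q) => // x Tx; split=> [Ox|Rx P Ps]; last first.
  exact: (Rl_local (Hc P Ps) Rx).
apply: (affine_intersection f_homog d_gt1 fr param0 Tx) => P oP cP.
have [_ [p Pp]] := oP.
have [/s2 [Q' Qs PQ]|nP] := EM (singular_point f P).
  by apply: (local_par (P := Q')); [rewrite par_sym | apply: Ox].
apply: (nonsingular_local oP nP Pp); first exact: (T_FF f_homog fr Tx).
exact: (T_regular f_homog (fiber_l cP Pp) Tx).
Qed.

Lemma FF_inv x : FF x -> FF x^-1.
Proof.
move=> [n [a [b [ha hb b0 ->]]]]; rewrite invf_div.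
have [->|a0] := eqVneq a 0; last by exists n, b, a.
exists 0%N, 0, 1; split; [exact: rpred0 | exact: dhomog1 | exact: oner_neq0 |].
by rewrite !tofrac0 invr0 mulr0 mul0r.
Qed.

(** With one point in the fiber, invertible means nonzero value there, and a nonzero sum has a
    nonzero term. *)
Lemma injective_unibranch P : on_curve f P ->
  (forall p q, in_fiber f P p -> in_fiber f P q -> (p == q)%MS) -> unibranch f P.
Proof.
rewrite /unibranch => oP inj /= x y /(normalized_hat x oP) Hx /(normalized_hat y oP) Hy.
have [_ [p Pp]] := oP.
have inv z v : H P z -> val_at p z v -> v != 0 ->
    [/\ normalized_local_ring f P z, z != 0 & normalized_local_ring f P z^-1].
  move=> Hz zv v0; split; first exact/normalized_hat.
    by apply: contraNneq v0 => z0; rewrite z0 in zv; rewrite (val_at_uniq zv (val_at0 p)).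
  apply/(normalized_hat _ oP); split; first by apply: FF_inv; case: Hz.
  move=> q Pq; exists v^-1; apply: val_atV => //.
  by apply: val_at_par zv; apply: inj.
move=> [_ xy0 /(normalized_hat _ oP) [_ Rxy]].
have [v Hv] := Hx.2 p Pp; have [w Hw] := Hy.2 p Pp; have [u Hu] := Rxy p Pp.
have := val_atM (val_atD Hv Hw) Hu; rewrite divff // => /val_at_uniq /(_ (val_at1 p)) e.
have [v0|v0] := eqVneq v 0; last by left; apply: inv Hv v0.
right; apply: inv Hw _ => //; apply/eqP => w0.
by move/eqP: e; rewrite v0 w0 addr0 mul0r eq_sym oner_eq0.
Qed.

(** If [p] and [q] were different, a function [x] with values 0 and 1 at them would give x + (1 - x)
    = 1 with neither term invertible. *)
Lemma unibranch_injective P p q : on_curve f P -> unibranch f P ->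
  in_fiber f P p -> in_fiber f P q -> (p == q)%MS.
Proof.
move=> oP uP Pp Pq; have [pn _] := Pp; have [qn _] := Pq.
rewrite -(br_eq0 pn qn); apply: contrapT => /negP pq.
have [|c [cg [ch [pt [fr Hc]]]]] := @frame_avoiding [:: P].
  by move=> Q; rewrite inE => /eqP ->.
have cP : dot c P != 0 by apply: Hc; rewrite mem_head.
have [r hr rq] := form_nonroot d.-1 qn.
have lf := fiber_l cP.
pose k := (lin p).@[q 0] * r.@[q 0] / (comb f c).@[q 0].
have k0 : k != 0 by rewrite /k lin_eval !mulf_neq0 ?invr_eq0 ?lf.
pose g := k^-1 *: (lin p * r).
have hg : g \is d.-homog.
  apply: rpredZ; rewrite -[d]prednK // -[d.-1.+1]add1n.
  by apply: dhomogM => //; apply: lin_homog.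
pose x : K := tofrac g / tofrac (comb f c).
have hl : comb f c \is d.-homog by apply: comb_homog.
have xval s : in_fiber f P s -> val_at s x (g.@[s 0] / (comb f c).@[s 0]).
  by move=> Ps; exists d, g, (comb f c); split=> //; apply: lf.
have xp : val_at p x 0.
  by have := xval p Pp; rewrite mevalZ mevalM lin_root mul0r mulr0 mul0r.
have xq : val_at q x 1.
  have := xval q Pq; rewrite mevalZ mevalM -mulrA -/k mulVf //.
have Hx : H P x.
  split; first by exists d, g, (comb f c); split=> //; apply: (neq0_eval (fiber_l cP Pp)).
  by move=> s Ps; eexists; apply: xval Ps.
have H1 : H P 1 by have := hatC f P 1; rewrite mpolyC1 tofrac1.
have Hy : H P (1 - x).
  apply: hatD => //.
  by have := hatM (hatC f P (-1)) Hx; rewrite mpolyCN mpolyC1 tofracN tofrac1 mulN1r.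
have yq : val_at q (1 - x) 0.
  by rewrite -(subrr 1); apply: val_atD (val_at1 q) (val_atN xq).
have noninv s z : in_fiber f P s -> val_at s z 0 -> z != 0 ->
    normalized_local_ring f P z^-1 -> False.
  move=> Ps z0v z0 /(normalized_hat _ oP) [_ /(_ s Ps) [w Hw]].
  have := val_atM z0v Hw; rewrite divff // mul0r => /val_at_uniq /(_ (val_at1 s)) /eqP.
  by rewrite eq_sym oner_eq0.
have H1' := (normalized_hat 1 oP).2 H1.
case: (uP x (1 - x)).
- exact/normalized_hat.
- exact/normalized_hat.
- by rewrite addrC subrK; split; rewrite ?invr1 ?oner_neq0.
- by case=> _ z0; apply: noninv Pp xp z0.
- by case=> _ z0; apply: noninv Pq yq z0.
Qed.

End Delta.

(** * The ideal of minors *)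

Section Minors.
Variables (R : idomainType) (n : nat).
Implicit Types (M : 'M[R]_(n, n.+1)) (c : 'rV[R]_n.+1).

(** A combination of the maximal minors with coefficients [c] up to sign. Adding to [c] a
    combination of the rows of [M] changes nothing, so row operations replace the handling of single
    minors. *)
Definition bordered M c : R := \det (col_mx c M : 'M_(1 + n)).

Lemma bordered_minors M c :
  bordered M c = \sum_j c 0 j * ((-1) ^+ j * \det (col' j M)).
Proof.
rewrite /bordered (expand_det_row _ (lshift n (0 : 'I_1))); apply: eq_bigr => j _.
rewrite col_mxEu /cofactor add0n; congr (_ * (_ * \det _)).
apply/matrixP=> a b; rewrite !mxE; case: splitP => [k|k] /=.
  by case: k => [[|k] hk] //=; rewrite /bump leq0n.
by rewrite /bump leq0n !add1n => -[ak]; congr (M _ _); apply: val_inj.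
Qed.

Lemma borderedB M c c' : bordered M (c - c') = bordered M c - bordered M c'.
Proof.
rewrite !bordered_minors -sumrB; apply: eq_bigr => j _.
by rewrite !mxE mulrBl.
Qed.

Lemma borderedZ M a c : bordered M (a *: c) = a * bordered M c.
Proof.
by rewrite !bordered_minors mulr_sumr; apply: eq_bigr => j _; rewrite mxE mulrA.
Qed.

Lemma bordered_sum M k (a : 'I_k -> R) (v : 'I_k -> 'rV_n.+1) :
  bordered M (\sum_i a i *: v i) = \sum_i a i * bordered M (v i).
Proof.
under [RHS]eq_bigr do rewrite bordered_minors mulr_sumr.
rewrite exchange_big bordered_minors; apply: eq_bigr => j _.
by rewrite summxE mulr_suml; apply: eq_bigr => i _; rewrite mxE mulrA.
Qed.

Lemma bordered_mul M y : bordered M (y *m M) = 0.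
Proof.
apply/eqP/det0P; exists (row_mx (1%:M : 'M_1) (- y)).
  apply/eqP => /matrixP/(_ 0 (lshift n 0)); rewrite row_mxEl !mxE eqxx => /eqP.
  by rewrite oner_eq0.
by rewrite mul_row_col mul1mx mulNmx subrr.
Qed.

Lemma bordered_eq0 M c : bordered M c = 0 ->
  exists x : 'cV[R]_n.+1, [/\ x != 0, c *m x = 0 & M *m x = 0].
Proof.
rewrite /bordered -det_tr => /eqP/det0P[v v0 vM]; exists v^T.
  have : (col_mx c M) *m v^T = 0 by apply: trmx_inj; rewrite trmx_mul trmxK vM trmx0.
  rewrite mul_col_mx => /eqP; rewrite col_mx_eq0 => /andP[/eqP-> /eqP->].
  split=> //.
by apply: contraNneq v0 => /(congr1 trmx); rewrite trmxK trmx0 => ->.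
Qed.

End Minors.

Lemma map_bordered (R S : idomainType) (n : nat) (h : {rmorphism R -> S})
    (M : 'M[R]_(n, n.+1)) (c : 'rV[R]_n.+1) :
  h (bordered M c) = bordered (map_mx h M) (map_mx h c).
Proof. by rewrite /bordered -det_map_mx map_col_mx. Qed.

(** * Evaluation functionals on coefficient vectors *)

Section BinaryCoefficients.
Variable R : comNzRingType.
Implicit Types (g : {mpoly R[2]}) (v : 'I_2 -> R).

Definition binom_exp d k : 'X_{1..2} := (U_(ord0) *+ (d - k) + U_(ord_max) *+ k)%MM.

Lemma binom_exp0 d k : binom_exp d k ord0 = (d - k)%N.
Proof. by rewrite /binom_exp mnmDE !mulmnE !mnm1E /= mul1n mul0n addn0. Qed.

Lemma binom_exp1 d k : binom_exp d k ord_max = k.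
Proof. by rewrite /binom_exp mnmDE !mulmnE !mnm1E /= mul1n mul0n add0n. Qed.

Lemma mdeg2 (m : 'X_{1..2}) : mdeg m = (m ord0 + m ord_max)%N.
Proof. by rewrite mdegE big_ord_recl big_ord1; congr (_ + m _)%N; apply: val_inj. Qed.

Lemma form_monomials d g : g \is d.-homog ->
  g = \sum_(k < d.+1) g@_(binom_exp d k) *: 'X_[binom_exp d k].
Proof.
move=> hg; apply/mpolyP => m; rewrite raddf_sum /=.
have Em k : binom_exp d k == m -> (k <= d)%N -> mdeg m = d.
  by move=> /eqP <- kd; rewrite mdeg2 binom_exp0 binom_exp1; lia.
have [md|md] := eqVneq (mdeg m) d; last first.
  rewrite (dhomog_nemf_coeff hg md) big1 // => k _; rewrite mcoeffZ mcoeffX.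
  case: eqP => [/eqP/Em|]; last by rewrite mulr0.
  by move=> /(_ (ltn_ord k)) E; rewrite E eqxx in md.
have mk : (m ord_max < d.+1)%N by rewrite -md mdeg2; lia.
have Ek : binom_exp d (m ord_max) = m.
  apply/mnmP => i; case: (unliftP ord_max i) => [j ->|->]; last by rewrite binom_exp1.
  have -> : lift ord_max j = ord0 by case: j => [[|j] hj]; apply: val_inj.
  by rewrite binom_exp0 -md mdeg2 addnK.
rewrite (bigD1 (Ordinal mk)) //= mcoeffZ mcoeffX Ek eqxx mulr1 big1 ?addr0 // => k nk.
rewrite mcoeffZ mcoeffX; case: eqP => [km|]; last by rewrite mulr0.
by case/eqP: nk; apply: val_inj; rewrite /= -km binom_exp1.
Qed.

Lemma form_coef_eval d g v : g \is d.-homog ->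
  g.@[v] = \sum_(k < d.+1) v 0 ^+ (d - k) * v 1 ^+ k * g@_(binom_exp d k).
Proof.
move=> hg; rewrite {1}(form_monomials hg) meval_sum; apply: eq_bigr => k _.
rewrite mevalZ mevalX mulrC big_ord_recl big_ord1; congr (_ * _ ^+ _ * _).
- by rewrite binom_exp0.
- by congr v; apply: val_inj.
- by have -> : lift ord0 ord0 = ord_max :> 'I_2 by [apply: val_inj]; rewrite binom_exp1.
Qed.

End BinaryCoefficients.

Section EvaluationRows.
Variable F : fieldType.
Implicit Types p : 'rV[F]_2.

(** The functional that evaluates at [p], in the monomial basis of the forms of degree [d]. *)
Definition ev d p : 'rV[F]_d.+1 := \row_k (p 0 0 ^+ (d - k) * p 0 1 ^+ k).

(** A dependency between the columns is a form of degree d with d+1 zeros. *)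
Lemma ev_unit d (pt : 'I_d.+1 -> 'rV[F]_2) : (forall i, pt i != 0) ->
  (forall i j, i != j -> br (pt i) (pt j) != 0) ->
  (\matrix_i ev d (pt i)) \in unitmx.
Proof.
move=> p0 pD; rewrite -unitmx_tr unitmxE unitfE; apply/det0P => -[v v0 vW].
pose g : {mpoly F[2]} := \sum_(k < d.+1) v 0 k *: 'X_[binom_exp d k].
have hg : g \is d.-homog.
  apply: rpred_sum => k _; apply: rpredZ; rewrite dhomogX /= mdeg2 binom_exp0 binom_exp1.
  by have := ltn_ord k; lia.
have cg (k : 'I_d.+1) : g@_(binom_exp d k) = v 0 k.
  rewrite /g raddf_sum (bigD1 k) //= mcoeffZ mcoeffX eqxx mulr1 big1 ?addr0 // => j jk.
  rewrite mcoeffZ mcoeffX; case: eqP => [/(congr1 (fun m : 'X_{1..2} => m ord_max))|]; last by rewrite mulr0.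
  by rewrite !binom_exp1 => E; case/eqP: jk; apply: val_inj.
have g0 : g = 0.
  apply: (form_eq0 p0 pD (P := predT) _ hg); first by rewrite card_ord.
  move=> i _; rewrite (form_coef_eval _ hg).
  have /matrixP/(_ 0 i) := vW; rewrite !mxE => E; rewrite -[RHS]E; apply: eq_bigr => k _.
  by rewrite cg !mxE mulrC.
by case/eqP: v0; apply/rowP => k; rewrite -cg g0 mcoeff0 mxE.
Qed.

End EvaluationRows.

Section ShiftedForms.
Variable R : comNzRingType.
Implicit Types (g : {mpoly R[2]}) (v : 'I_2 -> R).

Lemma quadratic_homog (a b c : R) :
  a *: 'X_0 ^+ 2 + b *: ('X_0 * 'X_1) + c *: 'X_1 ^+ 2 \is [in R[2], 2.-homog].
Proof.
by do !apply: rpredD; apply: rpredZ; rewrite ?expr2; exact: (dhomogM (homogX _ _) (homogX _ _)).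
Qed.

Lemma quadratic_eval (a b c : R) v :
  (a *: 'X_0 ^+ 2 + b *: ('X_0 * 'X_1) + c *: 'X_1 ^+ 2).@[v] =
  a * v 0 ^+ 2 + b * (v 0 * v 1) + c * v 1 ^+ 2.
Proof. by rewrite !mevalD !mevalZ mevalM !rmorphXn /= !mevalXU. Qed.

Lemma shifted_homog a b e g : g \is e.-homog -> 'X_0 ^+ a * 'X_1 ^+ b * g \is (a + b + e).-homog.
Proof.
have hX i k : ('X_i ^+ k : {mpoly R[2]}) \is k.-homog.
  by rewrite -{2}[k]mul1n; apply: dhomogMn; apply: homogX.
by move=> hg; rewrite dhomogM // dhomogM.
Qed.

Lemma shifted_eval a b g v : ('X_0 ^+ a * 'X_1 ^+ b * g).@[v] = v 0 ^+ a * v 1 ^+ b * g.@[v].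
Proof. by rewrite !mevalM !rmorphXn /= !mevalXU. Qed.

Lemma shifted_coef_eval d a b e g v : g \is e.-homog -> d = (a + b + e)%N ->
  \sum_(k < d.+1) v 0 ^+ (d - k) * v 1 ^+ k *
    ('X_0 ^+ a * 'X_1 ^+ b * g)@_(binom_exp d k) = v 0 ^+ a * v 1 ^+ b * g.@[v].
Proof.
move=> hg ->; rewrite -shifted_eval; symmetry.
exact: (form_coef_eval v (shifted_homog a b hg)).
Qed.

Lemma shifted_quadratic_coef (a b c : R) i j (m : 'X_{1..2}) : exists x y z : bool,
  ('X_0 ^+ i * 'X_1 ^+ j * (a *: 'X_0 ^+ 2 + b *: ('X_0 * 'X_1) + c *: 'X_1 ^+ 2))@_m =
  a * x%:R + b * y%:R + c * z%:R.
Proof.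
rewrite !mpolyXn -!mpolyXD !mulrDr -!scalerAr -!mpolyXD !mcoeffD !mcoeffZ !mcoeffX.
by do 3!eexists.
Qed.

End ShiftedForms.

Section SplitColumns.
Variables (R : comNzRingType) (n : nat).

(** The first block faces the multiples of P_2, the second the three columns of [f]; the cast hides
    n + 3 = n.+3. *)
Definition join_mx m (A : 'M[R]_(m, n)) (B : 'M[R]_(m, 3)) : 'M[R]_(m, n.+3) :=
  castmx (erefl m, addn3 n) (row_mx A B).

Lemma join_mxK m (C : 'M_(m, n.+3)) : exists A B, C = join_mx A B.
Proof.
pose D := castmx (erefl m, esym (addn3 n)) C.
by exists (lsubmx D), (rsubmx D); rewrite /join_mx hsubmxK castmxKV.
Qed.

Lemma join_mx_inj m (A A' : 'M_(m, n)) B B' : join_mx A B = join_mx A' B' -> A = A' /\ B = B'.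
Proof. by move=> /(can_inj (castmxK _ _)); exact: eq_row_mx. Qed.

Lemma join_mx0 m : join_mx (0 : 'M_(m, n)) 0 = 0.
Proof. by rewrite /join_mx row_mx0 castmx_const. Qed.

Lemma join_mxD m (A A' : 'M_(m, n)) B B' : join_mx A B + join_mx A' B' = join_mx (A + A') (B + B').
Proof. by apply/matrixP=> i j; rewrite !(mxE, castmxE); case: splitP => k _; rewrite !mxE. Qed.

Lemma join_mx_sum m (I : Type) (r : seq I) (P : pred I) (A : I -> 'M_(m, n)) B :
  \sum_(i <- r | P i) join_mx (A i) (B i) =
  join_mx (\sum_(i <- r | P i) A i) (\sum_(i <- r | P i) B i).
Proof.
by elim/big_rec3: _ => [|i U V W _ ->]; rewrite ?join_mx0 ?join_mxD.
Qed.

Lemma join_mxZ m a (A : 'M_(m, n)) B : a *: join_mx A B = join_mx (a *: A) (a *: B).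
Proof. by apply/matrixP=> i j; rewrite !(mxE, castmxE); case: splitP => k _; rewrite !mxE. Qed.

Lemma join_mxN m (A : 'M_(m, n)) B : - join_mx A B = join_mx (- A) (- B).
Proof. by rewrite -!scaleN1r join_mxZ. Qed.

Lemma mul_join_mx m k (y : 'M_(k, m)) (A : 'M_(m, n)) B :
  y *m join_mx A B = join_mx (y *m A) (y *m B).
Proof.
rewrite /join_mx -mul_mx_row; move: (row_mx A B).
by case: _ / (addn3 n) => C; rewrite !castmx_id.
Qed.

Lemma join_mx_dot m k (A : 'M_(m, n)) B (X : 'M_(k, n)) Y :
  join_mx A B *m (join_mx X Y)^T = A *m X^T + B *m Y^T.
Proof.
rewrite -mul_row_col -tr_row_mx /join_mx.
by move: (row_mx A B) (row_mx X Y); case: _ / (addn3 n) => a b; rewrite !castmx_id.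
Qed.

End SplitColumns.

Lemma map_join_mx (R S : comNzRingType) (n : nat) (h : {rmorphism R -> S}) m
  (A : 'M[R]_(m, n)) B : map_mx h (join_mx A B) = join_mx (map_mx h A) (map_mx h B).
Proof. by rewrite /join_mx map_castmx map_row_mx. Qed.

Lemma map_mx_combination (R S : comNzRingType) (h : {rmorphism R -> S}) m n k
    (a : 'I_k -> R) (v : 'I_k -> 'M[R]_(m, n)) :
  map_mx h (\sum_i a i *: v i) = \sum_i h (a i) *: map_mx h (v i).
Proof.
by elim/big_rec2: _ => [|i x y _ <-]; rewrite ?map_mx0 // map_mxD map_mxZ.
Qed.

Section EvaluatedRows.
Variables (F : fieldType) (n : nat) (f : 3.-tuple {mpoly F[2]}).
Hypothesis f_homog : forall j, tnth f j \is n.+2.-homog.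
Implicit Types p : 'rV[F]_2.

(** The value of P_2 at [p] as a linear form in u; its zeros are the quadratic forms vanishing at
    [p]. *)
Definition quad p : {mpoly F[3]} :=
  p 0 0 ^+ 2 *: 'X_0 + (p 0 0 * p 0 1) *: 'X_1 + p 0 1 ^+ 2 *: 'X_(inord 2).

Lemma quad_homog p : quad p \is 1.-homog.
Proof. by rewrite /quad; do !apply: rpredD; apply: rpredZ; apply: homogX. Qed.

Lemma P2_homog : P2 F \is 2.-homog.
Proof. exact: quadratic_homog. Qed.

Lemma P2_eval p : (P2 F).@[fun i => (p 0 i)%:MP] = quad p.
Proof.
rewrite /P2 quadratic_eval /quad -!rmorphXn -rmorphM.
by rewrite -!mul_mpolyC; congr (_ + _ + _); exact: mulrC.
Qed.

Local Notation lift_row := (map_mx (@mpolyC 3 F)).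

Lemma ev_M2 p : lift_row (ev n.+2 p) *m M2 f n.+2 =
  join_mx (quad p *: lift_row (ev n p)) (lift_row (param f p)).
Proof.
apply/rowP=> j; rewrite mxE.
transitivity (\sum_(k < n.+3) (p 0 0)%:MP ^+ (n.+2 - k) * (p 0 1)%:MP ^+ k *
    (M2_form f n.+2 j)@_(binom_exp n.+2 k)).
  by apply: eq_bigr => k _; rewrite !mxE rmorphM !rmorphXn.
rewrite castmxE mxE /M2_form; case: splitP => k /= jk.
  rewrite jk /= ltn_ord.
  have en : n.+2 = (n.+2 - 2 - k + k + 2)%N by have := ltn_ord k; lia.
  etransitivity; first exact: (shifted_coef_eval (fun i => (p 0 i)%:MP) P2_homog en).
  rewrite P2_eval !mxE mulrC.
  by rewrite rmorphM !rmorphXn /= !subSS subn0.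
rewrite jk /= ltnNge leq_addr /= addKn inord_val !mxE.
rewrite (form_coef_eval _ (f_homog k)) rmorph_sum /=; apply: eq_bigr => i _.
by rewrite mcoeff_map_mpoly /= !rmorphM !rmorphXn.
Qed.

End EvaluatedRows.

Lemma comp_mpoly_congr n (R : comNzRingType) (w : n.-tuple {mpoly R[n]}) (l : {mpoly R[n]})
    (c : 'I_n -> R) : l \is 1.-homog -> (forall i, tnth w i = 'X_i + c i *: l) ->
  forall e a, a \is e.-homog -> exists2 b, a \mPo w = a + l * b & b \is e.-1.-homog.
Proof.
(* The predecessor of degree 0 is 0, so the induction also has to record that [b] is zero in that
   case. *)
move=> hl hw; pose Q e (b : {mpoly R[n]}) := (b \is e.-1.-homog) && ((e == 0%N) ==> (b == 0)).
suff H : forall e a, a \is e.-homog -> exists2 b, a \mPo w = a + l * b & Q e b.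
  by move=> e a /H[b ab /andP[hb _]]; exists b.
elim=> [|e IH] a ha.
  exists 0; last by rewrite /Q rpred0 !eqxx.
  by rewrite (homog0C ha) comp_mpolyC mulr0 addr0.
have [B [hB ->]] := homog_decomp ha.
have /choice[b Hb] i : exists b, B i \mPo w = B i + l * b /\ Q e b.
  by have [b] := IH _ (hB i); exists b.
exists (\sum_i ('X_i * b i + c i *: B i + c i *: (l * b i))).
  rewrite raddf_sum mulr_sumr -big_split /=; apply: eq_bigr => i _.
  rewrite comp_mpolyM (Hb i).1 comp_mpolyXi hw -!mul_mpolyC.
  by move: (b i) (B i) (c i)%:MP => u v z; ring.
rewrite /Q /= andbT; apply: rpred_sum => i _.
have /andP[hb b0] := (Hb i).2.
have lb m : m \is 1.-homog -> m * b i \is e.-homog.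
  move=> hm; case: e {IH ha hB Hb} hb b0 => [_ /eqP->|e hb _]; first by rewrite mulr0 rpred0.
  by rewrite -add1n dhomogM.
by apply: rpredD; first apply: rpredD; first exact: lb (homogX _ _); apply: rpredZ;
  [exact: hB | exact: lb].
Qed.

Lemma comp_mpoly_congr_all n (R : comNzRingType) (w : n.-tuple {mpoly R[n]}) (l : {mpoly R[n]})
    (c : 'I_n -> R) : l \is 1.-homog -> (forall i, tnth w i = 'X_i + c i *: l) ->
  forall a, exists b, a \mPo w = a + l * b.
Proof.
move=> hl hw; elim/mpolyind => [|t m a _ _ [b ab]].
  by exists 0; rewrite comp_mpoly0 mulr0 addr0.
have hX : ('X_[m] : {mpoly R[n]}) \is (mdeg m).-homog by rewrite dhomogX.
have [b' mb _] := comp_mpoly_congr hl hw hX.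
exists (t *: b' + b); rewrite comp_mpolyD comp_mpolyZ ab mb.
by rewrite scalerDr mulrDr scalerAr addrACA.
Qed.

(* [sigma] restricts to the line [quad p1 = 0], on which
   [u0 s^2 + u1 s t + u2 t^2] is the product of [lin p1] and of a linear form
   with the free coefficients ['X_1], [-'X_0]; [rho] is a section of it. *)
Section LineRestriction.
Variables (F : fieldType) (p1 : 'rV[F]_2).
Local Notation x := (p1 0 0).
Local Notation y := (p1 0 1).
Hypothesis x0 : x != 0.

Definition line_tuple : 3.-tuple {mpoly F[2]} :=
  [tuple y *: 'X_1; - (y *: 'X_0 + x *: 'X_1); x *: 'X_0].

Definition section_tuple : 2.-tuple {mpoly F[3]} :=
  [tuple x^-1 *: 'X_(inord 2); - x^-1 *: ('X_1 + (y / x) *: 'X_(inord 2))].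

Local Notation sigma a := (a \mPo line_tuple).
Local Notation rho b := (b \mPo section_tuple).

Lemma line_tuple2 : tnth line_tuple (inord 2) = x *: 'X_0.
Proof. by rewrite (tnth_nth 0) /= inordK. Qed.

Lemma sigma_homog e a : a \is e.-homog -> sigma a \is e.-homog.
Proof.
move=> ha; rewrite -[e]muln1; apply: (homog_comp _ ha) => -[[|[|[|i]]] hi] //;
  rewrite (tnth_nth 0) /= ?rpredN; do ?[apply: rpredD | apply: rpredZ | exact: homogX].
Qed.

(** On the line, P_2 is [lin p1] times a second linear form. The two factors of the result are their
    values at [p], each up to sign; the second is [lin p] read in the coefficients of the second
    form. *)
Lemma sigma_quad p : sigma (quad p) = br p p1 *: lin p.
Proof.
rewrite /quad !comp_mpolyD !comp_mpolyZ !comp_mpolyXi line_tuple2 !(tnth_nth 0) /=.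
rewrite /lin /br -!mul_mpolyC !(rmorphD, rmorphN, rmorphM, rmorphXn) /=.
by move: (p 0 0)%:MP (p 0 1)%:MP x%:MP y%:MP => a b c d; ring.
Qed.

Lemma rhoK b : sigma (rho b) = b.
Proof.
rewrite comp_mpolyA -[RHS]comp_mpoly_id; congr (_ \mPo _).
apply: eq_from_tnth => i; rewrite !tnth_mktuple (tnth_nth 0).
case: i => [[|[|i]] hi] //=.
  rewrite comp_mpolyZ comp_mpolyXi line_tuple2 scalerA mulVf // scale1r.
  by congr 'X_ _; apply: val_inj.
rewrite comp_mpolyZ comp_mpolyD comp_mpolyZ !comp_mpolyXi line_tuple2 (tnth_nth 0) /=.
rewrite scalerA divfK // addrC opprD addrA subrr sub0r scaleNr scalerN opprK.
by rewrite scalerA mulVf // scale1r; congr 'X_ _; apply: val_inj.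
Qed.

Lemma sigmaK i : rho (sigma 'X_i) = 'X_i + (if i == 0 then - (x ^- 2) else 0) *: quad p1.
Proof.
rewrite comp_mpolyXi (tnth_nth 0); case: i => [[|[|[|i]]] hi] //=.
- rewrite comp_mpolyZ comp_mpolyXi (tnth_nth 0) /= /quad !scalerDr !scalerA.
  have -> : 'X_(Ordinal hi) = 'X_0 :> {mpoly F[3]} by congr 'X_ _; apply: val_inj.
  rewrite mulNr mulVf ?expf_neq0 // scaleN1r !addrA subrr add0r.
  congr (_ *: _ + _ *: _); rewrite expr2; field; exact: x0.
- rewrite scale0r addr0 comp_mpolyN comp_mpolyD !comp_mpolyZ !comp_mpolyXi !(tnth_nth 0) /=.
  rewrite scaleNr scalerN !scalerA divff // scale1r opprB addrK.
  by congr 'X_ _; apply: val_inj.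
- rewrite scale0r addr0 comp_mpolyZ comp_mpolyXi (tnth_nth 0) /= scalerA divff // scale1r.
  by congr 'X_ _; apply: val_inj; rewrite /= inordK.
Qed.
End LineRestriction.

Lemma nonparallel_indep (F : fieldType) n (P Q : 'rV[F]_n) a b :
  P != 0 -> Q != 0 -> ~~ (P == Q)%MS -> a *: P + b *: Q = 0 -> a = 0 /\ b = 0.
Proof.
move=> P0 Q0 PQ E.
have b0 : b = 0.
  apply: contraNeq PQ => b0; have QE : Q = - (a / b) *: P.
    apply: (scalerI b0); rewrite scalerA mulrN mulrC divfK // scaleNr.
    by apply/eqP; rewrite -addr_eq0 addrC E.
  have a0 : a != 0 by apply: contraNneq Q0 => a0; rewrite QE a0 mul0r oppr0 scale0r.
  rewrite par_sym QE; apply/eqmx_rVP; exists (- (a / b)) => //.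
  by rewrite oppr_eq0 mulf_neq0 ?invr_eq0.
split=> //; move: E; rewrite b0 scale0r addr0 => /eqP.
by rewrite scaler_eq0 (negPf P0) orbF => /eqP.
Qed.

Lemma map_mxC_unit (F : fieldType) r m (A : 'M[F]_m) : A \in unitmx ->
  map_mx (@mpolyC r F) (invmx A) *m map_mx (@mpolyC r F) A = 1%:M.
Proof. by move=> uA; rewrite -map_mxM mulVmx // map_mx1. Qed.

(** * Relations between the minors on the line [quad p1 = 0] *)

Section Exactness.
Variables (F : numClosedFieldType) (n : nat) (f : 3.-tuple {mpoly F[2]}).
Hypothesis f_homog : forall j, tnth f j \is n.+2.-homog.
Variables (c cg ch : 'rV[F]_3) (pt : 'I_n.+2 -> 'rV[F]_2) (ps : 'rV[F]_2).
Hypothesis fr : is_frame f c cg ch pt.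
Hypothesis ps_c : dot c (param f ps) != 0.
Local Notation B := {mpoly F[2]}.
Local Notation cst := (map_mx (@mpolyC 2 F)).
Local Notation p1 := (pt ord0).
Local Notation q i := (pt (lift ord0 i)).
Local Notation Mb := (map_mx (comp_mpoly (line_tuple p1)) (M2 f n.+2)).
Implicit Types p : 'rV[F]_2.

Let b11 : br p1 p1 = 0.
Proof. by rewrite /br [p1 0 0 * _]mulrC subrr. Qed.

Let q_neq0 i : q i != 0 := fr_pt0 fr (lift ord0 i).

Let q_distinct i j : i != j -> br (q i) (q j) != 0.
Proof. by move=> ij; apply: (fr_ptD fr); rewrite (inj_eq lift_inj). Qed.

Let q_p1 i : br (q i) p1 != 0.
Proof. by apply: (fr_ptD fr); rewrite eq_sym neq_lift. Qed.

Let dot_pt i : dot c (param f (pt i)) = 0.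
Proof. by rewrite -comb_eval (fr_root fr). Qed.

Let param_pt0 i : param f (pt i) != 0.
Proof.
apply: contraTneq (fr_g fr i) => fp0; rewrite comb_eval fp0 /dot big1 ?eqxx // => j _.
by rewrite mxE mulr0.
Qed.

Definition plane_basis : 'M[F]_3 :=
  \matrix_i param f (if i == 0 then p1 else if i == 1 then q 0 else ps).

Lemma mul_plane_basis (v : 'rV[F]_3) : v *m plane_basis =
  v 0 0 *: param f p1 + v 0 1 *: param f (q 0) + v 0 (inord 2) *: param f ps.
Proof.
apply/rowP=> j; rewrite mxE !big_ord_recl big_ord0 !mxE /= addr0 !addrA.
congr (_ + v 0 _ * _ + v 0 _ * _); rewrite ?mxE //; apply: val_inj => //=.
by rewrite inordK.
Qed.

Let dotDr (a P Q : 'rV[F]_3) : dot a (P + Q) = dot a P + dot a Q.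
Proof. by rewrite /dot -big_split; apply: eq_bigr => j _; rewrite mxE mulrDr. Qed.

(** Two distinct points of the line [c] and a point off that line. *)
Lemma plane_basis_unit : plane_basis \in unitmx.
Proof.
rewrite unitmxE unitfE; apply/det0P => -[v v0]; rewrite mul_plane_basis => E.
have v2 : v 0 (inord 2) = 0.
  have := congr1 (dot c) E; rewrite !dotDr !dotZr !dot_pt !mulr0 !add0r.
  have -> : dot c 0 = 0 by rewrite /dot big1 // => j _; rewrite mxE mulr0.
  by move/eqP; rewrite mulf_eq0 (negPf ps_c) orbF => /eqP.
have [v0' v1] : v 0 0 = 0 /\ v 0 1 = 0.
  apply: (nonparallel_indep (param_pt0 _) (param_pt0 _) (fr_par fr (neq_lift _ _))).
  by move: E; rewrite v2 scale0r addr0; apply.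
case/eqP: v0; apply/rowP => j; rewrite mxE.
case: j => [[|[|[|j]]] hj] //.
- by rewrite -[RHS]v0'; congr (v 0 _); apply: val_inj.
- by rewrite -[RHS]v1; congr (v 0 _); apply: val_inj.
- by rewrite -[RHS]v2; congr (v 0 _); apply: val_inj; rewrite /= inordK.
Qed.

(** The image of [q i] is on the line [c] spanned by those of [p1] and [q 0], and it differs from
    that of [p1], so its second coordinate is nonzero. *)
Lemma plane_coordinates i : exists ab : F * F, ab.2 != 0 /\
  param f (q i) = ab.1 *: param f p1 + ab.2 *: param f (q 0).
Proof.
pose v := param f (q i) *m invmx plane_basis.
have E : v *m plane_basis = param f (q i) by rewrite mulmxKV // plane_basis_unit.
have v2 : v 0 (inord 2) = 0.
  have := congr1 (dot c) E; rewrite mul_plane_basis !dotDr !dotZr !dot_pt !mulr0 !add0r.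
  by move/eqP; rewrite mulf_eq0 (negPf ps_c) orbF => /eqP.
move: E; rewrite mul_plane_basis v2 scale0r addr0 => E.
exists (v 0 0, v 0 1); split=> //=; apply: contraTneq isT => v1.
move: E; rewrite v1 scale0r addr0 => E.
have /negP[] := fr_par fr (neq_lift ord0 i); rewrite par_sym -E.
apply/eqmx_rVP; exists (v 0 0) => //; apply: contraTneq isT => v0.
by have /negP[] := param_pt0 (lift ord0 i); rewrite -E v0 scale0r.
Qed.

Variables al be : 'I_n.+1 -> F.
Hypothesis be0 : forall i, be i != 0.
Hypothesis q_coord : forall i, param f (q i) = al i *: param f p1 + be i *: param f (q 0).

Lemma ev_Mb p : cst (ev n.+2 p) *m Mb =
  join_mx ((br p p1 *: lin p) *: cst (ev n p)) (cst (param f p)).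
Proof.
have cstE m (v : 'rV[F]_m) : map_mx (comp_mpoly (line_tuple p1)) (map_mx (@mpolyC 3 F) v) = cst v.
  by apply/rowP=> j; rewrite !mxE comp_mpolyC.
rewrite -cstE -map_mxM (ev_M2 f_homog) map_join_mx cstE map_mxZ cstE.
by rewrite /= sigma_quad.
Qed.

Lemma cst_unit m (A : 'M[F]_m) k (x : 'M[B]_(m, k)) : A \in unitmx -> cst A *m x = 0 -> x = 0.
Proof.
by move=> uA Ax; rewrite -[x]mul1mx -(map_mxC_unit _ uA) -mulmxA Ax mulmx0.
Qed.

Definition tangent_weight i := be i / br (q i) p1.

(** A vanishing border gives a nonzero column killed by [Mb]. Pairing its two blocks with the
    evaluation at p gives br p p1 * lin p * Y p + G p = 0. So G vanishes at [p1], collinearity gives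
    G (q i) = be i b, and lin (q i) Y (q i) = - w_i b with w_i the [tangent_weight]. It remains to
    multiply sum a i Y (q i) = 0 by all [lin (q j)] and to cancel b. *)
Lemma bordered_relation (a : 'I_n.+1 -> B) :
  bordered Mb (join_mx (\sum_i a i *: cst (ev n (q i))) 0) = 0 ->
  \sum_i a i * (tangent_weight i)%:MP * \prod_(j | j != i) lin (q j) = 0.
Proof.
move=> /bordered_eq0[x [x0 ax Mx]].
have [X [E xE]] := join_mxK x^T.
move: (congr1 trmx xE); rewrite trmxK => {}xE; rewrite xE in x0 ax Mx.
pose Y p := (cst (ev n p) *m X^T) 0 0; pose G p := (cst (param f p) *m E^T) 0 0.
have row p : br p p1 *: lin p * Y p + G p = 0.
  have := congr1 (fun A => (cst (ev n.+2 p) *m A) 0 0) Mx.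
  rewrite mulmx0 mulmxA ev_Mb join_mx_dot -scalemxAl => E0.
  by rewrite mxE [X in X + _]mxE [RHS]mxE in E0.
have G1 : G p1 = 0.
  by have := row p1; rewrite b11 scale0r mul0r add0r.
set b := G (q 0).
have Gq i : G (q i) = (be i)%:MP * b.
  have -> : G (q i) = (al i)%:MP * G p1 + (be i)%:MP * b.
    rewrite /G q_coord map_mxD !map_mxZ mulmxDl -!scalemxAl.
    by rewrite mxE [X in X + _]mxE [X in _ + X]mxE.
  by rewrite G1 mulr0 add0r.
have Yq i : lin (q i) * Y (q i) = - ((tangent_weight i)%:MP * b).
  have := row (q i); rewrite Gq => /eqP; rewrite addr_eq0 => /eqP E0.
  apply: (mulfI (x := (br (q i) p1)%:MP)); first by rewrite mpolyC_eq0.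
  have -> : (br (q i) p1)%:MP * (lin (q i) * Y (q i)) = br (q i) p1 *: lin (q i) * Y (q i).
    by rewrite mulrA mul_mpolyC.
  by rewrite E0 mulrN mulrA -mpolyCM /tangent_weight [br _ _ * _]mulrC divfK.
(* Otherwise Y vanishes at n+1 points, which kills the block [X]; then G vanishes everywhere, which
   kills [E]. *)
have b0 : b != 0.
  apply: contraNneq x0 => b0.
  have Y0 i : Y (q i) = 0.
    by apply: (mulfI (lin_neq0 (q_neq0 i))); rewrite Yq b0 !mulr0 oppr0.
  have X0 : X^T = 0.
    apply: (cst_unit (ev_unit q_neq0 q_distinct)); apply/colP => i; rewrite !mxE.
    by rewrite -[RHS](Y0 i) /Y mxE; apply: eq_bigr => k _; rewrite !mxE.
  have row0 p : G p = 0 by have := row p; rewrite /Y X0 mulmx0 mxE mulr0 add0r.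
  have E0 : E^T = 0.
    apply: (cst_unit plane_basis_unit); apply/colP => i; rewrite !mxE.
    rewrite -[RHS](row0 (if i == 0 then p1 else if i == 1 then q 0 else ps)) /G mxE.
    by apply: eq_bigr => k _; rewrite !mxE.
  by apply/eqP/trmx_inj; rewrite trmxK -[X]trmxK -[E]trmxK X0 E0 !trmx0 join_mx0.
have S0 : \sum_i a i * Y (q i) = 0.
  have := congr1 (fun A : 'M_1 => A 0 0) ax.
  rewrite join_mx_dot mul0mx addr0 mulmx_suml summxE !mxE => S0.
  by rewrite -[RHS]S0; apply: eq_bigr => i _; rewrite -scalemxAl [RHS]mxE.
apply: (mulIf b0); rewrite mul0r.
transitivity (- ((\sum_i a i * Y (q i)) * \prod_j lin (q j))); last first.
  by rewrite S0 mul0r oppr0.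
rewrite !mulr_suml -sumrN; apply: eq_bigr => i _; rewrite [\prod_j _](bigD1 i) //=.
have := Yq i; move: (lin _) (Y _) (\prod_(j | _) _) (tangent_weight i)%:MP => u v w t E0.
have -> : - (a i * v * (u * w)) = - (a i * w) * (u * v) by ring.
by rewrite E0; ring.
Qed.

Lemma bordered_root (a : 'I_n.+1 -> B) i :
  bordered Mb (join_mx (\sum_i a i *: cst (ev n (q i))) 0) = 0 -> (a i).@[q i 0] = 0.
Proof.
move=> /bordered_relation/(congr1 (meval (q i 0))); rewrite meval0 meval_sum.
rewrite (bigD1 i) //= [X in _ + X]big1 => [|j ji]; last first.
  by rewrite mevalM (bigD1 i) 1?eq_sym // !mevalM lin_root mul0r mulr0.
have P0 : (\prod_(j | j != i) lin (q j)).@[q i 0] != 0.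
  by rewrite rmorph_prod; apply/prodf_neq0 => j ji; move: (q_distinct ji); rewrite -lin_eval.
have w0 : tangent_weight i != 0 by rewrite mulf_neq0 ?invr_eq0 ?q_p1.
rewrite addr0 !mevalM mevalC => /eqP; rewrite mulf_eq0 (negPf P0) orbF mulf_eq0 (negPf w0) orbF.
by move/eqP.
Qed.

(** Each [a i] is [lin (q i) * z i], and the relation becomes sum z i w_i = 0. The evaluation rows
    at the [q i] with coefficients z i / br (q i) p1 reproduce the first block. The row at [p1] is
    zero in that block and removes the multiples of [param f p1] from the second; those of
    [param f (q 0)] cancel by the relation. *)
Lemma bordered_exact e (a : 'I_n.+1 -> B) : (forall i, a i \is e.-homog) ->
  bordered Mb (join_mx (\sum_i a i *: cst (ev n (q i))) 0) = 0 ->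
  exists y, join_mx (\sum_i a i *: cst (ev n (q i))) 0 = y *m Mb.
Proof.
move=> ha H0; have aq i := bordered_root i H0.
case: e ha => [|e] ha.
  exists 0; rewrite mul0mx big1 ?join_mx0 // => i _.
  by rewrite (const_form_eq0 (ha i) (aq i)) scale0r.
have /choice[z Hz] i : exists z, a i = lin (q i) * z.
  by have [z _ ->] := form_root (q_neq0 i) (ha i) (aq i); exists z.
have z0 : \sum_i z i * (tangent_weight i)%:MP = 0.
  have L0 : \prod_j lin (q j) != 0 by apply/prodf_neq0 => j _; apply: lin_neq0.
  apply: (mulIf L0); rewrite mul0r -[RHS](bordered_relation H0) mulr_suml.
  apply: eq_bigr => i _; rewrite (bigD1 i) //= Hz.
  by move: (lin _) (z i) (\prod_(j | _) _) (tangent_weight i)%:MP => u v w t; ring.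
pose h i := (br (q i) p1)^-1 *: z i.
exists (\sum_i h i *: cst (ev n.+2 (q i)) - (\sum_i h i * (al i)%:MP) *: cst (ev n.+2 p1)).
rewrite mulmxBl mulmx_suml -scalemxAl ev_Mb.
rewrite b11 scale0r scale0r join_mxZ scaler0 join_mxN oppr0.
transitivity (\sum_i join_mx (a i *: cst (ev n (q i))) (h i *: cst (param f (q i))) +
    join_mx 0 (- ((\sum_i h i * (al i)%:MP) *: cst (param f p1)))); last first.
  congr (_ + _); apply: eq_bigr => i _; rewrite -scalemxAl ev_Mb join_mxZ scalerA.
  congr (join_mx (_ *: _) _); rewrite Hz /h.
  by rewrite -scalerAl -scalerAr scalerA mulVf // scale1r mulrC.
rewrite join_mx_sum join_mxD addr0; congr (join_mx _ _).
rewrite scaler_suml -sumrB; symmetry.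
transitivity ((\sum_i z i * (tangent_weight i)%:MP) *: cst (param f (q 0))).
  rewrite scaler_suml; apply: eq_bigr => i _.
  rewrite q_coord map_mxD !map_mxZ scalerDr !scalerA addrC addKr; congr (_ *: _).
  by rewrite /h /tangent_weight -mul_mpolyC [_ * z i]mulrC -mulrA -mpolyCM [_ * be i]mulrC.
by rewrite z0 scale0r.
Qed.
End Exactness.

(** * Homogeneous components and degrees of the minors *)

Section GradedIdeals.
Variables (n : nat) (R : comNzRingType).
Implicit Types a D g : {mpoly R[n]}.

Lemma pihomog_mul m e a D : D \is e.-homog ->
  pihomog mdeg m (a * D) = if (e <= m)%N then pihomog mdeg (m - e) a * D else 0.
Proof.
move=> hD; elim/mpolyind: a => [|t k a _ _ IH].
  by rewrite mul0r !linear0 mul0r if_same.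
have hk : 'X_[k] * D \is (mdeg k + e).-homog by rewrite dhomogM ?dhomogX.
rewrite mulrDl -scalerAl !linearD !linearZ /= IH mulrDl -scalerAl pihomogX.
have [em|me] := leqP e m; last first.
  rewrite (pihomog_ne0 _ hk) ?scaler0 ?addr0 //.
  by apply: contraTneq me => <-; rewrite -leqNgt leq_addl.
have [km|km] := eqVneq (mdeg k) (m - e)%N.
  by rewrite pihomog_dE // -(subnK em) -km.
rewrite (pihomog_ne0 _ hk) ?mul0r ?scaler0 //.
by apply: contraNneq km => <-; rewrite addnK.
Qed.

Lemma homog_combination m e k (a D : 'I_k -> {mpoly R[n]}) g : g \is m.-homog ->
  (forall i, D i \is e.-homog) -> g = \sum_i a i * D i ->
  if (e <= m)%N then exists2 b, (forall i, b i \is (m - e).-homog) & g = \sum_i b i * D i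
  else g = 0.
Proof.
move=> hg hD gE.
have : g = \sum_i pihomog mdeg m (a i * D i).
  by rewrite -{1}(pihomog_dE hg) gE linear_sum.
under eq_bigr do rewrite (pihomog_mul _ _ (hD _)).
case: leqP => [em gE'|_]; last by rewrite big1.
by exists (fun i => pihomog mdeg (m - e) (a i)) => // i; apply: pihomogP.
Qed.

Lemma det_homog k (w : 'I_k -> nat) (A : 'M[{mpoly R[n]}]_k) :
  (forall i j, A i j \is (w j).-homog) -> \det A \is (\sum_j w j).-homog.
Proof.
move=> hA; rewrite -det_tr; apply: rpred_sum => s _.
have hP : \prod_i A^T i (s i) \is (\sum_j w j).-homog.
  by apply: homog_prod_var => i _; rewrite mxE.
by rewrite mulr_sign; case: ifP => _; rewrite ?rpredN.
Qed.

End GradedIdeals.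

Lemma hilbert_value_free (F : fieldType) n (I : {mpoly F[n.+1]} -> Prop) m : I 0 ->
  (forall g, g \is m.-homog -> I g -> g = 0) -> hilbert_value I m 'C(m + n, m).
Proof.
move=> I0 H; have [v2r vL [r2v vK rK]] := dhomog_vecaxiom n F m.
pose L := HB.pack_for {linear dhomog n.+1 F m -> 'rV[F]_'C(m + n, m)} v2r
  (GRing.isLinear.Build _ _ _ _ v2r vL).
pose b i := r2v (delta_mx 0 i).
have comb (c : 'rV[F]_'C(m + n, m)) : v2r (\sum_i c 0 i *: b i) = c.
  rewrite [LHS](linear_sum L) [RHS]row_sum_delta; apply: eq_bigr => i _.
  by rewrite [LHS](linearZ_LR L) /= /b rK.
have val_sum c : (\sum_i c 0 i *: b i : dhomog n.+1 F m) = \sum_i c 0 i *: (b i : {mpoly F[n.+1]}) :> {mpoly F[n.+1]}.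
  by rewrite linear_sum; apply: eq_bigr => i _; rewrite linearZ.
exists (fun i => b i : {mpoly F[n.+1]}); split=> [i|x hx]; first exact: dhomog_is_dhomog.
exists (v2r (DHomog hx)); split=> [|c Ic].
  rewrite -val_sum.
  suff -> : \sum_i (v2r (DHomog hx)) 0 i *: b i = DHomog hx by rewrite /= subrr.
  by apply: (can_inj vK); rewrite comb.
suff -> : DHomog hx = \sum_i c 0 i *: b i by rewrite comb.
apply: val_inj; rewrite /= val_sum; apply/eqP; rewrite -subr_eq0; apply/eqP/H => //.
by rewrite -val_sum rpredB // dhomog_is_dhomog.
Qed.

Section MinorIdeal.
Variables (F : numClosedFieldType) (n : nat) (f : 3.-tuple {mpoly F[2]}).
Local Notation M := (M2 f n.+2).
Local Notation I := (X2 f n.+2).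
Local Notation cst := (map_mx (@mpolyC 3 F)).

Lemma X2_bordered g : I g <-> exists c, g = bordered M c.
Proof.
split=> [[c ->]|[c ->]].
  exists (\row_j ((-1) ^+ j * c j)); rewrite bordered_minors; apply: eq_bigr => j _.
  by rewrite mxE mulrACA -expr2 sqrr_sign mul1r.
exists (fun j => c 0 j * (-1) ^+ j); rewrite bordered_minors.
by apply: eq_bigr => j _; rewrite mulrA.
Qed.

Lemma subspace_X2 : subspace (@homscale F 3) I.
Proof.
split=> [|a x y /X2_bordered[c ->] /X2_bordered[c' ->]]; apply/X2_bordered.
  by exists 0; rewrite -(mul0mx _ M) bordered_mul.
exists (a%:MP *: c - (- 1) *: c').
by rewrite borderedB !borderedZ mulN1r opprK mul_mpolyC.
Qed.

Lemma X2_mul a g : I g -> I (a * g).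
Proof. by move=> /X2_bordered[c ->]; apply/X2_bordered; exists (a *: c); rewrite borderedZ. Qed.

Lemma M2_homog i j : M i j \is (j < n.+1)%N.-homog.
Proof.
rewrite mxE /M2_form; case: ifP => _; last first.
  by rewrite mcoeff_map_mpoly; apply: homogC.
have [x [y [z Exyz]]] := shifted_quadratic_coef ('X_0 : {mpoly F[3]}) 'X_1 'X_(inord 2)
  (n.+2 - 2 - j) j (binom_exp n.+2 i).
have -> : ('X_0 ^+ (n.+2 - 2 - j) * 'X_1 ^+ j * P2 F)@_(binom_exp n.+2 i) =
  'X_0 * x%:R + 'X_1 * y%:R + 'X_(inord 2) * z%:R := Exyz.
have hX k (t : bool) : ('X_k : {mpoly F[3]}) * t%:R \is 1.-homog.
  by rewrite mulr_natr; apply: rpredMn; apply: homogX.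
by apply: rpredD; first apply: rpredD; apply: hX.
Qed.

(** The n+1 multiples of P_2 give columns linear in u and the last three are constant. This border
    only picks minors that omit a linear column, which leaves degree n. *)
Lemma bordered_homog (v : 'rV[F]_n.+1) : bordered M (join_mx (cst v) 0) \is n.-homog.
Proof.
rewrite bordered_minors; apply: rpred_sum => j _; rewrite castmxE mxE.
case: splitP => k /= jk; last by rewrite mxE mul0r rpred0.
have jn : (j < n.+1)%N by rewrite jk.
have hdet : \det (col' j M) \is (\sum_(k < n.+3) (lift j k < n.+1)%N)%N.-homog.
  by apply: det_homog => a b; rewrite mxE; apply: M2_homog.
have Ew : (\sum_(k < n.+3) (lift j k < n.+1)%N)%N = n.
  apply: (@addnI (j < n.+1)%N); rewrite {2}jn add1n.
  transitivity (\sum_(k < n.+4) (k < n.+1)%N)%N; first by rewrite (bigD1_ord j) //= jn.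
  rewrite 3!big_ord_recr /= ltnn !ltnNge !leqW //= !addn0.
  by rewrite (eq_bigr (fun=> 1%N)) ?sum1_card ?card_ord // => i _; rewrite ltn_ord.
rewrite Ew in hdet; rewrite mxE mul_mpolyC; apply: rpredZ.
by rewrite -signr_odd mulr_sign; case: ifP => _; rewrite ?rpredN.
Qed.
End MinorIdeal.

(** * Hilbert function of the ideal of minors *)

Section MinorHilbert.
Variables (F : numClosedFieldType) (n : nat) (f : 3.-tuple {mpoly F[2]}).
Hypothesis f_homog : forall j, tnth f j \is n.+2.-homog.
Variables (c cg ch : 'rV[F]_3) (pt : 'I_n.+2 -> 'rV[F]_2) (ps : 'rV[F]_2).
Hypothesis fr : is_frame f c cg ch pt.
Hypothesis ps_c : dot c (param f ps) != 0.
Local Notation p1 := (pt ord0).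
Hypothesis p1_x : p1 0 0 != 0.
Local Notation q i := (pt (lift ord0 i)).
Local Notation M := (M2 f n.+2).
Local Notation I := (X2 f n.+2).
Local Notation cst := (map_mx (@mpolyC 3 F)).
Local Notation l := (quad p1).
Local Notation sigma a := (a \mPo line_tuple p1).
Local Notation rho b := (b \mPo section_tuple p1).
Implicit Types (a : 'I_n.+1 -> {mpoly F[3]}).

Let q_neq0 i : q i != 0 := fr_pt0 fr (lift ord0 i).

Let q_distinct i j : i != j -> br (q i) (q j) != 0.
Proof. by move=> ij; apply: (fr_ptD fr); rewrite (inj_eq lift_inj). Qed.

Definition minor_at i := bordered M (join_mx (cst (ev n (q i))) 0).

Lemma minor_at_sum a :
  \sum_i a i * minor_at i = bordered M (join_mx (\sum_i a i *: cst (ev n (q i))) 0).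
Proof.
rewrite -bordered_sum; congr bordered; under eq_bigr do rewrite join_mxZ scaler0.
by rewrite join_mx_sum big1_eq.
Qed.

(* Subtracting multiples of the evaluation rows at three points with independent
   images makes the coefficients facing the constant columns vanish. *)
Lemma X2_minor_at g : I g <-> exists a, g = \sum_i a i * minor_at i.
Proof.
split=> [/X2_bordered[r ->]|[a ->]]; last first.
  by rewrite minor_at_sum; apply/X2_bordered; eexists.
have [A [B ->]] := join_mxK r.
pose E : 'M[F]_(3, n.+3) := \matrix_i ev n.+2 (if i == 0 then p1 else if i == 1 then q 0 else ps).
pose y := B *m cst (invmx (plane_basis f pt ps)) *m cst E.
have [S ES] : exists S, y *m M = join_mx S B.
  have [S [T ST]] := join_mxK (cst E *m M).
  have T0 : T = cst (plane_basis f pt ps).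
    apply/row_matrixP => i; rewrite -map_row rowK.
    set p := (if i == 0 then _ else _).
    have : row i (cst E *m M) = join_mx (row i S) (row i T).
      rewrite ST; apply/rowP => j; rewrite mxE !castmxE /= !mxE.
      by case: splitP => k _; rewrite !mxE; congr (_ _ _); apply: val_inj.
    rewrite row_mul -map_row rowK (ev_M2 f_homog) => /join_mx_inj[_ <-] //.
  exists (B *m cst (invmx (plane_basis f pt ps)) *m S).
  rewrite /y -mulmxA ST mul_join_mx T0 -[in X in join_mx _ X]mulmxA.
  by rewrite map_mxC_unit ?mulmx1 // (plane_basis_unit fr ps_c).
pose W : 'M[F]_n.+1 := \matrix_i ev n (q i).
have uW : W \in unitmx := ev_unit q_neq0 q_distinct.
pose z := (A - S) *m cst (invmx W).
exists (fun i => z 0 i); rewrite minor_at_sum.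
have -> : \sum_i z 0 i *: cst (ev n (q i)) = A - S.
  rewrite -[A - S]mulmx1 -(map_mxC_unit 3 uW) mulmxA mulmx_sum_row.
  by apply: eq_bigr => i _; rewrite -map_row rowK.
rewrite -[bordered M (join_mx A B)]subr0 -(bordered_mul M y) -borderedB ES.
by rewrite join_mxN join_mxD subrr.
Qed.

Lemma minor_at_homog i : minor_at i \is n.-homog.
Proof. exact: bordered_homog. Qed.

Lemma X2_low_degree m g : (m < n)%N -> g \is m.-homog -> I g -> g = 0.
Proof.
move=> mn hg /X2_minor_at[a gE].
by have := homog_combination hg minor_at_homog gE; rewrite leqNgt mn.
Qed.

Variables al be : 'I_n.+1 -> F.
Hypothesis be0 : forall i, be i != 0.
Hypothesis q_coord : forall i, param f (q i) = al i *: param f p1 + be i *: param f (q 0).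

Let l_homog : l \is 1.-homog := quad_homog p1.

Let sigma_l : sigma l = 0.
Proof. by rewrite sigma_quad /br [p1 0 0 * _]mulrC subrr scale0r. Qed.

Let l_neq0 : l != 0.
Proof.
apply/eqP => /(congr1 (meval (fun i => (i == 0)%:R))).
rewrite /quad meval0 !mevalD !mevalZ !mevalXU -!val_eqE /= inordK // !mulr0 !addr0 mulr1.
by move/eqP; rewrite expf_eq0 (negPf p1_x).
Qed.

Let rho_sigma i : tnth [tuple rho (sigma 'X_j) | j < 3] i =
  'X_i + (if i == 0 then - (p1 0 0 ^- 2) else 0) *: l.
Proof. by rewrite tnth_mktuple sigmaK. Qed.

Let rho_sigmaE g : rho (sigma g) = g \mPo [tuple rho (sigma 'X_j) | j < 3].
Proof.
have -> : [tuple rho (sigma 'X_j) | j < 3] = [tuple rho (tnth (line_tuple p1) j) | j < 3].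
  by apply: eq_from_tnth => i; rewrite !tnth_mktuple comp_mpolyXi.
exact: comp_mpolyA.
Qed.

Lemma sigma_ker g : sigma g = 0 -> exists b, g = l * b.
Proof.
move=> g0; have [b] := comp_mpoly_congr_all l_homog rho_sigma g.
rewrite -rho_sigmaE g0 comp_mpoly0 => /esym/eqP; rewrite addr_eq0 => /eqP->.
by exists (- b); rewrite mulrN.
Qed.

Lemma sigma_homog_ker e g : g \is e.-homog -> sigma g = 0 ->
  exists2 b, b \is e.-1.-homog & g = l * b.
Proof.
move=> hg g0; have [b gb hb] := comp_mpoly_congr l_homog rho_sigma hg.
exists (- b); first by rewrite rpredN.
by move: gb; rewrite -rho_sigmaE g0 comp_mpoly0 => /esym/eqP; rewrite addr_eq0 mulrN => /eqP.
Qed.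

Let sigma_cst m (v : 'rV[F]_m) : map_mx (comp_mpoly (line_tuple p1)) (cst v) = map_mx (@mpolyC 2 F) v.
Proof. by apply/rowP=> j; rewrite !mxE comp_mpolyC. Qed.

Lemma sigma_minor_at_sum a : sigma (\sum_i a i * minor_at i) =
  bordered (map_mx (comp_mpoly (line_tuple p1)) M)
    (join_mx (\sum_i sigma (a i) *: map_mx (@mpolyC 2 F) (ev n (q i))) 0).
Proof.
rewrite minor_at_sum; apply: etrans; first exact: map_bordered.
congr bordered; rewrite map_join_mx map_mx0; congr join_mx.
by rewrite map_mx_combination; apply: eq_bigr => i _; rewrite sigma_cst.
Qed.

(** Write [l * g] by the minors [minor_at i]. On the line this is a relation, which by
    [bordered_exact] comes from a combination [y] of rows; subtracting the lift of [y] through [rho]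
    does not change the determinant and makes the border divisible by [l]. *)
Lemma X2_saturated m g : g \is m.-homog -> I (l * g) -> I g.
Proof.
move=> hg /X2_minor_at[a lgE].
have hlg : l * g \is m.+1.-homog by exact: dhomogM l_homog hg.
have := homog_combination hlg minor_at_homog lgE; case: leqP => [nm|_]; last first.
  move/eqP; rewrite mulf_eq0 (negPf l_neq0) => /eqP->.
  by apply/X2_bordered; exists 0; rewrite -(mul0mx _ M) bordered_mul.
case=> {lgE}a ha lgE.
have hs i : sigma (a i) \is (m.+1 - n).-homog by apply: sigma_homog.
have s0 : sigma (\sum_i a i * minor_at i) = 0.
  by rewrite -lgE comp_mpolyM sigma_l mul0r.
rewrite sigma_minor_at_sum in s0.
have [y yE] := bordered_exact f_homog fr ps_c be0 q_coord hs s0.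
pose y' := map_mx (comp_mpoly (section_tuple p1)) y.
pose r := join_mx (\sum_i a i *: cst (ev n (q i))) 0 - y' *m M.
have sy' : map_mx (comp_mpoly (line_tuple p1)) y' = y.
  by apply/rowP => j; rewrite !mxE rhoK.
have /choice[r' Hr'] j : exists b, r 0 j = l * b.
  apply: sigma_ker.
  have : map_mx (comp_mpoly (line_tuple p1)) r = 0.
    rewrite map_mxB map_mxM sy' -yE map_join_mx map_mx0 map_mx_combination.
    by rewrite (eq_bigr _ (fun i _ => congr1 _ (sigma_cst (ev n (q i))))) subrr.
  by move=> /rowP/(_ j); rewrite !mxE.
apply/X2_bordered; exists (\row_j r' j); apply: (mulfI l_neq0).
rewrite -borderedZ lgE minor_at_sum -[LHS]subr0 -(bordered_mul M y') -borderedB.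
by congr bordered; apply/rowP => j; rewrite -/r Hr' !mxE.
Qed.

(** By [bordered_root] the constant [v i] vanishes at [q i]. *)
Lemma sigma_minor_at_indep (v : 'I_n.+1 -> F) :
  sigma (\sum_i v i *: minor_at i) = 0 -> forall i, v i = 0.
Proof.
move=> s0 i.
have E : \sum_i v i *: minor_at i = \sum_i (v i)%:MP * minor_at i.
  by apply: eq_bigr => j _; rewrite mul_mpolyC.
move: s0; rewrite E sigma_minor_at_sum => /(bordered_root f_homog fr ps_c be0 q_coord i).
by rewrite comp_mpolyC mevalC.
Qed.

(** In degree n the n+1 minors restrict to independent, hence spanning, binary forms on the line,
    and a form with zero restriction is a multiple of [l]. Higher degrees follow by multiplying with
    variables. *)
Lemma X2_span k g : (0 < n)%N -> g \is (n + k).-homog ->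
  exists2 h, I h & exists2 b, b \is (n + k).-1.-homog & g = h + l * b.
Proof.
move=> n0; elim: k g => [|k IH] g hg.
  rewrite addn0 in hg *.
  (* A binary form of degree n is determined by its values at the n+1 points [q i]. *)
  pose G : 'M[F]_n.+1 := \matrix_(j, i) (sigma (minor_at j)).@[q i 0].
  have GE (v : 'rV[F]_n.+1) i : (v *m G) 0 i = (sigma (\sum_j v 0 j *: minor_at j)).@[q i 0].
    have -> : sigma (\sum_j v 0 j *: minor_at j) = \sum_j v 0 j *: sigma (minor_at j).
      by rewrite comp_mpoly_combination.
    by rewrite mxE meval_sum; apply: eq_bigr => j _; rewrite mevalZ mxE.
  have hsum (v : 'rV[F]_n.+1) : \sum_j v 0 j *: minor_at j \is n.-homog.
    by apply: rpred_sum => j _; apply: rpredZ; apply: minor_at_homog.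
  have van h : h \is n.-homog -> (forall i, h.@[q i 0] = 0) -> h = 0.
    move=> hh h0; apply: (form_eq0 q_neq0 q_distinct (P := predT) _ hh) => //.
    by rewrite card_ord.
  have uG : G \in unitmx.
    rewrite unitmxE unitfE; apply/det0P => -[v v0 vG]; case/eqP: v0.
    apply/rowP => i; rewrite mxE.
    apply: (sigma_minor_at_indep (v := fun i => v 0 i)).
    by apply: van => [|j]; [exact/sigma_homog/hsum | rewrite -GE vG mxE].
  pose v := (\row_i (sigma g).@[q i 0]) *m invmx G.
  exists (\sum_j v 0 j *: minor_at j).
    by apply/X2_minor_at; exists (fun j => (v 0 j)%:MP); apply: eq_bigr => j _; rewrite mul_mpolyC.
  have hgs : g - \sum_j v 0 j *: minor_at j \is n.-homog := rpredB hg (hsum v).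
  have [|b hb gb] := sigma_homog_ker hgs.
    apply: van => [|i]; first exact: sigma_homog.
    by rewrite comp_mpolyB mevalB -GE mulmxKV // mxE subrr.
  by exists b => //; rewrite -gb addrC subrK.
rewrite addnS in hg *.
have [B [hB ->]] := homog_decomp hg.
have /choice[h Hh] i : exists h, I h /\ exists2 b, b \is (n + k).-1.-homog & B i = h + l * b.
  by have [h Ih Hb] := IH _ (hB i); exists h.
have /choice[b Hb] i : exists b, b \is (n + k).-1.-homog /\ B i = h i + l * b.
  by have [_ [b hb E]] := Hh i; exists b.
exists (\sum_i 'X_i * h i).
  have Ii i : I ('X_i * h i) by apply: X2_mul; exact: (Hh i).1.
  have H := sub_sum (homscale_action F 3) (subspace_X2 n f). apply: H => i _; exact: Ii.
exists (\sum_i 'X_i * b i).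
  apply: rpred_sum => i _ /=; have := dhomogM (homogX F i) (Hb i).1.
  by rewrite add1n prednK // addn_gt0 n0.
rewrite mulr_sumr -big_split; apply: eq_bigr => i _ /=.
by rewrite (Hb i).2 mulrDr mulrCA.
Qed.

Lemma hilbert_value_X2 k : (0 < n)%N -> hilbert_value I (n.-1 + k) 'C(n.+1, 2).
Proof.
move=> n0; elim: k => [|k IH].
  (* The number of ternary monomials of degree n-1, a degree in which the ideal is still zero. *)
  have -> : 'C(n.+1, 2) = 'C(n.-1 + 2, n.-1).
    by rewrite addn2 prednK // -bin_sub ?subSS; last lia; congr 'C(_, _); lia.
  rewrite addn0; apply: hilbert_value_free => [|g hg]; first exact: (subspace_X2 n f).1.
  by apply: X2_low_degree hg; rewrite prednK.
have nk : (n.-1 + k.+1 = n + k)%N by lia.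
have nk1 : (n.-1 + k = (n + k).-1)%N by lia.
rewrite nk -['C(_, _)]addn0; rewrite nk1 in IH.
apply: (qdim_step (homscale_action F 3) (homscale_action F 3)
  (phi := fun g => l * g) (w := fun=> 0)) IH.
- by move=> a x y; rewrite /homscale mulrDr scalerAr.
- exact: subspace_homog.
- exact: subspace_X2.
- exact: subspace_homog.
- exact: subspace_X2.
- move=> x hx; have := dhomogM l_homog hx.
  by rewrite add1n prednK // addn_gt0 n0.
- by move=> x; apply: X2_mul.
- by move=> i; apply: rpred0.
- move=> y hy; have [h Ih [b hb yE]] := X2_span n0 hy.
  exists b, 0; split=> //; rewrite (lcomb0 (homscale_action F 3)) subr0 yE addrK.
  exact: Ih.
- move=> x v hx; rewrite /lcomb big_ord0 addr0 => Ix; split; first exact: thinmx0.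
  exact: X2_saturated hx Ix.
Qed.

End MinorHilbert.

(** * Degree and support of X_2 *)

Lemma sum_ord_2add (V : zmodType) m (G : 'I_(2 + m) -> V) :
  \sum_i G i = G (lshift m 0) + G (lshift m 1) + \sum_k G (rshift 2 k).
Proof.
rewrite big_split_ord big_ord_recl big_ord1; congr (_ + G _ + _).
by apply: val_inj.
Qed.

Lemma fr_avoid (F : numClosedFieldType) (d : nat) (f : 3.-tuple {mpoly F[2]}) c cg ch
    (pt : 'I_d -> 'rV[F]_2) (p : 'rV[F]_2) i :
  (forall j, tnth f j \is d.-homog) -> is_frame f c cg ch pt -> p != 0 ->
  dot c (param f p) != 0 -> br (pt i) p != 0.
Proof.
move=> hf fr p0; apply: contraNneq => /eqP; rewrite (br_eq0 (fr_pt0 fr i) p0) par_sym => pp.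
by rewrite -comb_eval (form_par (comb_homog hf c) pp (fr_root fr i)).
Qed.

Section MinorDegree.
Variables (F : numClosedFieldType) (n : nat) (f : 3.-tuple {mpoly F[2]}).
Hypothesis f_homog : forall j, tnth f j \is n.+2.-homog.
Hypothesis f_gcd : gcd_is_one f.
Hypothesis f_gen : generically_one_to_one f.
Local Notation M := (M2 f n.+2).
Local Notation I := (X2 f n.+2).
Implicit Types p q : 'rV[F]_2.

Let param0 p : p != 0 -> param f p != 0.
Proof. exact: (param_neq0 f_homog). Qed.

Lemma X2_degree : (0 < n)%N -> scheme_degree I 'C(n.+1, 2).
Proof.
(* Keeping the image of (0 : 1) off the line supplies the point [ps] and also forces the first
   coordinate of [pt ord0] to be nonzero, as [section_tuple] requires. *)
move=> n0; pose e : 'rV[F]_2 := delta_mx 0 1.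
have e0 : e != 0.
  by apply/eqP => /rowP/(_ 1); rewrite !mxE !eqxx => /eqP; rewrite oner_eq0.
have [|c [cg [ch [pt [fr Hc]]]]] := @frame_exists F n.+2 f [:: param f e] isT f_homog f_gcd f_gen.
  by move=> P; rewrite inE => /eqP->; apply: param0.
have ce : dot c (param f e) != 0 by apply: Hc; rewrite inE.
have p1x : pt ord0 0 0 != 0.
  apply: contraNneq (fr_avoid ord0 f_homog fr e0 ce) => p1x.
  by rewrite /br p1x !mxE mulr0 mul0r subrr.
have /choice[ab Hab] := plane_coordinates fr ce.
(* A constant Hilbert polynomial, so the factorial in the definition of the degree is 0! = 1. *)
exists ('C(n.+1, 2)%:R)%:P, n.-1; split.
  move=> m nm; exists 'C(n.+1, 2); last by rewrite hornerC.
  rewrite -(subnKC nm).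
  exact: (hilbert_value_X2 f_homog fr ce p1x (fun i => (Hab i).1) (fun i => (Hab i).2)).
rewrite lead_coefC size_polyC; case: (_ != _) => /=; by rewrite mul1r.
Qed.

Local Notation Mu u := (map_mx (meval (u 0)) M).

(** If the rows are independent, they do not span the larger space, so some unit row lies outside;
    bordering by it gives an element of the ideal that is nonzero at [u]. *)
Lemma X2_supportP (u : 'rV[F]_3) : (forall g, I g -> g.@[u 0] = 0) <->
  exists2 y : 'rV[F]_n.+3, y != 0 & y *m Mu u = 0.
Proof.
have bu c : (bordered M c).@[u 0] = bordered (Mu u) (map_mx (meval (u 0)) c).
  exact: map_bordered.
split=> [Iu|[y y0 yM] g /X2_bordered[c ->]]; last first.
  rewrite bu; apply/eqP/det0P; exists (row_mx (0 : 'M_1) y).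
    by apply: contraNneq y0 => /eqP; rewrite row_mx_eq0 eqxx.
  by rewrite mul_row_col mul0mx add0r.
apply: contrapT => Hy.
have free (y : 'rV_n.+3) : y *m Mu u = 0 -> y = 0.
  by move=> yM; apply: contrapT => /eqP y0; apply: Hy; exists y.
have : ~~ (1%:M <= Mu u)%MS.
  apply/negP => /mxrankS; rewrite mxrank1 => /leq_trans/(_ (rank_leq_row _)).
  by rewrite ltnn.
case/row_subPn => i; set c := row i _ => /negP[].
have /eqP/det0P[v v0] : bordered (Mu u) c = 0.
  have cE : map_mx (meval (u 0)) (map_mx (@mpolyC 3 F) c) = c.
    by apply/rowP => j; rewrite !mxE mevalC.
  by rewrite -cE -bu; apply: Iu; apply/X2_bordered; eexists.
rewrite -[v]hsubmxK mul_row_col.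
set a := lsubmx v; set y := rsubmx v => E.
have a0 : a 0 0 != 0.
  apply: contraNneq v0 => a0; have az : a = 0 by apply/matrixP => k j; rewrite !ord1 a0 mxE.
  move: E; rewrite az mul0mx add0r => /free y0.
  by rewrite -[v]hsubmxK -/a -/y az y0 row_mx0.
move/eqP: E; rewrite addr_eq0 [a]mx11_scalar mul_scalar_mx => /eqP E.
rewrite -[c](scalerK a0) E scalerN -scaleNr scalemxAl; exact: submxMl.
Qed.

Lemma ev_Mu (u : 'rV[F]_3) p : ev n.+2 p *m Mu u = join_mx ((quad p).@[u 0] *: ev n p) (param f p).
Proof.
have cE m (v : 'rV[F]_m) : map_mx (meval (u 0)) (map_mx (@mpolyC 3 F) v) = v.
  by apply/rowP => j; rewrite !mxE mevalC.
by rewrite -[ev n.+2 p]cE -map_mxM (ev_M2 f_homog) map_join_mx cE map_mxZ cE.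
Qed.

(** The coefficients of [lin p * lin q]. *)
Definition product_quad p q : 'rV[F]_3 :=
  \row_j (if j == 0 then p 0 1 * q 0 1 else if j == 1 then - (p 0 1 * q 0 0 + p 0 0 * q 0 1)
          else p 0 0 * q 0 0).

Definition discriminant (u : 'rV[F]_3) := u 0 1 ^+ 2 - 4%:R * u 0 0 * u 0 (inord 2).

Lemma quad_eval r (u : 'rV[F]_3) : (quad r).@[u 0] =
  r 0 0 ^+ 2 * u 0 0 + r 0 0 * r 0 1 * u 0 1 + r 0 1 ^+ 2 * u 0 (inord 2).
Proof. by rewrite /quad !mevalD !mevalZ !mevalXU. Qed.

Lemma product_quadE p q : [/\ product_quad p q 0 0 = p 0 1 * q 0 1,
  product_quad p q 0 1 = - (p 0 1 * q 0 0 + p 0 0 * q 0 1)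
  & product_quad p q 0 (inord 2) = p 0 0 * q 0 0].
Proof. by rewrite !mxE /= -!val_eqE /= inordK. Qed.

Lemma product_quad_eval k p q r :
  (quad r).@[(k *: product_quad p q) 0] = k * (br p r * br q r).
Proof.
rewrite quad_eval; have [e0 e1 e2] := product_quadE p q.
have kE j : (k *: product_quad p q) 0 j = k * product_quad p q 0 j by rewrite mxE.
by rewrite !kE e0 e1 e2 /br; ring.
Qed.

Lemma product_quad_discriminant p q : discriminant (product_quad p q) = br p q ^+ 2.
Proof.
by rewrite /discriminant; have [-> -> ->] := product_quadE p q; rewrite /br; ring.
Qed.

Lemma discriminantZ k u : discriminant (k *: u) = k ^+ 2 * discriminant u.
Proof. by rewrite /discriminant !mxE; ring. Qed.

(** If phi(p) = a phi(q), the functional ev p - a ev q kills [f] and all multiples of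
    [lin p * lin q]. It is nonzero on a form that vanishes at [q] and not at [p]. *)
Lemma double_point_in_support p q : p != 0 -> q != 0 -> br p q != 0 ->
  (param f p == param f q)%MS -> in_support I (product_quad p q).
Proof.
move=> p0 q0 pq /eqmx_rVP[a _ fE]; split.
  apply: contraNneq pq => u0; have := product_quad_discriminant p q.
  by rewrite u0 -[0](scale0r 0) discriminantZ expr0n mul0r => /esym/eqP; rewrite expf_eq0.
apply/X2_supportP; exists (ev n.+2 p - a *: ev n.+2 q).
  have [h hh hp] := form_nonroot n.+1 p0.
  have hg : lin q * h \is n.+2.-homog by exact: dhomogM (lin_homog q) hh.
  have evE (r : 'rV[F]_2) : (lin q * h).@[r 0] = \sum_k ev n.+2 r 0 k * (lin q * h)@_(binom_exp n.+2 k).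
    by rewrite (form_coef_eval _ hg); apply: eq_bigr => k _; rewrite mxE.
  apply: contraNneq hp => /eqP; rewrite subr_eq0 => /eqP E.
  have : (lin q * h).@[p 0] = a * (lin q * h).@[q 0].
    by rewrite !evE E mulr_sumr; apply: eq_bigr => k _; rewrite [X in X * _]mxE mulrA.
  rewrite !mevalM lin_root mul0r mulr0 lin_eval => /eqP.
  by rewrite mulf_eq0 brC oppr_eq0 (negPf pq).
have b0 r : br r r = 0 by rewrite /br [r 0 0 * _]mulrC subrr.
rewrite -[product_quad p q]scale1r mulmxBl -scalemxAl !ev_Mu !product_quad_eval !b0.
rewrite mul0r !mulr0 !scale0r.
by rewrite join_mxZ scaler0 join_mxN join_mxD oppr0 addr0 fE subrr join_mx0.
Qed.

(* A functional on forms of degree [n + 2] that kills the multiples of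
   [lin p * lin q] is a combination of the evaluations at [p] and [q]. *)
Lemma product_quad_double_point k p q (y : 'rV[F]_n.+3) :
  k != 0 -> p != 0 -> q != 0 -> br p q != 0 -> y != 0 -> y *m Mu (k *: product_quad p q) = 0 -> (param f p == param f q)%MS.
Proof.
move=> t0 p0 q0 pq y0 yM; rename k into t.
have [|c [cg [ch [pt [fr Hc]]]]] :=
  @frame_exists F n.+2 f [:: param f p; param f q] isT f_homog f_gcd f_gen.
  by move=> P; rewrite !inE => /orP[] /eqP->; apply: param0.
have cp : dot c (param f p) != 0 by apply: Hc; rewrite !inE eqxx.
have cq : dot c (param f q) != 0 by apply: Hc; rewrite !inE eqxx orbT.
pose r i := pt (lift ord0 i).
have r0 i : r i != 0 := fr_pt0 fr _.
have rD i j : i != j -> br (r i) (r j) != 0.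
  by move=> ij; apply: (fr_ptD fr); rewrite (inj_eq lift_inj).
have rp i : br (r i) p != 0 := fr_avoid _ f_homog fr p0 cp.
have rq i : br (r i) q != 0 := fr_avoid _ f_homog fr q0 cq.
(* Together with [p] and [q], the n+1 points [r] give n+3 nodes, so every functional on forms of
   degree n+2 is a combination of evaluations at them. *)
pose R (i : 'I_(2 + n.+1)) : 'rV[F]_2 :=
  match split i with inl k => if k == 0 then p else q | inr k => r k end.
have RD i j : i != j -> br (R i) (R j) != 0.
  have sw (a b : 'rV[F]_2) : br a b != 0 -> br b a != 0 by rewrite brC oppr_eq0.
  have sE := can_inj (@splitK 2 n.+1).
  rewrite /R; case: (split i) (sE i j) => k; case: (split j) => k' E ij; last first.
  - by apply: rD; apply: contra_neq ij => kk; apply: E; rewrite kk.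
  - by case: ifP.
  - by case: ifP => _; apply: sw.
  case: (eqVneq k 0) (eqVneq k' 0) E => [->|k0] [->|k0'] E //; try exact: sw.
    by case/eqP: ij; apply: E.
  case/eqP: ij; apply: E; congr inl; apply: val_inj.
  by case: k k' k0 k0' => [[|[|?]] ?] [[|[|?]] ?].
have R0 i : R i != 0 by rewrite /R; case: split => k //; case: ifP.
pose W : 'M[F]_n.+3 := \matrix_i ev n.+2 (R i).
have uW : W \in unitmx := ev_unit R0 RD.
pose z := y *m invmx W.
have yE : y = \sum_i z 0 i *: ev n.+2 (R i).
  rewrite -[LHS](mulmxKV uW) -/z mulmx_sum_row.
  by apply: eq_bigr => i _; rewrite rowK.
pose zR i := z 0 i * (t * (br p (R i) * br q (R i))).
have : \sum_i join_mx (zR i *: ev n (R i)) (z 0 i *: param f (R i)) = 0.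
  rewrite -[RHS]yM yE mulmx_suml; apply: eq_bigr => i _.
  by rewrite -scalemxAl ev_Mu product_quad_eval join_mxZ scalerA.
rewrite join_mx_sum -[RHS]join_mx0 => /join_mx_inj[].
have b0 a : br a a = 0 by rewrite /br [a 0 0 * _]mulrC subrr.
have Rl (k : 'I_2) : R (lshift n.+1 k) = if k == 0 then p else q by rewrite /R (unsplitK (inl k)).
have Rr (k : 'I_n.+1) : R (rshift 2 k) = r k by rewrite /R (unsplitK (inr k)).
have Rl0 : R (lshift n.+1 0) = p by rewrite Rl.
have Rl1 : R (lshift n.+1 1) = q by rewrite Rl.
rewrite (sum_ord_2add (fun i => zR i *: ev n (R i))) /zR Rl0 Rl1 !b0.
rewrite mul0r !mulr0 !scale0r !add0r => E1.
rewrite (sum_ord_2add (fun i => z 0 i *: param f (R i))) Rl0 Rl1.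
(* The product form is nonzero at each [r], and the evaluations at these n+1 points are independent
   on the cofactors of degree n. *)
have z0 k : z 0 (rshift 2 k) = 0.
  pose v : 'rV[F]_n.+1 := \row_k zR (rshift 2 k).
  have v0 : v = 0.
    have ur : row_free (\matrix_i ev n (r i)) by rewrite row_free_unit; apply: ev_unit.
    apply: (row_free_inj ur); rewrite mul0mx mulmx_sum_row -[RHS]E1.
    by apply: eq_bigr => i _; rewrite rowK Rr /v /zR mxE Rr.
  have w0 : t * (br p (r k) * br q (r k)) != 0.
    by rewrite !mulf_neq0 // brC oppr_eq0.
  by have /rowP/(_ k) := v0; rewrite mxE [RHS]mxE /zR Rr => /eqP; rewrite mulf_eq0 (negPf w0) orbF => /eqP.
rewrite [X in _ + X]big1 => [|k _]; last by rewrite z0 scale0r.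
rewrite addr0 => E2; apply: contraT => npar.
have [za zb] := nonparallel_indep (param0 p0) (param0 q0) npar E2.
case/eqP: y0; rewrite yE (sum_ord_2add (fun i => z 0 i *: ev n.+2 (R i))) za zb.
by rewrite !scale0r !add0r big1 // => k _; rewrite z0 scale0r.
Qed.

(** The quadratic form of [u] splits as k lin p lin q, and its discriminant k^2 (br p q)^2 is
    nonzero, so [p] and [q] are different points. *)
Lemma support_double_point (u : 'rV[F]_3) : in_support I u -> discriminant u != 0 ->
  exists p q, [/\ p != 0, q != 0, br p q != 0 & (param f p == param f q)%MS].
Proof.
move=> [u0 /X2_supportP[y y0 yM]] Du.
have [k [[|p [|q [|? ?]]] [] // _ s0 gE]] :=
  form_factor (quadratic_homog (u 0 0) (u 0 1) (u 0 (inord 2))).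
have p0 : p != 0 by apply: s0; rewrite !inE eqxx.
have q0 : q != 0 by apply: s0; rewrite !inE eqxx orbT.
have E a b : u 0 0 * a ^+ 2 + u 0 1 * (a * b) + u 0 (inord 2) * b ^+ 2 =
    k * ((p 0 1 * a - p 0 0 * b) * (q 0 1 * a - q 0 0 * b)).
  have := congr1 (meval (fun i => if i == 0 then a else b)) gE.
  rewrite quadratic_eval /= => ->.
  by rewrite !big_cons big_nil mulr1 mevalZ mevalM /lin !mevalB !mevalZ !mevalXU.
have uE : u = k *: product_quad p q.
  have [e0 e1 e2] := product_quadE p q.
  (* The three coefficients are read off at (1, 0), (0, 1) and (1, 1). *)
  pose L a b := u 0 0 * a ^+ 2 + u 0 1 * (a * b) + u 0 (inord 2) * b ^+ 2.
  have H0 : u 0 0 = k * (p 0 1 * q 0 1).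
    by transitivity (L 1 0); [rewrite /L; ring | rewrite /L E; ring].
  have H2 : u 0 (inord 2) = k * (p 0 0 * q 0 0).
    by transitivity (L 0 1); [rewrite /L; ring | rewrite /L E; ring].
  have H1 : u 0 1 = k * - (p 0 1 * q 0 0 + p 0 0 * q 0 1).
    by transitivity (L 1 1 - u 0 0 - u 0 (inord 2)); [|rewrite {1}/L E H0 H2]; rewrite ?/L; ring.
  apply/rowP => j; rewrite !mxE.
  case: j => [[|[|[|j]]] hj] //=.
  - by rewrite -H0; congr (u 0 _); apply: val_inj.
  - by rewrite -H1; congr (u 0 _); apply: val_inj.
  - by rewrite -H2; congr (u 0 _); apply: val_inj; rewrite /= inordK.
have Dk : k ^+ 2 * br p q ^+ 2 != 0.
  by rewrite -product_quad_discriminant -discriminantZ -uE.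
have k0 : k != 0 by apply: contraNneq Dk => ->; rewrite expr0n mul0r.
have pq : br p q != 0 by apply: contraNneq Dk => ->; rewrite expr0n mulr0.
exists p, q; split=> //; apply: (product_quad_double_point k0 p0 q0 pq y0).
by rewrite -uE.
Qed.

End MinorDegree.

Section Cuspidal.
Variables (F : numClosedFieldType) (n : nat) (f : 3.-tuple {mpoly F[2]}).
Hypothesis f_homog : forall j, tnth f j \is n.+2.-homog.
Hypothesis f_gcd : gcd_is_one f.
Hypothesis f_gen : generically_one_to_one f.

(** Both sides say that no two points of P^1 have the same image. A coincidence over a nonsingular
    point is excluded by [nonsingular_fiber], so testing the singular points suffices. *)
Lemma cuspidal_support : cuspidal f <->
  forall u : 'rV[F]_3, in_support (X2 f n.+2) u -> discriminant u = 0.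
Proof.
have d1 : (1 < n.+2)%N by [].
split=> [cusp u Iu|supp P [oP _]].
  apply: contrapT => /eqP Du.
  have [p [q [p0 q0 pq fpq]]] := support_double_point f_homog f_gcd f_gen Iu Du.
  have Pp : in_fiber f (param f p) p by split=> //; apply: par_refl.
  have Pq : in_fiber f (param f p) q by split=> //; rewrite par_sym.
  have oP : on_curve f (param f p).
    by split; [apply: (param_neq0 f_homog) | exists p].
  case/negP: pq; rewrite br_eq0 //.
  have [sP|nP] := pselect (singular_point f (param f p)); last first.
    exact: (nonsingular_fiber f_homog d1 f_gcd f_gen oP nP Pp Pq).
  exact: (unibranch_injective f_homog d1 f_gcd f_gen oP (cusp _ sP) Pp Pq).
apply: (injective_unibranch f_homog d1 f_gcd f_gen oP) => p q [p0 Pp] [q0 Pq].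
rewrite -br_eq0 //; apply: contraT => pq.
have fpq : (param f p == param f q)%MS by apply: par_trans Pp _; rewrite par_sym.
have := supp _ (double_point_in_support f_homog p0 q0 pq fpq).
by rewrite product_quad_discriminant => /eqP; rewrite expf_eq0 (negPf pq).
Qed.

End Cuspidal.

Theorem proposition3p9 (R : realType) (d : nat) (d_ge3 : (3 <= d)%N)
    (f : 3.-tuple {mpoly R[i][2]})
    (f_homog : forall j, tnth f j \is d.-homog)
    (f_gcd : gcd_is_one f) (f_gen : generically_one_to_one f) :
  (exists delta : nat,
     [/\ total_delta f delta, scheme_degree (X2 f d) delta
       & delta = ((d - 1) * (d - 2) %/ 2)%N])
  /\ (cuspidal f <->
      forall u : 'rV[R[i]]_3, in_support (X2 f d) u ->
        u 0 1 ^+ 2 - 4%:R * u 0 0 * u 0 (inord 2) = 0).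
Proof.
(* Writing d as n+2 with n positive makes the truncated subtractions exact. *)
case: d d_ge3 f_homog => [|[|n]] // n_gt0 hf.
have binE : ((n.+2 - 1) * (n.+2 - 2) %/ 2)%N = 'C(n.+1, 2).
  by rewrite bin2 !subSS !subn0 divn2.
split; last exact: cuspidal_support.
exists 'C(n.+1, 2); split; last by rewrite binE.
  rewrite -binE; exact: total_deltaE.
exact: X2_degree.
Qed.
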